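(* Let $K:(0,\infty)\to(0,\infty)$ and $g_0:(0,\infty)\to\mathbb{R}$ be smooth functions, let $c\in\mathbb{R}$, and let $Q_c=(\rho_c,u_c)$, with $\rho_c:\mathbb{R}\to(0,\infty)$ and $u_c:\mathbb{R}\to\mathbb{R}$ smooth, be the profile of a (non-constant) one-dimensional solitary wave, i.e. $\rho(t,x,y)=\rho_c(x-ct)$, $u(t,x,y)=(u_c(x-ct),0)$ is a solution of the Euler-Korteweg system $$\partial_t\rho+\nabla\cdot(\rho u)=0,\qquad \partial_t u+u\cdot\nabla u+\nabla(g_0(\rho))=\nabla\Big(K(\rho)\Delta\rho+\tfrac12K'(\rho)|\nabla\rho|^2\Big),\qquad (x,y)\in\mathbb{R}^2,$$ and $$\lim_{x\to\pm\infty}(\rho_c(x),u_c(x))=(\rho_\infty,u_\infty),\qquad \rho_\infty>0 .$$ Assume that $$\rho_\infty\, g_0'(\rho_\infty)>(u_\infty-c)^2 .$$ Then the solitary wave is (linearly) unstable with respect to transverse perturbations: there exist $\sigma>0$, a real $k\neq 0$ and $U\in H^2(\mathbb{R})\times H^2(\mathbb{R})$, $U\neq0$, such that $$\sigma U=J\,L(k)\,U,$$ where $J$ and $L(k)$ are the operators defined in the context; that is, $(\eta,\varphi)=e^{\sigma t}e^{iky}U(x)$ solves the linearization about the solitary wave, in the frame moving with speed $c$, of the Euler-Korteweg system for potential flows $u=\nabla\varphi$.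
   Context: For potential flows $u=\nabla\varphi$ the system reads $$\partial_t\rho+\nabla\varphi\cdot\nabla\rho+\rho\Delta\varphi=0,\qquad \partial_t\varphi+\tfrac12|\nabla\varphi|^2+g_0(\rho)=K(\rho)\Delta\rho+\tfrac12K'(\rho)|\nabla\rho|^2 .$$ After changing $x$ into $x-ct$ (still denoted $x$), linearizing about $(\rho_c,u_c)$ and looking for perturbations of (density, potential) of the form $(\eta,\varphi)=e^{\sigma t}e^{iky}U(x)$, one gets $\sigma U=JL(k)U$ with $$J=\begin{pmatrix}0&1\\-1&0\end{pmatrix},$$ $$L(k)=\begin{pmatrix}-\partial_x\big(K(\rho_c)\partial_x\,\cdot\big)+k^2K(\rho_c)-m & -c\,\partial_x+u_c\,\partial_x\\[2pt] c\,\partial_x-\partial_x(u_c\,\cdot)& -\partial_x(\rho_c\,\partial_x\,\cdot)+\rho_c k^2\end{pmatrix},$$ $$m=K'(\rho_c)\rho_c''+\tfrac12K''(\rho_c)(\rho_c')^2-g_0'(\rho_c).$$ Here $L(k)$ acts on $L^2(\mathbb{R})\times L^2(\mathbb{R})$ with domain $H^2(\mathbb{R})\times H^2(\mathbb{R})$. Instability is meant in this linear (spectral) sense. *)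

(* Defs.v *)
From HB Require Import structures.
From mathcomp Require Import all_boot all_order all_algebra.
From mathcomp Require Import all_classical all_reals all_analysis.
From mathcomp Require Import complex.

Set Implicit Arguments.
Unset Strict Implicit.
Unset Printing Implicit Defensive.

Import Order.TTheory GRing.Theory Num.Theory.
Import numFieldNormedType.Exports.

Local Open Scope classical_set_scope.
Local Open Scope complex_scope.
Local Open Scope ring_scope.

(* Meant for open D: for such D the values of f outside D do not matter. *)
Definition smooth_on (R : realType) (D : set R) (f : R -> R) : Prop :=
  forall (n : nat) (x : R), D x -> derivable (derive1n n f) x 1.

Section EulerKorteweg.
Context {R : realType}.
Implicit Types (f rho u v : R -> R -> R -> R) (t x y : R) (K : R -> R).

Definition partial_t f t x y : R := derive1 (fun s => f s x y) t.
Definition partial_x f t x y : R := derive1 (fun s => f t s y) x.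
Definition partial_y f t x y : R := derive1 (fun s => f t x s) y.

Definition laplacian f t x y : R :=
  partial_x (partial_x f) t x y + partial_y (partial_y f) t x y.

Definition sqr_norm_grad f t x y : R :=
  partial_x f t x y ^+ 2 + partial_y f t x y ^+ 2.

Definition capillarity K rho t x y : R :=
  K (rho t x y) * laplacian rho t x y
  + 2^-1 * derive1 K (rho t x y) * sqr_norm_grad rho t x y.

Definition comp_density (g0 : R -> R) rho t x y : R := g0 (rho t x y).

(* The velocity field is (u, v). As derive1 is total, this says what it should for
   smooth positive rho and smooth u, v only. *)
Definition euler_korteweg K (g0 : R -> R) rho u v : Prop :=
  forall t x y,
  [/\ partial_t rho t x y
      + (partial_x (fun t x y => rho t x y * u t x y) t x y
         + partial_y (fun t x y => rho t x y * v t x y) t x y) = 0,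
      partial_t u t x y
      + (u t x y * partial_x u t x y + v t x y * partial_y u t x y)
      + partial_x (comp_density g0 rho) t x y
      = partial_x (capillarity K rho) t x y &
      partial_t v t x y
      + (u t x y * partial_x v t x y + v t x y * partial_y v t x y)
      + partial_y (comp_density g0 rho) t x y
      = partial_y (capillarity K rho) t x y].

End EulerKorteweg.

(* Elements of L^2(R) and H^2(R) are represented by functions R -> R[i], to be
   considered modulo equality almost everywhere. *)
Section Sobolev.
Context {R : realType}.
Implicit Types f g : R -> R[i].

Definition test_function (phi : R -> R) : Prop :=
  smooth_on setT phi /\ compact (closure [set x | phi x != 0]).

Definition weak_derivR (f g : R -> R) : Prop :=
  [/\ locally_integrable setT f, locally_integrable setT g &
      forall phi : R -> R, test_function phi ->
        \int[lebesgue_measure]_(x in setT) (f x * derive1 phi x)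
        = - \int[lebesgue_measure]_(x in setT) (g x * phi x)].

Definition weak_deriv f g : Prop :=
  weak_derivR (fun x => complex.Re (f x)) (fun x => complex.Re (g x)) /\
  weak_derivR (fun x => complex.Im (f x)) (fun x => complex.Im (g x)).

Definition in_L2 f : Prop :=
  (fun x => complex.Re (f x)) \in Lfun lebesgue_measure 2%:E /\
  (fun x => complex.Im (f x)) \in Lfun lebesgue_measure 2%:E.

Definition in_H2 f : Prop :=
  in_L2 f /\
  exists f1 f2, [/\ weak_deriv f f1, in_L2 f1, weak_deriv f1 f2 & in_L2 f2].

End Sobolev.

Section Linearization.
Context {R : realType}.
Implicit Types (K rhoc uc : R -> R) (c k : R).
Implicit Types U V : (R -> R[i]) * (R -> R[i]).

Definition potential_m K (g0 : R -> R) rhoc (x : R) : R :=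
  derive1 K (rhoc x) * derive1n 2 rhoc x
  + 2^-1 * derive1n 2 K (rhoc x) * derive1 rhoc x ^+ 2
  - derive1 g0 (rhoc x).

(* The graph of L(k): [linL K g0 c rhoc uc k U V] means L(k) U = V. Every
   derivative falling on U is a weak derivative, determined only almost
   everywhere. With U = (eta, phi): deta = eta', dphi = phi',
   dKdeta = (K(rhoc) eta')', dueta = (uc eta)', drhodphi = (rhoc phi')'. *)
Definition linL K (g0 : R -> R) c rhoc uc k U V : Prop :=
  [/\ in_H2 U.1, in_H2 U.2 &
  exists deta dphi dKdeta dueta drhodphi : R -> R[i],
  [/\ weak_deriv U.1 deta /\ weak_deriv U.2 dphi,
      weak_deriv (fun x => (K (rhoc x))%:C * deta x) dKdeta,
      weak_deriv (fun x => (uc x)%:C * U.1 x) dueta,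
      weak_deriv (fun x => (rhoc x)%:C * dphi x) drhodphi &
      \forall x \ae lebesgue_measure,
        V.1 x = (- dKdeta x + (k ^+ 2 * K (rhoc x))%:C * U.1 x
                 - (potential_m K g0 rhoc x)%:C * U.1 x)
                + (- c%:C * dphi x + (uc x)%:C * dphi x) /\
        V.2 x = (c%:C * deta x - dueta x)
                + (- drhodphi x + (rhoc x * k ^+ 2)%:C * U.2 x)]].

Definition opJ V : (R -> R[i]) * (R -> R[i]) := (V.2, fun x => - V.1 x).

End Linearization.

(* Main.v *)
(* After the first integrals of the profile are taken, [rhoc'] solves [(a r')' = - q r] with
   [a = K(rhoc)] and [q = m + (uc - c)^2 / rhoc], and it has exactly one zero; the subsonic
   condition makes [q] negative at infinity. Hence the quadratic form of [L(k)] is positive on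
   the hyperplane of the [U = (eta, phi)] for which [eta] vanishes at that zero (Jacobi's
   identity), but for small [k <> 0] it takes a negative value. On a finite dimensional space
   stable under [J] such a form has negative determinant, whereas an antisymmetric matrix
   without kernel has positive determinant; so the segment between them contains a singular
   matrix, which is a Galerkin solution of [L(k) U = - sigma J U] with [sigma > 0]. The forms
   keep [sigma] away from [0] and infinity and, after normalising the integral of
   [max(q, 0) eta^2], bound [U] in H^1. Along an ultrafilter on the finite sets of test
   functions the Galerkin solutions converge locally uniformly; the limit is nonzero because
   of the normalisation, and the lemma of du Bois-Reymond makes it a classical solution. *)
Require Import Defs.
From mathcomp Require Import all_boot all_order all_algebra.
From mathcomp Require Import all_classical all_reals all_analysis.
From mathcomp Require Import complex.
From mathcomp Require Import measurable_realfun ring lra.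

Set Implicit Arguments.
Unset Strict Implicit.
Unset Printing Implicit Defensive.

Import Order.TTheory GRing.Theory Num.Theory.
Import numFieldNormedType.Exports.

Local Open Scope classical_set_scope.
Local Open Scope complex_scope.
Local Open Scope ring_scope.

(** The form of [L(k)] is the integral of [a eta'^2 - q eta^2], plus that of
    [p (phi' + w eta / p)^2], plus [k^2] times that of [a eta^2 + p phi^2]. A suitable [phi] makes
    the middle square as small as desired, so the signs are those of a one-dimensional
    Sturm-Liouville form, whose translation mode [rhoc'] has a single zero and allows a single
    negative direction. The last term is what [k <> 0] contributes: it controls the mass.

    The obstacle is compactness: on the whole line Galerkin solutions could drift to infinity and
    leave nothing in the limit. The positive part of [q] is all that prevents the form from being
    coercive, and it has compact support. Hence one normalisation serves twice: it bounds the full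
    H^1 norm, and it is an integral over a fixed window, which local uniform convergence preserves.
    No spectral theory of unbounded operators enters.

    Integrals of continuous functions are handled as differences of primitives; the Lebesgue
    integral appears only to produce primitives and, at the end, to reach weak derivatives and
    L^2. *)

Section Calculus.
Context {R : realType}.
Implicit Types (f g h F G : R -> R) (a b c x y : R).

(** A relation instead of the total function [derive1]: differentiability and the value of the
    derivative travel together, and the derivative may be written in any convenient form. *)
Definition has_deriv f g := forall x, is_derive x (1 : R) f (g x).

Lemma has_deriv_ext f f1 g g1 :
  has_deriv f g -> f =1 f1 -> g =1 g1 -> has_deriv f1 g1.
Proof. by move=> fg /funext <- /funext <-. Qed.

Lemma has_derivE f g : has_deriv f g -> derive1 f = g.
Proof. by move=> fg; apply/funext => x; rewrite derive1E; exact: (@derive_val _ _ _ _ _ _ _ (fg x)). Qed.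

Lemma derivable_has_deriv f :
  (forall x, derivable f x 1) -> has_deriv f (derive1 f).
Proof. by move=> df x; rewrite derive1E; exact/derivableP. Qed.

Lemma has_deriv_continuous f g : has_deriv f g -> continuous f.
Proof.
move=> fg x; apply: differentiable_continuous; apply/derivable1_diffP.
exact: (@ex_derive _ _ _ _ _ _ _ (fg x)).
Qed.

Lemma has_deriv_cst c : has_deriv (fun=> c) (fun=> 0).
Proof. by move=> x; apply: is_derive_cst. Qed.

Lemma has_deriv_id : has_deriv id (fun=> 1).
Proof. by move=> x; apply: is_derive_id. Qed.

Lemma has_derivD f f1 g g1 : has_deriv f f1 -> has_deriv g g1 ->
  has_deriv (fun x => f x + g x) (fun x => f1 x + g1 x).
Proof. by move=> ff gg x; apply: (@is_deriveD _ _ _ f g). Qed.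

Lemma has_derivN f f1 : has_deriv f f1 -> has_deriv (fun x => - f x) (fun x => - f1 x).
Proof. by move=> ff x; apply: (@is_deriveN _ _ _ f). Qed.

Lemma has_derivB f f1 g g1 : has_deriv f f1 -> has_deriv g g1 ->
  has_deriv (fun x => f x - g x) (fun x => f1 x - g1 x).
Proof. by move=> ff gg x; apply: (@is_deriveB _ _ _ f g). Qed.

Lemma has_derivM f f1 g g1 : has_deriv f f1 -> has_deriv g g1 ->
  has_deriv (fun x => f x * g x) (fun x => f1 x * g x + f x * g1 x).
Proof.
move=> ff gg x; apply: is_derive_eq (is_deriveM (ff x) (gg x)) _.
by rewrite addrC; congr (_ + _); rewrite [LHS]mulrC.
Qed.

Lemma has_derivMl c f f1 : has_deriv f f1 -> has_deriv (fun x => c * f x) (fun x => c * f1 x).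
Proof.
move=> ff; apply: (has_deriv_ext (has_derivM (has_deriv_cst c) ff)) => // x.
by rewrite mul0r add0r.
Qed.

Lemma has_deriv_sqr f f1 : has_deriv f f1 ->
  has_deriv (fun x => f x ^+ 2) (fun x => 2 * (f x * f1 x)).
Proof.
move=> ff; apply: (has_deriv_ext (has_derivM ff ff)) => x; first by rewrite expr2.
ring.
Qed.

Lemma has_derivV f f1 : has_deriv f f1 -> (forall x, f x != 0) ->
  has_deriv (fun x => (f x)^-1) (fun x => - f1 x / f x ^+ 2).
Proof.
move=> ff f0 x; apply: is_derive_eq (is_deriveV (f0 x) (ff x)) _.
by rewrite [LHS]mulrC mulrN mulNr.
Qed.

Lemma has_deriv_quotient (a a1 f h : R -> R) : has_deriv a a1 -> (forall x, a x != 0) ->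
  has_deriv (fun x => a x * f x) h -> has_deriv f (fun x => (h x - a1 x * f x) / a x).
Proof.
move=> da a0 dh.
apply: (has_deriv_ext (has_derivM dh (has_derivV da a0))) => x; field; exact: a0.
Qed.

Lemma has_deriv_comp_derivable f g g1 : (forall x, derivable f (g x) 1) -> has_deriv g g1 ->
  has_deriv (fun x => f (g x)) (fun x => derive1 f (g x) * g1 x).
Proof.
move=> df dg x; have dfx : derivable f (g x) 1 := df x.
have dgx : derivable g x 1 by exact: (@ex_derive _ _ _ _ _ _ _ (dg x)).
have dfg : derivable (f \o g) x 1.
  by apply/derivable1_diffP/differentiable_comp; exact/derivable1_diffP.
apply: (DeriveDef dfg); rewrite -derive1E (derive1_comp dgx dfx).
by rewrite (has_derivE dg).
Qed.

Lemma has_deriv_comp f f1 g g1 : has_deriv f f1 -> has_deriv g g1 ->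
  has_deriv (fun x => f (g x)) (fun x => f1 (g x) * g1 x).
Proof.
move=> ff; rewrite -(has_derivE ff); apply: has_deriv_comp_derivable => x.
exact: (@ex_derive _ _ _ _ _ _ _ (ff _)).
Qed.

Lemma has_deriv_cfixed f g : has_deriv f g -> forall a b, {within `[a, b], continuous f}.
Proof. by move=> fg a b; apply: continuous_subspaceT; exact: has_deriv_continuous fg. Qed.

Lemma has_deriv_ge f g a b : has_deriv f g -> a <= b ->
  (forall x, a <= x <= b -> 0 <= g x) -> f a <= f b.
Proof.
move=> fg ab g0.
have [c cab E] := MVT_segment ab (fun x _ => fg x) (has_deriv_cfixed fg (a := a) (b := b)).
by rewrite -subr_ge0 E mulr_ge0 ?subr_ge0 // g0.
Qed.

Lemma has_deriv_cst_on f g a b : has_deriv f g -> a <= b ->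
  (forall x, a <= x <= b -> g x = 0) -> f a = f b.
Proof.
move=> fg ab g0; apply/eqP; rewrite eq_le (has_deriv_ge fg) //=; last by move=> x /g0 ->.
rewrite -lerN2; apply: (has_deriv_ge (has_derivN fg)) => // x /g0 ->.
by rewrite oppr0.
Qed.

Lemma has_deriv_diff f F G : has_deriv F f -> has_deriv G f -> forall a b,
  F b - F a = G b - G a.
Proof.
move=> Ff Gf a b.
have H := has_derivB Ff Gf.
suff E : F a - G a = F b - G b by lra.
have [ab|/ltW ba] := leP a b; [|apply/esym];
  by apply: (has_deriv_cst_on H) => // x _; rewrite subrr.
Qed.

Lemma continuous_integrable_itv f a b : continuous f ->
  (@lebesgue_measure R).-integrable `[a, b] (EFin \o f).
Proof.
move=> cf; apply: continuous_compact_integrable; first exact: segment_compact.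
exact: continuous_subspaceT.
Qed.

(** The integral from [- n.+1] is a primitive only for [|x| < n.+1]. Normalised to vanish at 0,
    these local primitives agree on overlaps and glue to one on the whole line. *)
Lemma continuous_has_primitive f : continuous f -> exists F, has_deriv F f.
Proof.
move=> cf.
pose P n x : R := \int[lebesgue_measure]_(t in `[- n.+1%:R, x]) f t.
have PE n x : `|x| < n.+1%:R -> is_derive x (1 : R) (P n) (f x).
  rewrite ltr_norml => /andP[nx xn].
  have [dP E] := @continuous_FTC1 R f (BLeft (- n.+1%:R)) x _ xn
    (@continuous_integrable_itv f (- n.+1%:R) (n.+1%:R) cf) nx (cf x).
  by apply: (DeriveDef dP); rewrite -derive1E E.
have PP n m x : `|x| < n.+1%:R -> `|x| < m.+1%:R -> P n x - P n 0 = P m x - P m 0.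
  move=> xn xm; pose H := P n \- P m.
  have dH y : `|y| <= `|x| -> is_derive y (1 : R) H 0.
    move=> yx; rewrite -(subrr (f y)).
    by apply: is_deriveB; apply: PE; apply: le_lt_trans yx _.
  suff : H x = H 0 by rewrite /H /=; lra.
  have HM u v : u <= v -> `|u| <= `|x| -> `|v| <= `|x| -> H u = H v.
    move=> uv ux vx.
    have I y : u <= y <= v -> `|y| <= `|x|.
      case/andP=> uy yv; rewrite ler_norml; apply/andP; split.
        by apply: le_trans uy; move: ux; rewrite ler_norml => /andP[].
      by apply: (le_trans yv); move: vx; rewrite ler_norml => /andP[].
    have [y||c _] := @MVT_segment R H (fun=> 0) u v uv.
    - by rewrite in_itv /= => /andP[uy yv]; apply/dH/I; rewrite !ltW.
    - apply: derivable_within_continuous => y; rewrite in_itv /= => /I /dH.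
      by move=> dy; exact: (@ex_derive _ _ _ _ _ _ _ dy).
    - by rewrite mul0r => /eqP; rewrite subr_eq0 => /eqP ->.
  have [x0|x0] := leP 0 x; first by rewrite (HM 0 x) // normr0.
  by apply: HM; rewrite ?normr0 // ltW.
have ub x : exists n : nat, `|x| < n.+1%:R.
  exists (Num.truncn `|x|).
  by case/andP: (truncn_itv (normr_ge0 x)).
have [N NP] := choice ub.
exists (fun x => P (N x) x - P (N x) 0) => x.
have dQ : is_derive x (1 : R) (fun y => P (N x) y - P (N x) 0) (f x).
  rewrite -(subr0 (f x)).
  by apply: (@is_deriveB _ _ _ (P (N x)) (cst _)); apply: PE.
apply: near_eq_is_derive dQ.
have : \forall y \near x, `|y| < (N x).+1%:R.
  have : open [set y : R | `|y| < (N x).+1%:R].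
    apply: (@open_comp _ _ (fun y : R => `|y|) [set z | z < (N x).+1%:R]).
      by move=> y _; apply: norm_continuous.
    exact: open_lt.
  by move=> o; apply: (open_nbhs_nbhs); split.
by apply: filterS => y yx; apply: PP.
Qed.

(** Any primitive will do: it is used through differences of values, which do not depend on the
    choice. *)
Definition primitive f : R -> R := xget (fun=> 0) [set F | has_deriv F f].

(* The integral of [f] when [f] is continuous; junk otherwise. *)
Definition intg a b f : R := primitive f b - primitive f a.

Lemma primitiveP f : continuous f -> has_deriv (primitive f) f.
Proof.
move=> /continuous_has_primitive[F FP].
by rewrite /primitive; case: xgetP => [G ->//|/(_ F)].
Qed.

Lemma intgE f F a b : has_deriv F f -> intg a b f = F b - F a.
Proof.
move=> Ff; rewrite /intg; apply: (@has_deriv_diff f) => //.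
by rewrite /primitive; case: xgetP => [G ->//|/(_ F)].
Qed.

Lemma eq_intg a b f g : (forall x, f x = g x) -> intg a b f = intg a b g.
Proof. by move=> /funext ->. Qed.

Lemma intgD a b f g : continuous f -> continuous g ->
  intg a b (fun x => f x + g x) = intg a b f + intg a b g.
Proof.
move=> /primitiveP pf /primitiveP pg; rewrite (intgE _ _ (has_derivD pf pg)) /intg.
ring.
Qed.

Lemma intgZ a b c f : continuous f -> intg a b (fun x => c * f x) = c * intg a b f.
Proof. by move=> /primitiveP pf; rewrite (intgE _ _ (has_derivMl c pf)) /intg; ring. Qed.

Lemma intgN a b f : continuous f -> intg a b (fun x => - f x) = - intg a b f.
Proof. by move=> /primitiveP pf; rewrite (intgE _ _ (has_derivN pf)) /intg; ring. Qed.

Lemma intgB a b f g : continuous f -> continuous g ->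
  intg a b (fun x => f x - g x) = intg a b f - intg a b g.
Proof.
move=> /primitiveP pf /primitiveP pg; rewrite (intgE _ _ (has_derivB pf pg)) /intg.
ring.
Qed.

Lemma intg_chasles a b c f : intg a b f + intg b c f = intg a c f.
Proof. by rewrite /intg; ring. Qed.

Lemma intg_cst a b c : intg a b (fun=> c) = c * (b - a).
Proof.
rewrite (intgE _ _ (F := fun x => c * x)); first by rewrite mulrBr.
apply: (has_deriv_ext (has_derivMl c has_deriv_id)) => // x; exact: mulr1.
Qed.

Lemma intg0 a b : intg a b (fun=> 0) = 0.
Proof. by rewrite intg_cst mul0r. Qed.

Lemma intg_ge0 a b f : a <= b -> continuous f ->
  (forall x, a <= x <= b -> 0 <= f x) -> 0 <= intg a b f.
Proof.
by move=> ab /primitiveP pf f0; rewrite subr_ge0; apply: (has_deriv_ge pf).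
Qed.

Lemma le_intg a b f g : a <= b -> continuous f -> continuous g ->
  (forall x, a <= x <= b -> f x <= g x) -> intg a b f <= intg a b g.
Proof.
move=> ab cf cg fg; rewrite -subr_ge0 -intgB //; apply: intg_ge0 => //.
  by move=> x; apply: cvgB; [exact: cg|exact: cf].
by move=> x /fg; rewrite subr_ge0.
Qed.

Lemma eq_intg_on a b f g : a <= b -> continuous f -> continuous g ->
  (forall x, a <= x <= b -> f x = g x) -> intg a b f = intg a b g.
Proof.
by move=> ab cf cg fg; apply/eqP; rewrite eq_le !le_intg // => x /fg ->.
Qed.

Lemma intg_support a b c d f : c <= a -> a <= b -> b <= d -> continuous f ->
  (forall x, x <= a -> f x = 0) -> (forall x, b <= x -> f x = 0) ->
  intg c d f = intg a b f.
Proof.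
move=> ca ab bd cf fa fb.
rewrite -(intg_chasles c a d) -(intg_chasles a b d).
rewrite (@eq_intg_on c a f (fun=> 0)) ?(@eq_intg_on b d f (fun=> 0)) //.
- by rewrite !intg0 add0r addr0.
- exact: cst_continuous.
- by move=> x /andP[? _]; apply: fb.
- exact: cst_continuous.
- by move=> x /andP[_ ?]; apply: fa.
Qed.

Lemma intg_sub a b c d f : c <= a -> a <= b -> b <= d -> continuous f ->
  (forall x, 0 <= f x) -> intg a b f <= intg c d f.
Proof.
move=> ca ab bd cf f0.
rewrite -(intg_chasles c a d) -(intg_chasles a b d).
have := @intg_ge0 c a f ca cf (fun x _ => f0 x).
have := @intg_ge0 b d f bd cf (fun x _ => f0 x).
lra.
Qed.

(** The primitive is monotone and takes equal values at both ends, so it is constant and its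
    derivative vanishes inside. *)
Lemma intg_eq0 a b f : a <= b -> continuous f -> (forall x, a <= x <= b -> 0 <= f x) ->
  intg a b f = 0 -> forall x, a < x < b -> f x = 0.
Proof.
move=> ab cf f0 I0 x /andP[ax xb].
have pf := primitiveP cf; set F := primitive f in pf.
have mono u v : a <= u -> u <= v -> v <= b -> F u <= F v.
  move=> au uv vb; apply: (has_deriv_ge pf) => // y /andP[uy yv].
  by apply: f0; rewrite (le_trans au uy) (le_trans yv vb).
have Fc y : a <= y <= b -> F y = F a.
  case/andP=> ay yb; apply/eqP; rewrite eq_le; apply/andP; split; last exact: mono.
  by apply: (le_trans (mono _ _ ay yb (lexx b))); rewrite -subr_le0; move: I0; rewrite /intg -/F => ->.
have dF : is_derive x (1 : R) F 0.
  apply: (@near_eq_is_derive _ _ _ (cst (F a)) F) => //.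
  have : \forall y \near x, y \in `]a, b[ by apply: near_in_itvoo; rewrite in_itv /= ax xb.
  apply: filterS => y; rewrite in_itv /= => /andP[ay yb].
  by rewrite Fc // !ltW.
by rewrite -(@derive_val _ _ _ _ _ _ _ (pf x)) (@derive_val _ _ _ _ _ _ _ dF).
Qed.

Lemma intg_byparts a b f f1 g g1 : has_deriv f f1 -> has_deriv g g1 ->
  continuous f1 -> continuous g1 ->
  intg a b (fun x => f1 x * g x) = f b * g b - f a * g a - intg a b (fun x => f x * g1 x).
Proof.
move=> ff gg cf cg; rewrite -(intgE _ _ (has_derivM ff gg)) intgD; first ring.
  by move=> x; apply: cvgM; [exact: cf|exact: (has_deriv_continuous gg)].
by move=> x; apply: cvgM; [exact: (has_deriv_continuous ff)|exact: cg].
Qed.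

End Calculus.

(** * Signs of determinants along segments of matrices *)

Section Determinants.
Context {F : rcfType}.

(** Along the segment the determinant is a polynomial in [t], and polynomials over a real closed
    field have the intermediate value property. *)
Lemma det_segment_root n (A B : 'M[F]_n) : \det A < 0 -> 0 < \det B ->
  exists2 t, 0 < t < 1 & \det ((1 - t) *: A + t *: B) = 0.
Proof.
move=> A0 B0.
pose p := \det (map_mx polyC A + 'X *: map_mx polyC (B - A)).
have pE t : p.[t] = \det ((1 - t) *: A + t *: B).
  rewrite -/(horner_eval t p) -det_map_mx; congr (\det _).
  apply/matrixP => i j; rewrite !mxE /= /horner_eval !hornerE.
  ring.
have p0 : p.[0] = \det A by rewrite pE subr0 scale1r scale0r addr0.
have p1 : p.[1] = \det B by rewrite pE subrr scale1r scale0r add0r.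
have [||t /andP[t0 t1] /eqP] := @poly_ivt F p 0 1.
- exact: ler01.
- by rewrite p0 p1 !ltW.
move=> pt; exists t; last by rewrite -pE.
rewrite !lt_neqAle t0 t1 !andbT; apply/andP; split.
  by apply/eqP => t00; move: A0; rewrite -p0 [X in p.[X]]t00 pt ltxx.
by apply/eqP => t00; move: B0; rewrite -p1 -t00 pt ltxx.
Qed.

Lemma det_segment_gt0 n (A B : 'M[F]_n) :
  (forall t x, 0 <= t < 1 -> x *m ((1 - t) *: A + t *: B) = 0 -> x = 0 :> 'rV_n) ->
  0 < \det B -> 0 < \det A.
Proof.
move=> AB B0; rewrite ltNge; apply/negP; rewrite le_eqVlt => /orP[/eqP A0|A0].
  have /eqP/det0P[x x0 xA] := A0.
  move/eqP: x0; apply; apply: (AB 0); first by rewrite lexx ltr01.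
  by rewrite subr0 scale1r scale0r addr0.
have [t /andP[t0 t1] /eqP/det0P[x x0 xA]] := det_segment_root A0 B0.
by move/eqP: x0; apply; apply: (AB t) => //; rewrite ltW.
Qed.

Lemma mulmx_tr_gt0 n (x : 'rV[F]_n) : x != 0 -> 0 < (x *m x^T) 0 0.
Proof.
move=> x0; rewrite mxE lt_neqAle; apply/andP; split; last first.
  by apply: sumr_ge0 => i _; rewrite mxE -expr2 sqr_ge0.
rewrite eq_sym; apply: contra x0 => /eqP H; apply/eqP/rowP => i; rewrite mxE.
have := psumr_eq0P (F := fun i => x 0 i * x^T i 0) (P := xpredT).
move=> /(_ _ H i isT); rewrite mxE -expr2 => /(_ _)/eqP.
rewrite sqrf_eq0 => /(_ _)/eqP; apply=> j _.
by rewrite mxE -expr2 sqr_ge0.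
Qed.

(** Deform [J] to the identity: the quadratic form of [(1 - t) J + t I] is [t |x|^2], because the
    antisymmetric part contributes nothing, so no singular matrix is met. *)
Lemma det_antisym_gt0 n (J : 'M[F]_n) : J^T = - J ->
  (forall x : 'rV_n, x *m J = 0 -> x = 0) -> 0 < \det J.
Proof.
move=> JN J0; apply: (@det_segment_gt0 _ J 1%:M); last by rewrite det1 ltr01.
move=> t x /andP[t0 _]; move: t0; rewrite le_eqVlt => /orP[/eqP <-|t0].
  by rewrite subr0 scale1r scale0r addr0; exact: J0.
move=> xJ; apply/eqP; apply: contraT => x0.
have : (x *m ((1 - t) *: J + t *: 1%:M) *m x^T) 0 0 = 0 by rewrite xJ mul0mx mxE.
have xJx : (x *m J *m x^T) 0 0 = 0.
  have : (x *m J *m x^T)^T 0 0 = - (x *m J *m x^T) 0 0.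
    by rewrite !trmx_mul trmxK JN mulNmx mulmxN mulmxA mxE.
  by rewrite mxE; lra.
rewrite mulmxDr mulmxDl -!scalemxAr -!scalemxAl mxE mxE xJx mulr0 add0r mulmx1 mxE.
by move/eqP; rewrite mulf_eq0 (gt_eqF t0) (gt_eqF (mulmx_tr_gt0 x0)).
Qed.

(** The block matrices [A] and [C] satisfy [A B = B C] with [B] unipotent, so they have equal
    determinants; each is block triangular. *)
Lemma det_rank1_update n (l : 'cV[F]_n) s :
  \det (1%:M - s *: (l *m l^T)) = 1 - s * (l^T *m l) 0 0.
Proof.
pose A := block_mx (1%:M - s *: (l *m l^T)) l 0 (1%:M : 'M[F]_1).
pose B := block_mx (1%:M : 'M[F]_n) 0 (s *: l^T) (1%:M : 'M[F]_1).
pose C := block_mx 1%:M l 0 (1%:M - s *: (l^T *m l)).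
have E : A *m B = B *m C.
  rewrite !mulmx_block !mulmx0 !mul0mx !mul1mx !mulmx1 !addr0 !add0r.
  by rewrite -scalemxAr -scalemxAl subrK addrC subrK.
have : \det (A *m B) = \det (B *m C) by rewrite E.
rewrite !det_mulmx !det_ublock !det_lblock !det1 !mulr1 !mul1r => ->.
by rewrite det_mx11 !mxE.
Qed.

(* The sign of the determinant is read off by deforming [L], within the forms of this
   kind, to an explicit rank one perturbation of the identity. *)
Lemma det_index1_lt0 n (L : 'M[F]_n) (l : 'cV[F]_n) (u : 'rV[F]_n) :
  L^T = L -> (u *m L *m u^T) 0 0 < 0 ->
  (forall x : 'rV_n, x *m l = 0 -> x != 0 -> 0 < (x *m L *m x^T) 0 0) ->
  \det L < 0.
Proof.
move=> LT Lu Ll.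
have u0 : u != 0 by apply/eqP => u0; move: Lu; rewrite u0 !mul0mx mxE ltxx.
have ul0 : (u *m l) 0 0 != 0.
  apply/eqP => H; have ul : u *m l = 0 by rewrite [u *m l]mx11_scalar H raddf0.
  by have := Ll _ ul u0; rewrite ltNge (ltW Lu).
have l0 : l^T != 0.
  by apply: contra ul0 => /eqP H; rewrite -[l]trmxK H trmx0 mulmx0 mxE.
have nl : 0 < (l^T *m l) 0 0 by have := mulmx_tr_gt0 l0; rewrite trmxK.
set nu := (u *m u^T) 0 0; set ul := (u *m l) 0 0 in ul0; set N := (l^T *m l) 0 0 in nl.
have nu0 : 0 < nu by exact: mulmx_tr_gt0.
(* The first summand makes [M] at most [-1] at [u], the second makes [1 - s N], the determinant of
   [M], less than [-1]. *)
pose s := (nu + 1) / ul ^+ 2 + 2 / N.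
pose M := 1%:M - s *: (l *m l^T).
have qM (x : 'rV_n) : (x *m M *m x^T) 0 0 = (x *m x^T) 0 0 - s * ((x *m l) 0 0) ^+ 2.
  rewrite mulmxBr mulmxBl mulmx1 -scalemxAr -scalemxAl mxE; congr (_ + _).
  rewrite mxE mxE; congr (- (_ * _)).
  rewrite mulmxA -[_ *m l^T *m _]mulmxA mxE big_ord1 expr2; congr (_ * _).
  by rewrite -trmx_mul mxE.
have dM : \det M < 0.
  rewrite det_rank1_update -/N /s mulrDl divfK ?gt_eqF //.
  have : 0 < (nu + 1) / ul ^+ 2 * N.
    rewrite mulr_gt0 // divr_gt0 //; first by rewrite addr_gt0.
    by rewrite lt_neqAle sqr_ge0 eq_sym sqrf_eq0 ul0.
  lra.
have uM : (u *m M *m u^T) 0 0 < 0.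
  rewrite qM -/nu -/ul /s mulrDl divfK ?sqrf_eq0 //.
  have : 0 <= 2 / N * ul ^+ 2 by rewrite mulr_ge0 ?sqr_ge0 // divr_ge0 // ltW.
  lra.
have Ml (x : 'rV_n) : x *m l = 0 -> x != 0 -> 0 < (x *m M *m x^T) 0 0.
  by move=> xl x0; rewrite qM xl [X in X ^+ 2]mxE expr0n mulr0 subr0 mulmx_tr_gt0.
have MT : M^T = M by rewrite /M raddfB /= trmx1 linearZ /= trmx_mul trmxK.
rewrite ltNge; apply/negP => L0.
(* A kernel vector [x] of [H] cannot lie in the hyperplane [l = 0], where [H] is positive. Otherwise
   [u = al x + h] with [h] in the hyperplane, and [H] takes the same value at [u] and at [h]:
   negative and non-negative at once. *)
have K t x : 0 <= t <= 1 -> x *m ((1 - t) *: L + t *: M) = 0 -> x = 0 :> 'rV_n.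
  case/andP=> t0 t1; set H := (1 - t) *: L + t *: M => xH.
  have qH (y : 'rV_n) : (y *m H *m y^T) 0 0 = (1 - t) * (y *m L *m y^T) 0 0 + t * (y *m M *m y^T) 0 0.
    by rewrite /H mulmxDr mulmxDl -!scalemxAr -!scalemxAl !mxE.
  have HT : H^T = H by rewrite /H linearD /= !linearZ /= LT MT.
  have qHl (y : 'rV_n) : y *m l = 0 -> y != 0 -> 0 < (y *m H *m y^T) 0 0.
    move=> yl y0; have Ly := Ll _ yl y0; have My := Ml _ yl y0; rewrite qH; nra.
  have qHu : (u *m H *m u^T) 0 0 < 0 by rewrite qH; nra.
  apply/eqP; apply: contraT => x0.
  have [/eqP xl|xl] := boolP ((x *m l) 0 0 == 0).
    have := qHl x; rewrite [x *m l]mx11_scalar xl raddf0 => /(_ erefl x0).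
    by rewrite xH mul0mx mxE ltxx.
  pose al := ul / (x *m l) 0 0; pose h := u - al *: x.
  have hl : h *m l = 0.
    rewrite mulmxBl -scalemxAl [u *m l]mx11_scalar [x *m l]mx11_scalar -/ul.
    by rewrite scale_scalar_mx /al divfK // subrr.
  have Hx : H *m x^T = 0 by rewrite -[H]trmxK -trmx_mul HT xH trmx0.
  have uE : u = al *: x + h by rewrite addrC subrK.
  have uT : u^T = al *: x^T + h^T by rewrite uE linearD linearZ.
  move: qHu; rewrite uT {1}uE [_ *m H]mulmxDl -scalemxAl xH scaler0 add0r.
  rewrite mulmxDr -scalemxAr -[h *m H *m x^T]mulmxA Hx mulmx0 scaler0 add0r.
  have [->|h0] := eqVneq h 0; first by rewrite !mul0mx mxE ltxx.
  by rewrite ltNge (ltW (qHl _ hl h0)).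
have Lp : 0 < \det L.
  rewrite lt_neqAle L0 andbT eq_sym; apply/eqP => /eqP/det0P[x x0 xL].
  move/eqP: x0; apply; apply: (K 0); first by rewrite lexx ler01.
  by rewrite subr0 scale1r scale0r addr0.
have [t /andP[t0 t1] /eqP/det0P[x x0 xA]] := det_segment_root dM Lp.
(* The segment was run from [M], the negative end, to [L]; in the parametrisation of [K] this is
   [1 - t]. *)
move/eqP: x0; apply; apply: (K (1 - t)); first by rewrite subr_ge0 gerBl !ltW.
by rewrite subKr addrC.
Qed.

(** The singular matrix [(1 - t) L + t J] lies strictly inside the segment; division by [1 - t]
    gives the rate [s = t / (1 - t)]. *)
Lemma index1_antisym_pencil n (L J : 'M[F]_n) (l : 'cV[F]_n) (u : 'rV[F]_n) :
  L^T = L -> (u *m L *m u^T) 0 0 < 0 ->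
  (forall x : 'rV_n, x *m l = 0 -> x != 0 -> 0 < (x *m L *m x^T) 0 0) ->
  J^T = - J -> (forall x : 'rV_n, x *m J = 0 -> x = 0) ->
  exists s (x : 'rV_n), [/\ 0 < s, x != 0 & x *m L + s *: (x *m J) = 0].
Proof.
move=> LT Lu Ll JN J0.
have [t /andP[t0 t1] /eqP/det0P[x x0 xA]] :=
  det_segment_root (det_index1_lt0 LT Lu Ll) (det_antisym_gt0 JN J0).
have t1' : 0 < 1 - t by rewrite subr_gt0.
exists (t / (1 - t)), x; split=> //; first exact: divr_gt0.
have : (1 - t) *: (x *m L + (t / (1 - t)) *: (x *m J)) = 0.
  by rewrite scalerDr scalerA mulrCA divff ?gt_eqF // mulr1 !scalemxAr -mulmxDr.
by move/eqP; rewrite scaler_eq0 (gt_eqF t1') /= => /eqP.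
Qed.

End Determinants.

(** * Finite dimensional reduction of a pair of bilinear forms *)

Section Galerkin.
Context {F : rcfType} {W : lmodType F}.
Implicit Types (D S : set W) (b : W -> W -> F) (u v w : W).

Definition linear_subspace D := D 0 /\ forall a u v, D u -> D v -> D (a *: u + v).

(** Relative to [D], because the forms to come are integrals through primitives, which are additive
    only when the integrands are continuous. *)
Definition linear_on D (l : W -> F) :=
  forall a u v, D u -> D v -> l (a *: u + v) = a * l u + l v.

Definition bilinear_on D b :=
  (forall v, D v -> linear_on D (b ^~ v)) /\ (forall u, D u -> linear_on D (b u)).

Definition spanned (s : seq W) : set W :=
  [set w | forall D, linear_subspace D -> {in s, forall v, D v} -> D w].

Lemma linear_subspace_spanned s : linear_subspace (spanned s).
Proof.
split; first by move=> D [].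
by move=> a u v su sv D DD sD; apply: DD.2; [exact: su|exact: sv].
Qed.

Lemma mem_spanned s v : v \in s -> spanned s v.
Proof. by move=> vs D _; exact. Qed.

Lemma spanned_sub s D w : linear_subspace D -> {in s, forall v, D v} -> spanned s w -> D w.
Proof. by move=> DD sD; exact. Qed.

Definition comb n (e : 'I_n -> W) (x : 'rV[F]_n) := \sum_i x 0 i *: e i.

Lemma combD n (e : 'I_n -> W) a x y : comb e (a *: x + y) = a *: comb e x + comb e y.
Proof.
rewrite /comb scaler_sumr -big_split; apply: eq_bigr => i _ /=.
by rewrite !mxE scalerDl scalerA.
Qed.

Lemma comb0 n (e : 'I_n -> W) : comb e 0 = 0.
Proof. by rewrite /comb big1 // => i _; rewrite mxE scale0r. Qed.

Lemma linear_subspace_comb D n (e : 'I_n -> W) x :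
  linear_subspace D -> (forall i, D (e i)) -> D (comb e x).
Proof.
move=> [D0 DD] De; rewrite /comb; elim/big_rec: _ => // i w _ Dw.
exact: DD.
Qed.

Lemma linear_on0 D l : linear_subspace D -> linear_on D l -> l 0 = 0.
Proof.
move=> [D0 _] ll; have := ll 1 0 0 D0 D0.
by rewrite scaler0 addr0 mul1r => H; lra.
Qed.

Lemma linear_on_comb D l n (e : 'I_n -> W) x : linear_subspace D -> linear_on D l ->
  (forall i, D (e i)) -> l (comb e x) = \sum_i x 0 i * l (e i).
Proof.
move=> DD ll De; rewrite /comb.
suff [//] : l (\sum_i x 0 i *: e i) = \sum_i x 0 i * l (e i) /\ D (\sum_i x 0 i *: e i).
elim/big_rec2: _ => [|i z w _ [lw Dw]]; first by rewrite (linear_on0 DD ll); case: DD.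
by split; [rewrite ll // lw|exact: DD.2].
Qed.

(** Generators depending on the later ones are dropped one by one. Freeness is needed to turn a
    nonzero coordinate vector into a nonzero element. *)
Lemma exists_free_generators (s : seq W) : exists n (e : 'I_n -> W),
  [/\ forall i, e i \in s, forall x, comb e x = 0 -> x = 0 &
      {in s, forall v, exists x, v = comb e x}].
Proof.
elim: s => [|f s [n [e [es free gen]]]].
  exists 0%N, (fun=> 0); split=> [[]//|x _|//].
  by apply/rowP => - [].
have [[x fx]|nf] := pselect (exists x, f = comb e x).
  exists n, e; split=> // [i|v]; first by rewrite inE es orbT.
  by rewrite inE => /orP[/eqP ->|/gen//]; exists x.
pose e' (i : 'I_n.+1) := if unlift ord0 i is Some j then e j else f.
have e'E x : comb e' x = x 0 ord0 *: f + comb e (\row_j x 0 (lift ord0 j)).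
  rewrite /comb big_ord_recl {1}/e' unlift_none; congr (_ + _).
  by apply: eq_bigr => j _; rewrite /e' liftK mxE.
exists n.+1, e'; split.
- by move=> i; rewrite /e' inE; case: unliftP => [j _|_]; rewrite ?eqxx ?es ?orbT.
- move=> x; rewrite e'E => H.
  have x0 : x 0 ord0 = 0.
    apply/eqP; apply: contraT => x0; exfalso; apply: nf.
    exists (- (x 0 ord0)^-1 *: \row_j x 0 (lift ord0 j)).
    rewrite -[X in comb _ X]addr0 combD comb0 addr0.
    move/eqP: H; rewrite addr_eq0 => /eqP H.
    by rewrite scaleNr -scalerN -H scalerA mulVf // scale1r.
  move: H; rewrite x0 scale0r add0r => /free H.
  apply/rowP => i; rewrite mxE; case: (unliftP ord0 i) => [j ->|-> //].
  by have := congr1 (fun r : 'rV_n => r 0 j) H; rewrite !mxE.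
- move=> v; rewrite inE => /orP[/eqP ->|/gen[x ->]].
    exists (\row_j (j == ord0)%:R); rewrite e'E mxE eqxx scale1r.
    rewrite (_ : \row_j _ = 0) ?comb0 ?addr0 //.
    by apply/rowP => j; rewrite !mxE.
  exists (\row_j (if unlift ord0 j is Some k then x 0 k else 0)).
  rewrite e'E mxE unlift_none scale0r add0r; congr comb.
  by apply/rowP => j; rewrite !mxE liftK.
Qed.

Lemma gram_comb D b n (e : 'I_n -> W) x y :
  linear_subspace D -> bilinear_on D b -> (forall i, D (e i)) ->
  (x *m (\matrix_(i, j) b (e i) (e j)) *m y^T) 0 0 = b (comb e x) (comb e y).
Proof.
move=> DD [bl br] De.
rewrite (linear_on_comb _ DD (bl _ (linear_subspace_comb y DD De)) De) mxE.
under eq_bigr do rewrite mxE big_distrl /=.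
rewrite exchange_big; apply: eq_bigr => i _ /=.
rewrite (linear_on_comb _ DD (br _ (De i)) De) big_distrr; apply: eq_bigr => j _ /=.
by rewrite !mxE; ring.
Qed.

(** Stability under [j] does two things: [om v (j v) > 0] shows that the Gram matrix of [om] has no
    kernel, and the solution [w] may later be tested against [j w]. *)
Lemma galerkin_pencil D b om (j : W -> W) (l : W -> F) u (s : seq W) :
  linear_subspace D -> bilinear_on D b -> bilinear_on D om ->
  {in D &, forall v w, b v w = b w v} -> {in D &, forall v w, om v w = - om w v} ->
  (forall a v w, j (a *: v + w) = a *: j v + j w) -> (forall v, j (j v) = - v) ->
  (forall v, D v -> D (j v)) -> (forall v, D v -> v != 0 -> 0 < om v (j v)) ->
  linear_on D l -> D u -> b u u < 0 ->
  (forall v, D v -> l v = 0 -> v != 0 -> 0 < b v v) -> {in s, forall v, D v} ->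
  exists S sg w, [/\ linear_subspace S, S `<=` D, S u /\ {in s, forall v, S v},
    forall v, S v -> S (j v) & [/\ 0 < sg, S w, w != 0 &
      forall v, S v -> b w v + sg * om w v = 0]].
Proof.
move=> DD bb bo bs oas jl jj jD opos ll Du bu bl sD.
(* Adding the images under [j] once is enough, since [j] squares to minus the identity. *)
pose s0 := u :: s; pose s1 := s0 ++ map j s0.
have s1D : {in s1, forall v, D v}.
  have s0D : {in s0, forall v, D v} by move=> v; rewrite inE => /orP[/eqP ->//|]; exact: sD.
  move=> v; rewrite mem_cat => /orP[/s0D//|/mapP[w /s0D Dw ->]]; exact: jD.
have SS := linear_subspace_spanned s1.
have SD v : spanned s1 v -> D v by apply: spanned_sub.
have s0S : {in s0, forall v, spanned s1 v}.
  by move=> v vs; apply: mem_spanned; rewrite mem_cat vs.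
have SN v : spanned s1 v -> spanned s1 (- v).
  by move=> Sv; have := SS.2 (-1) v 0 Sv SS.1; rewrite addr0 scaleN1r.
have Sj v : spanned s1 v -> spanned s1 (j v).
  apply: (@spanned_sub _ [set v | spanned s1 (j v)]).
    split=> /=; last by move=> a x y Sx Sy; rewrite jl; exact: SS.2.
    by have := jl (-1) 0 0; rewrite scaler0 addr0 scaleN1r addNr => ->; exact: SS.1.
  move=> w; rewrite mem_cat => /orP[ws|/mapP[x xs ->]] /=.
    by apply: mem_spanned; rewrite mem_cat map_f ?orbT.
  rewrite jj; apply: SN; exact: s0S.
have [n [e [es free gen]]] := exists_free_generators s1.
have De i : D (e i) by exact: s1D.
have Sgen v : spanned s1 v -> exists x, v = comb e x.
  apply: (@spanned_sub _ [set v | exists x, v = comb e x]) => //.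
  split; first by exists 0; rewrite comb0.
  by move=> a _ _ [x ->] [y ->]; exists (a *: x + y); rewrite combD.
pose L := \matrix_(i, j) b (e i) (e j); pose J := \matrix_(i, j) om (e i) (e j).
have Sx x : spanned s1 (comb e x).
  by apply: linear_subspace_comb => // i; apply: mem_spanned.
have Dx x : D (comb e x) by exact: SD.
have uS : spanned s1 u by apply: s0S; rewrite mem_head.
have [xu uE] := Sgen _ uS.
have x0 x : x != 0 -> comb e x != 0 by apply: contra => /eqP/free ->.
pose lc := \col_i l (e i).
have lE (x : 'rV_n) : (x *m lc) 0 0 = l (comb e x).
  by rewrite (linear_on_comb _ DD) // mxE; apply: eq_bigr => i _; rewrite mxE.
have [|||||sg [x [sg0 xn0 xE]]] := @index1_antisym_pencil F n L J lc xu.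
- by apply/matrixP => i k; rewrite !mxE bs // inE.
- by rewrite (gram_comb _ _ DD) // -uE.
- move=> x /(congr1 (fun m : 'M[F]_1 => m 0 0)); rewrite lE mxE => lx xn0.
  by rewrite (gram_comb _ _ DD) // bl // x0.
- by apply/matrixP => i k; rewrite !mxE oas // inE.
- move=> x xJ; apply/eqP; apply: contraT => xn0.
  have [y yE] := Sgen _ (Sj _ (Sx x)).
  have := opos _ (Dx x) (x0 _ xn0).
  by rewrite yE -(gram_comb _ _ DD) // -/J xJ mul0mx mxE ltxx.
exists (spanned s1), sg, (comb e x); split=> //.
  by split=> // v vs; apply: s0S; rewrite inE vs orbT.
split=> //; first exact: x0.
move=> v /Sgen[y ->]; rewrite -!(gram_comb _ _ DD) // -/L -/J.
have := congr1 (fun m : 'rV[F]_n => (m *m y^T) 0 0) xE.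
by rewrite mulmxDl -scalemxAl mul0mx !mxE.
Qed.

End Galerkin.

(** * Rules for continuity and differentiation of composite expressions *)

Section ContinuityRules.
Context {R : realType}.
Implicit Types (f g : R -> R).

Lemma continuous_add f g : continuous f -> continuous g -> continuous (fun x => f x + g x).
Proof. by move=> cf cg x; apply: cvgD; [exact: cf|exact: cg]. Qed.

Lemma continuous_opp f : continuous f -> continuous (fun x => - f x).
Proof. by move=> cf x; apply: cvgN; exact: cf. Qed.

Lemma continuous_mul f g : continuous f -> continuous g -> continuous (fun x => f x * g x).
Proof. by move=> cf cg x; apply: cvgM; [exact: cf|exact: cg]. Qed.

Lemma continuous_expn f n : continuous f -> continuous (fun x => f x ^+ n).
Proof.
move=> cf; elim: n => [|n IH]; first by move=> x; under eq_fun do rewrite expr0; exact: cvg_cst.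
have -> : (fun x => f x ^+ n.+1) = (fun x => f x * f x ^+ n).
  by apply/funext => x; rewrite exprS.
exact: continuous_mul.
Qed.

Lemma continuous_inv f : continuous f -> (forall x, f x != 0) -> continuous (fun x => (f x)^-1).
Proof. by move=> cf f0 x; apply: cvgV; [exact: f0|exact: cf]. Qed.

Lemma continuous_const (c : R) : continuous (fun _ : R => c).
Proof. by move=> x; exact: cvg_cst. Qed.

Lemma continuous_identity : continuous (fun x : R => x).
Proof. by move=> x; exact: cvg_id. Qed.

Lemma continuous_compose f g : continuous f -> continuous g -> continuous (fun x => f (g x)).
Proof. by move=> cf cg x; apply: (@continuous_comp _ _ _ g f); [exact: cg|exact: cf]. Qed.

Lemma continuous_maxr f g : continuous f -> continuous g ->
  continuous (fun x => Num.max (f x) (g x)).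
Proof. by move=> cf cg x; apply: continuous_max; [exact: cf|exact: cg]. Qed.

Lemma continuous_epsilon_delta f x e : continuous f -> 0 < e ->
  exists2 d, 0 < d & forall y, `|y - x| <= d -> `|f y - f x| <= e.
Proof.
move=> cf e0; have := cf x => /(@cvgrPdist_le _ _ _ _ _ _ (f x)) /(_ e e0).
move=> /nbhs_ballP[d /= d0 H]; exists (d / 2); first by rewrite divr_gt0.
move=> y yx; rewrite distrC; apply: H; rewrite /ball /= distrC.
by apply: (le_lt_trans yx); lra.
Qed.

End ContinuityRules.

Ltac cont_hyp := match goal with
  | H : continuous ?g |- continuous ?f => constr_eq f g; exact H
  | H : has_deriv ?g _ |- continuous ?f => constr_eq f g; exact (has_deriv_continuous H)
  end.

Ltac cont := first [cont_hyp | lazymatch goal with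
  | |- continuous (fun _ => ?c) => exact (@continuous_const _ c)
  | |- continuous (fun x => @?f x + @?g x) => apply (@continuous_add _ f g); cont
  | |- continuous (fun x => - @?f x) => apply (@continuous_opp _ f); cont
  | |- continuous (fun x => @?f x * @?g x) => apply (@continuous_mul _ f g); cont
  | |- continuous (fun x => @?f x ^+ ?n) => apply (@continuous_expn _ f n); cont
  | |- continuous (fun x => (@?f x)^-1) => apply (@continuous_inv _ f); [cont|]
  | |- continuous (fun x => Num.max (@?f x) (@?g x)) => apply (@continuous_maxr _ f g); cont
  | |- continuous (fun x => x) => apply continuous_identity
  | |- continuous (fun x => ?f x) => change (continuous f); cont
  | _ => try (match goal with
    | H : continuous ?f |- continuous ?f => exact H
    | H : has_deriv ?f _ |- continuous ?f => exact (has_deriv_continuous H) end)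
  end].

Lemma has_deriv_eq (R : realType) (f g h : R -> R) : has_deriv f g -> g =1 h -> has_deriv f h.
Proof. by move=> fg /funext <-. Qed.

Ltac deriv := eapply has_deriv_eq;
  [ repeat first [ eassumption | eapply has_derivD | eapply has_derivN | eapply has_deriv_sqr
    | eapply has_derivM | eapply has_deriv_cst | eapply has_deriv_id ]
  | move=> ? /= ].

Section LocalMonotonicity.
Context {R : realType}.
Implicit Types (f g : R -> R).

Lemma is_derive_ge f g (a b : R) : a <= b ->
  (forall x, a <= x <= b -> is_derive x (1 : R) f (g x)) ->
  (forall x, a <= x <= b -> 0 <= g x) -> f a <= f b.
Proof.
move=> ab fg g0.
have fc : {within `[a, b], continuous f}.
  apply: derivable_within_continuous => x; rewrite in_itv /= => /fg H.
  exact: (@ex_derive _ _ _ _ _ _ _ H).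
have dfo x : x \in `]a, b[ -> is_derive x (1 : R) f (g x).
  by rewrite in_itv /= => /andP[ax xb]; apply: fg; rewrite !ltW.
have [c] := MVT_segment ab dfo fc.
by rewrite in_itv /= => /g0 gc0 E; rewrite -subr_ge0 E mulr_ge0 ?subr_ge0.
Qed.

(** Caratheodory's slope [s] extends [f z / (z - x0)] continuously to the zero [x0]; it resolves
    quotients of two functions vanishing there. *)
Lemma has_deriv_slope f g x0 : has_deriv f g -> f x0 = 0 ->
  exists s : R -> R, [/\ forall z, f z = s z * (z - x0), {for x0, continuous s} & s x0 = g x0].
Proof.
move=> fg f0; have /is_derive1_caratheodory[s [sE sc s0]] := fg x0.
by exists s; split=> // z; rewrite -sE f0 subr0.
Qed.

Lemma is_deriveM_at f g (x df dg : R) : is_derive x (1 : R) f df -> is_derive x (1 : R) g dg ->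
  is_derive x (1 : R) (fun y => f y * g y) (df * g x + f x * dg).
Proof.
move=> ff gg; apply: is_derive_eq (is_deriveM ff gg) _.
by rewrite addrC; congr (_ + _); rewrite [LHS]mulrC.
Qed.

End LocalMonotonicity.

(** * Jacobi's identity and the sign of the Sturm-Liouville form *)

Section Jacobi.
Context {R : realType}.
Variables (a a1 q r r1 : R -> R) (x0 : R).
Hypotheses (aa : has_deriv a a1) (a_ge0 : forall x, 0 <= a x) (qc : continuous q)
  (rr : has_deriv r r1) (ode : has_deriv (fun x => a x * r1 x) (fun x => - q x * r x))
  (r1c : continuous r1)
  (rx0 : r x0 = 0) (r1x0 : r1 x0 != 0) (r_neq0 : forall x, x != x0 -> r x != 0).

(* Away from [x0], [a f'^2 - q f^2 = a (f' - r' f / r)^2 + (a r' f^2 / r)']; the boundary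
   term at [x0] vanishes because [f] does. *)
Lemma jacobi_form_ge0 f f1 N : has_deriv f f1 -> continuous f1 -> f x0 = 0 ->
  0 <= N -> (forall x, N <= `|x| -> f x = 0 /\ f1 x = 0) ->
  0 <= intg (- N) N (fun x => a x * f1 x ^+ 2 - q x * f x ^+ 2).
Proof.
move=> ff f1c fx0 N0 fN.
have ac := has_deriv_continuous aa.
set e := fun x => _; have ec : continuous e by rewrite /e; cont.
have pe := primitiveP ec; set P := primitive e in pe.
pose G x := a x * r1 x * (f x ^+ 2 / r x).
have [sf [sfE sfc sfx]] := has_deriv_slope ff fx0.
have [sr [srE src srx]] := has_deriv_slope rr rx0.
(* The quotient [f ^+ 2 / r] is of the form 0 / 0 at [x0]. Written with slopes it has the factor
   [x - x0] over [sr], and [sr x0 = r1 x0] is nonzero, so it tends to 0. *)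
pose Gt x := a x * r1 x * (sf x ^+ 2 * (x - x0) / sr x).
have GGt x : x != x0 -> G x = Gt x.
  move=> xx; rewrite /G /Gt; congr (_ * _); rewrite sfE srE.
  have sx : sr x != 0 by apply: contra (r_neq0 xx); rewrite srE => /eqP ->; rewrite mul0r.
  have xx' : x - x0 != 0 by rewrite subr_eq0.
  by field; rewrite sx xx'.
have Gtc : Gt x @[x --> x0] --> (0 : R).
  have -> : 0 = a x0 * r1 x0 * (sf x0 ^+ 2 * (x0 - x0) / sr x0).
    by rewrite subrr mulr0 mul0r mulr0.
  apply: cvgM; first by apply: cvgM; [exact: ac|exact: r1c].
  apply: cvgM; last by apply: cvgV; [rewrite srx|].
  by apply: cvgM; [apply: cvgM; exact: sfc|apply: cvgB; [exact: cvg_id|exact: cvg_cst]].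
have PG : P x - Gt x @[x --> x0] --> P x0.
  rewrite -[X in _ --> X]subr0; apply: cvgB => //.
  exact: (has_deriv_continuous pe).
have dG x : x != x0 -> is_derive x (1 : R) (fun y => P y - G y)
    (a x * (f1 x - r1 x / r x * f x) ^+ 2).
  move=> xx; have rx := r_neq0 xx.
  have dr : is_derive x (1 : R) (fun y => (r y)^-1) (- r1 x / r x ^+ 2).
    apply: is_derive_eq (is_deriveV rx (rr x)) _.
    by rewrite [LHS]mulrC mulrN mulNr.
  have dGx := is_deriveM_at (ode x) (is_deriveM_at (has_deriv_sqr ff x) dr).
  apply: is_derive_eq (is_deriveB (pe x) dGx) _.
  by rewrite /e; field.
have dG0 x : 0 <= a x * (f1 x - r1 x / r x * f x) ^+ 2 by rewrite mulr_ge0 ?sqr_ge0.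
pose M := Num.max N `|x0| + 1.
have NM : N <= M by rewrite /M ler_wpDr // le_max lexx.
have xM : `|x0| < M by rewrite /M ltr_pwDr // le_max lexx orbT.
have M0 : 0 < M by apply: le_lt_trans xM.
have [Mx xM'] : - M < x0 /\ x0 < M by move: xM; rewrite ltr_norml => /andP.
have GM x : N <= `|x| -> G x = 0 by move=> /fN[fx _]; rewrite /G fx expr0n mul0r mulr0.
have [M1 M2] : N <= `|M| /\ N <= `|- M| by rewrite normrN gtr0_norm.
(* [P - G] is nondecreasing on either side of [x0], equals [P] at [M] and [- M], and tends to [P x0]
   at [x0]; this bridges the singular point. *)
have right : P x0 <= P M.
  apply: (cvgr_to_le (cvg_at_right_filter PG)).
  near=> y.
  have xy : x0 < y by near: y; exact: nbhs_right_gt.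
  have yM : y <= M by near: y; exact: nbhs_right_le.
  rewrite -GGt ?gt_eqF //.
  have D x : y <= x <= M -> x != x0 by case/andP=> yx _; rewrite gt_eqF // (lt_le_trans xy).
  have := is_derive_ge yM (fun x H => dG x (D x H)) (fun x _ => dG0 x).
  by rewrite (GM M) // subr0.
have left : P (- M) <= P x0.
  apply: (cvgr_to_ge (cvg_at_left_filter PG)).
  near=> y.
  have xy : y < x0 by near: y; exact: nbhs_left_lt.
  have yM : - M <= y by near: y; exact: nbhs_left_ge.
  rewrite -GGt ?lt_eqF //.
  have D x : - M <= x <= y -> x != x0 by case/andP=> _ yx; rewrite lt_eqF // (le_lt_trans yx).
  have := is_derive_ge yM (fun x H => dG x (D x H)) (fun x _ => dG0 x).
  by rewrite (GM (- M)) // subr0.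
have E0 : 0 <= intg (- M) M e by rewrite subr_ge0 (le_trans left).
rewrite -(@intg_support _ (- N) N (- M) M) ?lerN2 //.
- by rewrite ge0_cp.
- move=> x xN; have [] := fN x; first by rewrite ler0_norm; lra.
  by rewrite /e => -> ->; rewrite expr0n !mulr0 subr0.
- move=> x Nx; have [] := fN x; first by rewrite ger0_norm; lra.
  by rewrite /e => -> ->; rewrite expr0n !mulr0 subr0.
Unshelve. all: by end_near. Qed.
End Jacobi.

Section SmoothStep.
Context {R : realType}.

Lemma has_deriv_pos_sqr : has_deriv (fun t : R => Num.max 0 t ^+ 2) (fun t => 2 * Num.max 0 t).
Proof.
move=> t; have [t0|t0|->] := ltgtP t 0.
- rewrite mulr0; apply: (@near_eq_is_derive _ _ _ (cst 0)).
  have : \forall y \near t, y < 0 by apply: lt_nbhsl.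
  by apply: filterS => y y0 /=; rewrite max_l ?expr0n // ltW.
- apply: (@near_eq_is_derive R R R (fun y : R => y ^+ 2)).
  have : \forall y \near t, 0 < y by apply: lt_nbhsr.
  by apply: filterS => y y0 /=; rewrite max_r // ltW.
  have := has_deriv_sqr (@has_deriv_id R) t.
  by rewrite mulr1.
- rewrite mulr0; apply/is_derive1_caratheodory.
  exists (fun z => Num.max 0 z); split; last by rewrite maxxx.
    move=> z; rewrite maxxx expr0n subr0 subr0.
    by have [z0|z0] := leP 0 z; rewrite ?mul0r expr2 ?mul0r.
  exact: (@continuous_maxr R (fun=> 0) id (@continuous_const R 0) (@continuous_identity R)).
Qed.

(** Normalised primitive of the C^1 bump [max(0, x - x^2)^2]. Class C^2 is all that the trial
    functions require, and the bump is at most 1, so [D] is the inverse of its integral. *)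
Lemma smooth_step : exists (S S1 S2 : R -> R) (D : R),
  [/\ [/\ has_deriv S S1, has_deriv S1 S2, continuous S2 & 0 < D],
      forall x, x <= 0 -> S x = 0 /\ S1 x = 0,
      forall x, 1 <= x -> S x = 1 /\ S1 x = 0 &
      forall x, 0 <= S1 x <= D].
Proof.
pose b (x : R) := Num.max 0 (x - x ^+ 2) ^+ 2.
pose b1 (x : R) := 2 * Num.max 0 (x - x ^+ 2) * (1 - 2 * x).
have db : has_deriv b b1.
  have dx : has_deriv (fun x : R => x - x ^+ 2) (fun x => 1 - 2 * x).
    by deriv; ring.
  exact: has_deriv_comp has_deriv_pos_sqr dx.
have b1c : continuous b1 by rewrite /b1; cont.
have bc := has_deriv_continuous db.
have b_ge0 x : 0 <= b x by rewrite sqr_ge0.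
have b_le x : b x <= 1.
  rewrite /b; have [h|h] := leP 0 (x - x ^+ 2); last by rewrite expr0n /= ler01.
  have h1 : x - x ^+ 2 <= 1 by nra.
  by rewrite expr_le1.
have b0 x : x <= 0 -> b x = 0.
  by move=> x0; rewrite /b max_l ?expr0n //; nra.
have b0' x : 1 <= x -> b x = 0.
  by move=> x0; rewrite /b max_l ?expr0n //; nra.
have I0 : 0 < intg 0 1 b.
  rewrite lt_neqAle intg_ge0 ?ler01 // andbT eq_sym; apply/eqP => I0.
  have := @intg_eq0 _ 0 1 b ler01 bc (fun x _ => b_ge0 x) I0 2^-1.
  rewrite invr_gt0 invf_lt1 ?ltr0n // ltr1n => /(_ isT) /eqP.
  by rewrite sqrf_eq0 max_r; [move/eqP; lra|lra].
set I := intg 0 1 b in I0.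
have pb := primitiveP bc.
exists (fun x => I^-1 * intg 0 x b), (fun x => I^-1 * b x), (fun x => I^-1 * b1 x), I^-1.
split.
- split; [|exact: has_derivMl|by cont|by rewrite invr_gt0].
  apply: has_derivMl; rewrite /intg.
  by apply: (has_deriv_eq (has_derivB pb (has_deriv_cst _))) => x; rewrite subr0.
- move=> x x0; rewrite b0 // mulr0; split=> //.
  rewrite (_ : intg 0 x b = 0) ?mulr0 // /intg.
  by rewrite (has_deriv_cst_on pb x0) ?subrr // => y /andP[_ y0]; rewrite b0.
- move=> x x1; rewrite b0' // mulr0; split=> //.
  rewrite -(intg_chasles 0 1 x) -/I (_ : intg 1 x b = 0) ?addr0 ?mulVf ?gt_eqF //.
  by rewrite /intg (has_deriv_cst_on pb x1) ?subrr // => y /andP[y0 _]; rewrite b0'.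
- have I1 : 0 <= I^-1 by rewrite invr_ge0 ltW.
  by move=> x; rewrite mulr_ge0 //= ler_piMr.
Qed.

End SmoothStep.

(** * Trial functions of negative energy *)

Section NegativeDirection.
Context {R : realType}.

(* The trial function is a truncation of [r] to the half line [x >= x0], plus a small
   multiple [s h] of a bump rounding off the corner at [x0]. *)
Lemma jacobi_form_lt0 (a a1 q r r1 r2 : R -> R) (x0 kap A : R) :
  has_deriv a a1 -> 0 < kap -> (forall x, kap <= a x) -> (forall x, a x <= A) ->
  continuous q -> has_deriv r r1 -> has_deriv r1 r2 -> continuous r2 ->
  has_deriv (fun x => a x * r1 x) (fun x => - q x * r x) -> r x0 = 0 -> 0 < r1 x0 ->
  (forall e, 0 < e -> exists M, forall x, M <= x -> `|r x| <= e) ->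
  exists (f f1 f2 : R -> R) N,
  [/\ 0 < N, [/\ has_deriv f f1, has_deriv f1 f2 & continuous f2],
      forall x, N <= `|x| -> f x = 0 /\ f1 x = 0 &
      intg (- N) N (fun x => a x * f1 x ^+ 2 - q x * f x ^+ 2) < 0].
Proof.
move=> aa kap0 a_ge a_le qc rr rr1 r2c ode rx0 r1x0 r_lim.
have [S [S1 [S2 [D [[SS SS1 S2c D0] S_0 S_1 S1D]]]]] := @smooth_step R.
have A0 : 0 < A by apply: lt_le_trans kap0 (le_trans (a_ge 0) (a_le 0)).
(* Lower and upper bounds for [r1] on a short interval to the right of [x0]. *)
pose b := r1 x0 / 2; pose C := 2 * r1 x0.
have b0 : 0 < b by rewrite /b; lra.
have [d [d0 d1 rb]] : exists d, [/\ 0 < d, d <= 1 & forall x, x0 <= x <= x0 + d -> b <= r1 x <= C].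
  have [d d0 H] := continuous_epsilon_delta x0 (has_deriv_continuous rr1) b0.
  exists (Num.min 1 d); split; [by rewrite lt_min ltr01|by rewrite ge_min lexx|].
  move=> x /andP[xx xd].
  have xd' : x - x0 <= d by rewrite lerBlDl (le_trans xd) // lerD2l ge_min lexx orbT.
  have := H x; rewrite ger0_norm ?subr_ge0 // => /(_ xd').
  by rewrite ler_norml => /andP[H1 H2]; rewrite /b /C in H1 H2 *; apply/andP; split; lra.
have rC x : x0 <= x <= x0 + d -> 0 <= r x <= C * (x - x0).
  case/andP=> xx xd.
  have I y : x0 <= y <= x -> b <= r1 y <= C by case/andP=> y1 y2; apply: rb; lra.
  have := has_deriv_ge rr xx (fun y H => le_trans (ltW b0) (andP (I y H)).1).
  have dC : has_deriv (fun y => C * y - r y) (fun y => C - r1 y) by deriv; ring.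
  have := has_deriv_ge dC xx; rewrite rx0 => H -> /=.
  have : C * x0 - 0 <= C * x - r x by apply: H => y /I /andP[_ ?]; rewrite subr_ge0.
  by rewrite subr0 mulrBr; lra.
(* A bump supported in [[x0 - 2, x0 + 3]] and equal to 1 on [[x0 - 1, x0 + 2]], hence flat around
   the corner. *)
pose h x := S (x - x0 + 2) * S (x0 + 3 - x).
pose h1 x := S1 (x - x0 + 2) * S (x0 + 3 - x) - S (x - x0 + 2) * S1 (x0 + 3 - x).
pose h2 x := S2 (x - x0 + 2) * S (x0 + 3 - x) - 2 * (S1 (x - x0 + 2) * S1 (x0 + 3 - x))
  + S (x - x0 + 2) * S2 (x0 + 3 - x).
have dl : has_deriv (fun x => x - x0 + 2) (fun=> 1) by deriv; ring.
have dr (c : R) : has_deriv (fun x => c - x) (fun=> -1) by deriv; ring.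
have hh : has_deriv h h1.
  apply: (has_deriv_eq (has_derivM (has_deriv_comp SS dl) (has_deriv_comp SS (dr _)))).
  by move=> x; rewrite /h1; ring.
have hh1 : has_deriv h1 h2.
  apply: (has_deriv_eq (has_derivB (has_derivM (has_deriv_comp SS1 dl) (has_deriv_comp SS (dr _)))
   (has_derivM (has_deriv_comp SS dl) (has_deriv_comp SS1 (dr _))))).
  by move=> x; rewrite /h2; ring.
have Sc (g g1 : R -> R) : has_deriv g g1 -> continuous (fun x => S2 (g x)).
  by move=> gg; apply: (@continuous_compose _ S2 g) => //; exact: has_deriv_continuous gg.
have Scl := Sc _ _ dl; have Scr (c : R) := Sc _ _ (dr c).
have h2c : continuous h2.
  have H1 := has_deriv_comp SS dl; have H2 := has_deriv_comp SS (dr (x0 + 3)).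
  have H3 := has_deriv_comp SS1 dl; have H4 := has_deriv_comp SS1 (dr (x0 + 3)).
  by have Sr := Scr (x0 + 3); rewrite /h2; cont.
have h_0 x : x <= x0 - 2 \/ x0 + 3 <= x -> h x = 0 /\ h1 x = 0.
  rewrite /h /h1; case=> xx.
    by have [-> ->] := S_0 (x - x0 + 2) ltac:(lra); rewrite !mul0r subr0.
  by have [-> ->] := S_0 (x0 + 3 - x) ltac:(lra); rewrite !mulr0 subr0.
have h_1 x : x0 <= x <= x0 + 1 -> h x = 1 /\ h1 x = 0.
  case/andP=> x1 x2; rewrite /h /h1.
  have [-> ->] := S_1 (x - x0 + 2) ltac:(lra).
  by have [-> ->] := S_1 (x0 + 3 - x) ltac:(lra); rewrite mulr1 mul0r mulr0 subr0.
pose eh x := a x * h1 x ^+ 2 - q x * h x ^+ 2.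
have ehc : continuous eh by rewrite /eh; cont.
pose Eh := intg (x0 - 2) (x0 + 3) eh.
(* Small enough that the self-energy [s ^+ 2 * Eh] of the bump is at most [z = s * (kap * b)], half
   of the gain [2 z] made at the corner. *)
pose s := kap * b / (`|Eh| + 1).
have kb : 0 < kap * b by rewrite mulr_gt0.
have s0 : 0 < s by rewrite divr_gt0 // ltr_pwDr.
have sE : s ^+ 2 * Eh <= s * (kap * b).
  rewrite expr2 -mulrA ler_pM2l // (le_trans (ler_norm _)) // normrM gtr0_norm //.
  by rewrite /s mulrAC ler_pdivrMr ?ltr_pwDr // ler_pM2l // lerDl ler01.
pose z := s * (kap * b).
have z0 : 0 < z by rewrite mulr_gt0.
(* Width of the layer in which the truncation at [x0] is carried out; its cost [A C^2 D ep] is at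
   most [z / 4]. *)
pose ep := Num.min d (z / (4 * (A * C ^+ 2 * D))).
have C0 : 0 < C by rewrite /C; lra.
have ACD : 0 < A * C ^+ 2 * D by rewrite !mulr_gt0.
have ep0 : 0 < ep by rewrite lt_min d0 divr_gt0 // mulr_gt0.
have epd : ep <= d by rewrite ge_min lexx.
have epz : A * C ^+ 2 * D * ep <= z / 4.
  have : ep <= z / (4 * (A * C ^+ 2 * D)) by rewrite ge_min lexx orbT.
  rewrite -(ler_pM2l ACD) => /le_trans; apply.
  by rewrite le_eqVlt; apply/orP; left; apply/eqP; field; rewrite !gt_eqF.
(* Size of [r] where the tail is cut off; the cost [A D de^2] is again at most [z / 4]. The total is
   then at most [z - 2 z + z / 4 + z / 4 < 0]. *)
pose de := Num.min 1 (z / (4 * (A * D))).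
have AD : 0 < A * D by rewrite mulr_gt0.
have de0 : 0 < de by rewrite lt_min ltr01 divr_gt0 // mulr_gt0.
have dez : A * D * de ^+ 2 <= z / 4.
  have H1 : de <= 1 by rewrite ge_min lexx.
  have H2 : de <= z / (4 * (A * D)) by rewrite ge_min lexx orbT.
  have : de ^+ 2 <= z / (4 * (A * D)).
    by apply: le_trans H2; rewrite expr2 ler_piMr // ltW.
  rewrite -(ler_pM2l AD) => /le_trans; apply.
  by rewrite le_eqVlt; apply/orP; left; apply/eqP; field; rewrite !gt_eqF.
have [M' HM'] := r_lim _ de0.
pose M := Num.max M' (x0 + 3).
have MM : x0 + 3 <= M by rewrite le_max lexx orbT.
have HM x : M <= x -> r x ^+ 2 <= de ^+ 2.
  move=> Mx; rewrite -[r x ^+ 2]real_normK ?num_real // lerXn2r ?nnegrE // ?(ltW de0) //.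
  by apply: HM'; apply: le_trans Mx; rewrite le_max lexx.
(* [Z1] rises from 0 to 1 on [[x0, x0 + ep]]; [Z2] falls from 1 to 0 on [[M, M + 1]], where the bump
   [h] already vanishes. *)
pose Z1 x := S ((x - x0) / ep); pose Z1' x := S1 ((x - x0) / ep) / ep.
pose Z1'' x := S2 ((x - x0) / ep) / ep / ep.
pose Z2 x := S (M + 1 - x); pose Z2' x := - S1 (M + 1 - x); pose Z2'' x := S2 (M + 1 - x).
have dep : has_deriv (fun x => (x - x0) / ep) (fun=> ep^-1) by deriv; ring.
have dZ1 : has_deriv Z1 Z1' by exact: (has_deriv_comp SS dep).
have dZ1' : has_deriv Z1' Z1''.
  apply: (has_deriv_eq (has_derivM (has_deriv_comp SS1 dep) (has_deriv_cst _))) => x.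
  by rewrite mulr0 addr0.
have dZ2 : has_deriv Z2 Z2'.
  by apply: (has_deriv_eq (has_deriv_comp SS (dr _))) => x; rewrite mulrN1.
have dZ2' : has_deriv Z2' Z2''.
  by apply: (has_deriv_eq (has_derivN (has_deriv_comp SS1 (dr _)))) => x; rewrite mulrN1 opprK.
have cZ1'' : continuous Z1''.
  have H := Sc _ _ dep.
  by rewrite /Z1''; cont.
have cZ2'' : continuous Z2'' by exact: (Scr (M + 1)).
pose ze x := Z1 x * Z2 x; pose ze1 x := Z1' x * Z2 x + Z1 x * Z2' x.
pose ze2 x := Z1'' x * Z2 x + 2 * (Z1' x * Z2' x) + Z1 x * Z2'' x.
have dze : has_deriv ze ze1 by exact: has_derivM.
have dze1 : has_deriv ze1 ze2.
  apply: (has_deriv_eq (has_derivD (has_derivM dZ1' dZ2) (has_derivM dZ1 dZ2'))) => x.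
  by rewrite /ze2; ring.
have cze2 : continuous ze2 by rewrite /ze2; cont.
pose f x := r x * ze x + s * h x; pose f1 x := r1 x * ze x + r x * ze1 x + s * h1 x.
pose f2 x := r2 x * ze x + 2 * (r1 x * ze1 x) + r x * ze2 x + s * h2 x.
pose N := Num.max (`|x0| + 3) (`|M| + 1).
have xN : `|x0| + 3 <= N by rewrite le_max lexx.
have MN : `|M| + 1 <= N by rewrite le_max lexx orbT.
have N0 : 0 < N by apply: lt_le_trans xN; rewrite ltr_wpDl.
have [xx1 xx2] : - `|x0| <= x0 /\ x0 <= `|x0| by apply/andP; rewrite -ler_norml.
have [MM1 MM2] : - `|M| <= M /\ M <= `|M| by apply/andP; rewrite -ler_norml.
have zeL x : x <= x0 -> [/\ Z1 x = 0 & Z1' x = 0].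
  move=> xx; rewrite /Z1 /Z1'.
  have [|-> ->] := S_0 ((x - x0) / ep); last by rewrite mul0r.
  by rewrite pmulr_lle0 ?invr_gt0 // subr_le0.
have zeR x : M + 1 <= x -> [/\ Z2 x = 0 & Z2' x = 0].
  move=> xx; rewrite /Z2 /Z2'.
  by have [|-> ->] := S_0 (M + 1 - x); [clear -xx; lra|rewrite oppr0].
have zeM x : x <= M -> [/\ Z2 x = 1 & Z2' x = 0].
  move=> xx; rewrite /Z2 /Z2'.
  by have [|-> ->] := S_1 (M + 1 - x); [clear -xx; lra|rewrite oppr0].
have zeE x : x0 + ep <= x -> [/\ Z1 x = 1 & Z1' x = 0].
  move=> xx; rewrite /Z1 /Z1'.
  have [|-> ->] := S_1 ((x - x0) / ep); last by rewrite mul0r.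
  by rewrite ler_pdivlMr // mul1r; clear -xx; lra.
have ze0 x : N <= `|x| -> ze x = 0 /\ ze1 x = 0.
  rewrite ler_normr => /orP[Nx|Nx]; rewrite /ze /ze1.
    by have [-> ->] := zeR x ltac:(clear -Nx MN MM1 MM2; lra); rewrite !mulr0 addr0.
  by have [-> ->] := zeL x ltac:(clear -Nx xN xx1 xx2; lra); rewrite !mul0r addr0.
have h0 x : N <= `|x| -> h x = 0 /\ h1 x = 0.
  by rewrite ler_normr => /orP[Nx|Nx]; apply: h_0; [right; clear -Nx xN xx1 xx2; lra|left; clear -Nx xN xx1 xx2; lra].
have df : has_deriv f f1 by rewrite /f /f1; deriv; ring.
have df1 : has_deriv f1 f2 by rewrite /f1 /f2; deriv; ring.
exists f, f1, f2, N; split=> //.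
- by split=> //; rewrite /f2; cont.
- move=> x Nx; rewrite /f /f1.
  have [-> ->] := ze0 x Nx; have [-> ->] := h0 x Nx.
  by rewrite !mulr0 !addr0.
(* Because [r] solves the equation, every term without a derivative of the cutoff [ze] is contained
   in the exact derivative of [T] or in the self-energy of [h]. The remainder [B] lives in the two
   transition layers. *)
pose T x := a x * r1 x * (r x * ze x ^+ 2 + 2 * s * (ze x * h x)).
pose T1 x := - q x * r x * (r x * ze x ^+ 2 + 2 * s * (ze x * h x))
  + a x * r1 x * (r1 x * ze x ^+ 2 + r x * (2 * (ze x * ze1 x))
     + 2 * s * (ze1 x * h x + ze x * h1 x)).
have dT : has_deriv T T1.
  rewrite /T /T1; apply: (has_deriv_eq (has_derivM ode _)); first deriv; last by move=> x.
  ring.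
have ac := has_deriv_continuous aa.
pose B x := a x * (r x * ze1 x) ^+ 2 + 2 * s * a x * ze1 x * (r x * h1 x - r1 x * h x).
have eE x : a x * f1 x ^+ 2 - q x * f x ^+ 2 = T1 x + B x + s ^+ 2 * eh x.
  by rewrite /T1 /B /eh /f /f1; ring.
have T1c : continuous T1 by rewrite /T1; cont.
have Bc : continuous B by rewrite /B; cont.
rewrite (eq_intg _ _ eE) intgD //; [|by cont|by cont].
rewrite intgD // (intgE _ _ dT) intgZ //.
have -> : intg (- N) N eh = Eh.
  apply: intg_support => //; [clear -xN xx1 xx2; lra|clear; lra|clear -xN xx1 xx2; lra| |].
    by move=> x xx; rewrite /eh; have [-> ->] := h_0 x (or_introl xx); rewrite expr0n !mulr0 subr0.
  by move=> x xx; rewrite /eh; have [-> ->] := h_0 x (or_intror xx); rewrite expr0n !mulr0 subr0.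
have TN x : N <= `|x| -> T x = 0.
  by move=> /ze0[zx _]; rewrite /T zx expr0n !mul0r !mulr0 addr0 mulr0.
rewrite !TN ?normrN ?gtr0_norm // subrr add0r.
(* In the layer at [x0] the cross term is [- 2 s a r1 Z1'], at most [- 2 z Z1']: this is the gain.
   Both [Z1'] and [- Z2'] have integral 1, whatever the widths. *)
have BB x : B x <= (A * C ^+ 2 * D * ep - 2 * z) * Z1' x + A * D * de ^+ 2 * (- Z2' x).
  rewrite /B /ze1.
  case: (leP x x0) => [xx|xx].
    have [-> ->] := zeL x xx; have [_ ->] := zeM x ltac:(clear -xx MM; lra).
    by rewrite !mul0r !mulr0 !addr0 oppr0 mulr0 mulr0 expr0n /= !mulr0 !mul0r addr0.
  have [xe|xe] := leP (x0 + ep) x.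
    have [-> ->] := zeE x xe; rewrite mul0r add0r mul1r mulr0 add0r.
    have [Mx|xM] := leP M x; last first.
      have [_ ->] := zeM x (ltW xM).
      by rewrite !mulr0 expr0n /= !mulr0 mul0r addr0 oppr0 mulr0.
    have [-> ->] := h_0 x (or_intror (le_trans MM Mx)); rewrite !mulr0 subrr mulr0 addr0.
    have /andP[S1a S1b] := S1D (M + 1 - x).
    rewrite /Z2' opprK mulrN sqrrN exprMn.
    set y := S1 _ in S1a S1b *.
    have H := HM x Mx; have ax := a_ge x; have ax' := a_le x.
    have H2 : r x ^+ 2 * y ^+ 2 <= de ^+ 2 * (D * y).
      apply: ler_pM; rewrite ?sqr_ge0 //.
      by rewrite expr2 ler_wpM2r.
    have H3 : 0 <= r x ^+ 2 * y ^+ 2 by rewrite mulr_ge0 ?sqr_ge0.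
    have H4 : a x * (r x ^+ 2 * y ^+ 2) <= A * (de ^+ 2 * (D * y)).
      by apply: ler_pM => //; clear -ax kap0; lra.
    by apply: (le_trans H4); rewrite le_eqVlt; apply/orP; left; apply/eqP; ring.
  have [-> ->] := zeM x ltac:(clear -xe MM epd d1; lra); rewrite mulr1 mulr0 oppr0 mulr0 !addr0.
  have [-> ->] := h_1 x ltac:(clear -xx xe epd d1; lra); rewrite mulr0 mulr1 sub0r.
  have xd : x0 <= x <= x0 + d by clear -xx xe epd; lra.
  have /andP[r0 rC'] := rC x xd; have /andP[rb1 _] := rb x xd.
  have /andP[S1a S1b] := S1D ((x - x0) / ep).
  set y := Z1' x.
  have y0 : 0 <= y by rewrite /y /Z1' divr_ge0 // ltW.
  have yD : ep * y <= D by rewrite /y /Z1' mulrCA divff ?gt_eqF // mulr1.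
  have ax := a_ge x; have ax' := a_le x.
  have ry : r x * y <= C * D.
    apply: (@le_trans _ _ (C * ep * y)).
      rewrite ler_wpM2r //; apply: (le_trans rC'); rewrite ler_pM2l //; clear -xe; lra.
    by rewrite -mulrA ler_pM2l.
  have ry0 : 0 <= r x * y by rewrite mulr_ge0.
  have rep : r x <= C * ep by apply: (le_trans rC'); rewrite ler_pM2l //; clear -xe; lra.
  have H2 : (r x * y) ^+ 2 <= C * D * (C * ep * y).
    by rewrite expr2; apply: ler_pM => //; rewrite ler_wpM2r.
  have H4 : a x * (r x * y) ^+ 2 <= A * (C * D * (C * ep * y)).
    by apply: ler_pM; rewrite ?sqr_ge0 //; clear -ax kap0; lra.
  have H5 : kap * b <= a x * r1 x.
    by apply: ler_pM => //; [exact: ltW|exact: ltW].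
  have H6 : s * y * (kap * b) <= s * y * (a x * r1 x).
    by rewrite ler_wpM2l // mulr_ge0 // ltW.
  apply: (@le_trans _ _ (A * (C * D * (C * ep * y)) - 2 * (s * y * (kap * b)))).
    apply: lerD => //.
    have -> : 2 * s * a x * y * - r1 x = - (2 * (s * y * (a x * r1 x))) by ring.
    by clear -H6; lra.
  by rewrite le_eqVlt; apply/orP; left; apply/eqP; rewrite /z; ring.
have NN : - N <= N by clear -N0; lra.
have cZ1' := has_deriv_continuous dZ1'; have cZ2' := has_deriv_continuous dZ2'.
have Yc : continuous (fun x => (A * C ^+ 2 * D * ep - 2 * z) * Z1' x + A * D * de ^+ 2 * - Z2' x).
  by cont.
have := le_intg NN Bc Yc (fun x _ => BB x).
rewrite [X in _ <= X]intgD; [|by cont|by cont].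
rewrite [X in _ <= X + _]intgZ // [X in _ <= _ + X]intgZ; last by cont.
rewrite intgN // (intgE _ _ dZ1) (intgE _ _ dZ2).
have [-> _] := zeL (- N) ltac:(clear -xN xx1; lra).
have [-> _] := zeE N ltac:(clear -xN xx2 epd d1; lra).
have [-> _] := zeR N ltac:(clear -MN MM2; lra).
have [-> _] := zeM (- N) ltac:(clear -MN MM1 MM2; lra).
rewrite subr0 sub0r opprK !mulr1 => BI.
by rewrite -/z in sE; clear -sE BI epz dez z0; lra.
Qed.

End NegativeDirection.

Section TransverseTrial.
Context {R : realType}.
Variables (p p1 w w1 : R -> R) (kap A : R).
Hypotheses (pp : has_deriv p p1) (ww : has_deriv w w1) (p1c : continuous p1)
  (w1c : continuous w1) (kap0 : 0 < kap) (p_ge : forall x, kap <= p x)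
  (p_le : forall x, p x <= A).

Lemma weight_neq0 x : p x != 0.
Proof. by rewrite gt_eqF // (lt_le_trans kap0). Qed.

(* The potential compensates [w f / p] on the support of [f] and is then cut off slowly. *)
Lemma compensating_potential (f f1 f2 : R -> R) N e :
  0 < N -> has_deriv f f1 -> has_deriv f1 f2 -> continuous f2 ->
  (forall x, N <= `|x| -> f x = 0 /\ f1 x = 0) -> 0 < e ->
  exists (g g1 g2 : R -> R) M,
  [/\ N <= M, [/\ has_deriv g g1, has_deriv g1 g2 & continuous g2],
      forall x, M <= `|x| -> g x = 0 /\ g1 x = 0 &
      intg (- M) M (fun x => p x * (g1 x + w x * f x / p x) ^+ 2) <= e].
Proof.
move=> N0 ff ff1 f2c fN e0.
have [S [S1 [S2 [D [[SS SS1 S2c D0] S_0 S_1 S1D]]]]] := @smooth_step R.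
have p0 := weight_neq0.
have A0 : 0 < A := lt_le_trans kap0 (le_trans (p_ge 0) (p_le 0)).
pose u x := w x * f x / p x.
pose u1 x := (w1 x * f x + w x * f1 x) / p x + w x * f x * (- p1 x / p x ^+ 2).
have du : has_deriv u u1 by exact: has_derivM (has_derivM ww ff) (has_derivV pp p0).
have uc := has_deriv_continuous du.
have u1c : continuous u1 by rewrite /u1; cont => // x; rewrite sqrf_eq0.
have u0 x : N <= `|x| -> u x = 0 by move=> /fN[fx _]; rewrite /u fx mulr0 mul0r.
pose Th x := intg (- N) x u.
have dTh : has_deriv Th u.
  by apply: (has_deriv_eq (has_derivB (primitiveP uc) (has_deriv_cst _))) => x; rewrite subr0.
pose T := Th N.
have ThL x : x <= - N -> Th x = 0.
  move=> xN; rewrite /Th /intg (has_deriv_cst_on (primitiveP uc) xN) ?subrr // => y /andP[_ yN].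
  by rewrite u0 // ler_normr; apply/orP; right; rewrite lerNr.
have ThR x : N <= x -> Th x = T.
  move=> Nx; rewrite /T (has_deriv_cst_on dTh Nx) // => y /andP[Ny _].
  by rewrite u0 // ler_normr Ny.
(* Length of the cutoff. The tail costs at most [A T^2] times the integral of the squared slope,
   which is at most [D / L]. *)
pose L := A * T ^+ 2 * D / e + 1.
have ATD : 0 <= A * T ^+ 2 * D by apply: mulr_ge0; [apply: mulr_ge0; [exact: ltW|exact: sqr_ge0]|exact: ltW].
have L0 : 0 < L by rewrite ltr_wpDl // divr_ge0 // (ltW e0).
have Le : A * T ^+ 2 * (D / L) <= e.
  rewrite mulrA ler_pdivrMr // /L mulrDr mulr1 [e * (_ / e)]mulrC divfK ?gt_eqF //.
  by rewrite lerDl ltW.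
pose chi x := S ((N + L - x) / L); pose chi1 x := - (S1 ((N + L - x) / L) / L).
pose chi2 x := S2 ((N + L - x) / L) / L / L.
have dl : has_deriv (fun x => (N + L - x) / L) (fun=> - L^-1) by deriv; ring.
have dchi : has_deriv chi chi1.
  by apply: (has_deriv_eq (has_deriv_comp SS dl)) => x; rewrite mulrN.
have dchi1 : has_deriv chi1 chi2.
  apply: (has_deriv_eq (has_derivN (has_derivM (has_deriv_comp SS1 dl) (has_deriv_cst _)))).
  by move=> x; rewrite /chi2 mulr0 addr0 mulrN mulNr opprK.
have chi2c : continuous chi2.
  have H : continuous (fun x => S2 ((N + L - x) / L)).
    by apply: (@continuous_compose _ S2) => //; exact: has_deriv_continuous dl.
  by rewrite /chi2; cont.
have chiN x : x <= N -> chi x = 1 /\ chi1 x = 0.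
  move=> xN; rewrite /chi /chi1; have [|-> ->] := S_1 ((N + L - x) / L).
    by rewrite ler_pdivlMr // mul1r addrAC lerDr subr_ge0.
  by rewrite mul0r oppr0.
have chiR x : N + L <= x -> chi x = 0 /\ chi1 x = 0.
  move=> xN; rewrite /chi /chi1; have [|-> ->] := S_0 ((N + L - x) / L).
    by rewrite pmulr_lle0 ?invr_gt0 // subr_le0.
  by rewrite mul0r oppr0.
(* [- Th] would cancel [u] exactly, but it stays at the value [- T] to the right of the support of
   [f]. Cutting it off there leaves only [- Th chi1]. *)
pose g x := - (Th x * chi x); pose g1 x := - (u x * chi x + Th x * chi1 x).
pose g2 x := - (u1 x * chi x + 2 * (u x * chi1 x) + Th x * chi2 x).
have dg : has_deriv g g1 by rewrite /g /g1; deriv.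
have dg1 : has_deriv g1 g2 by rewrite /g1 /g2; deriv; ring.
have g2c : continuous g2 by rewrite /g2; cont.
pose M := N + L.
have NM : N <= M by rewrite lerDl ltW.
have M0 : 0 < M := lt_le_trans N0 NM.
exists g, g1, g2, M; split=> // [x|].
  rewrite ler_normr => /orP[Mx|Mx]; rewrite /g /g1.
    by have [-> ->] := chiR x Mx; rewrite !mulr0 addr0 oppr0.
  have xN : x <= - N by rewrite lerNr (le_trans NM).
  rewrite (ThL _ xN) u0 ?mul0r ?mul0r ?addr0 ?oppr0 //.
  by rewrite ler_normr (le_trans NM Mx) orbT.
have E x : g1 x + w x * f x / p x = - (Th x * chi1 x).
  rewrite -/(u x) /g1; have [xN|Nx] := leP x N.
    by have [-> ->] := chiN x xN; ring.
  rewrite u0; first ring.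
  by rewrite ler_normr ltW.
have pc := has_deriv_continuous pp.
have cE : continuous (fun x => p x * (g1 x + w x * f x / p x) ^+ 2).
  have wc := has_deriv_continuous ww; have fc := has_deriv_continuous ff.
  by cont.
have chi1c := has_deriv_continuous dchi1.
have MM : - M <= M by rewrite ge0_cp // ltW.
apply: (@le_trans _ _ (intg (- M) M (fun x => A * T ^+ 2 * (D / L) * (- chi1 x)))).
  apply: le_intg => // [|x _]; first by cont.
  rewrite E sqrrN exprMn.
  have [xN|Nx] := leP x N.
    by have [_ ->] := chiN x xN; rewrite expr0n !mulr0 oppr0 mulr0.
  rewrite (ThR _ (ltW Nx)).
  have /andP[s0 s1] := S1D ((N + L - x) / L).
  rewrite /chi1 opprK sqrrN.
  set y := S1 _ in s0 s1 *.
  have y0 : 0 <= y / L by rewrite divr_ge0 // ltW.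
  have H : (y / L) ^+ 2 <= D / L * (y / L).
    by rewrite expr2 ler_wpM2r // ler_pM2r ?invr_gt0.
  have T0 := sqr_ge0 T.
  have -> : A * T ^+ 2 * (D / L) * (y / L) = A * (T ^+ 2 * (D / L * (y / L))) by ring.
  apply: ler_pM; [|by apply: mulr_ge0; exact: sqr_ge0|exact: p_le|by rewrite ler_wpM2l].
  by apply: le_trans (p_ge x); exact: ltW.
rewrite intgZ; last by cont.
rewrite (intgN _ _ chi1c) (intgE _ _ dchi).
have [-> _] := chiR M (lexx _); have [-> _] := chiN (- M) ltac:(by rewrite lerNl (le_trans _ NM) // ge0_cp // ltW).
by rewrite sub0r opprK mulr1.
Qed.

End TransverseTrial.

(** * The test space, its quarter turn and its symplectic form *)

Section TestFunctions.
Context {R : realType}.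
Implicit Types (f g : R -> R) (N c : R) (U V : (R -> R) * (R -> R)).

(* Locking [derive1] keeps unification fast. *)
Definition der f : R -> R := locked (derive1 f).

Lemma has_deriv_der f g : has_deriv f g -> der f = g.
Proof. by move=> fg; rewrite /der -lock; exact: has_derivE. Qed.

(** The window [N] is explicit so that finitely many functions can be put in one space. Class C^2
    suffices because the du Bois-Reymond lemma builds its test functions by integrating twice. *)
Definition C2c N f :=
  [/\ has_deriv f (der f), has_deriv (der f) (der (der f)),
      continuous (der (der f)) &
      forall x, N <= `|x| -> f x = 0 /\ der f x = 0].

Lemma C2cI N f f1 f2 : has_deriv f f1 -> has_deriv f1 f2 -> continuous f2 ->
  (forall x, N <= `|x| -> f x = 0 /\ f1 x = 0) -> C2c N f.
Proof. by move=> ff ff1; rewrite /C2c (has_deriv_der ff) (has_deriv_der ff1). Qed.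

Lemma C2cW N M f : N <= M -> C2c N f -> C2c M f.
Proof. by move=> NM [? ? ? H]; split=> // x Mx; apply: H; apply: le_trans Mx. Qed.

Lemma has_deriv_lin c f f1 g g1 : has_deriv f f1 -> has_deriv g g1 ->
  has_deriv (c *: f + g) (fun x => c * f1 x + g1 x).
Proof. by move=> ff gg; exact: has_derivD (has_derivMl c ff) gg. Qed.

Lemma C2c_derive_lin N c f g : C2c N f -> C2c N g ->
  der (c *: f + g) = (fun x => c * der f x + der g x).
Proof. by move=> [ff _ _ _] [gg _ _ _]; apply: has_deriv_der; exact: has_deriv_lin. Qed.

Lemma C2c_linear_subspace N : linear_subspace (C2c N).
Proof.
split=> [|c f g [ff ff1 f2c f0] [gg gg1 g2c g0]].
  have d0 : has_deriv (0 : R -> R) (fun=> 0) by exact: has_deriv_cst.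
  by apply: (C2cI d0 (@has_deriv_cst R 0)) => //; cont.
apply: (C2cI (has_deriv_lin c ff gg) (has_derivD (has_derivMl c ff1) gg1)); first by cont.
move=> x xN; have [g0x g1x] := g0 x xN; have [f0x f1x] := f0 x xN.
split; last by rewrite f1x g1x mulr0 addr0.
by rewrite -[LHS]/(c * f x + g x) f0x g0x mulr0 addr0.
Qed.

Definition C2c2 N : set ((R -> R) * (R -> R)) := [set U | C2c N U.1 /\ C2c N U.2].

Lemma C2c2_linear_subspace N : linear_subspace (C2c2 N).
Proof.
have [Z L] := C2c_linear_subspace N; split=> [|c u v [u1 u2] [v1 v2]]; first by split; exact: Z.
by split; [exact: (L c _ _ u1 v1)|exact: (L c _ _ u2 v2)].
Qed.

(** The matrix [J] acting on real pairs; its square is minus the identity. *)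
Definition quarter_turn U : (R -> R) * (R -> R) := (U.2, - U.1).

Lemma C2c2_quarter_turn N U : C2c2 N U -> C2c2 N (quarter_turn U).
Proof.
move=> [U1 U2]; split; first exact: U2.
have := (C2c_linear_subspace N).2 (-1) _ _ U1 (C2c_linear_subspace N).1.
by rewrite addr0 scaleN1r; exact.
Qed.

(** The L^2 pairing of [J U] with [V]. *)
Definition symp N U V := intg (- N) N (fun x => U.2 x * V.1 x - U.1 x * V.2 x).

Definition mass N U := intg (- N) N (fun x => U.1 x ^+ 2 + U.2 x ^+ 2).

Lemma C2c_continuous N f : C2c N f -> continuous f /\ continuous (der f).
Proof.
by move=> [ff ff1 _ _]; split; [exact: has_deriv_continuous ff|exact: has_deriv_continuous ff1].
Qed.

Lemma symp_bilinear N : bilinear_on (C2c2 N) (symp N).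
Proof.
split=> V [/C2c_continuous[V1 _] /C2c_continuous[V2 _]] c u v
  [/C2c_continuous[u1 _] /C2c_continuous[u2 _]] [/C2c_continuous[v1 _] /C2c_continuous[v2 _]].
  rewrite /symp -intgZ; last by cont.
  rewrite -intgD; [|by cont|by cont].
  by apply: eq_intg => x; rewrite /= -[(c *: u.2 + v.2) x]/(c * u.2 x + v.2 x)
    -[(c *: u.1 + v.1) x]/(c * u.1 x + v.1 x); ring.
rewrite /symp -intgZ; last by cont.
rewrite -intgD; [|by cont|by cont].
by apply: eq_intg => x; rewrite /= -[(c *: u.2 + v.2) x]/(c * u.2 x + v.2 x)
    -[(c *: u.1 + v.1) x]/(c * u.1 x + v.1 x); ring.
Qed.

Lemma symp_antisym N U V : C2c2 N U -> C2c2 N V -> symp N U V = - symp N V U.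
Proof.
move=> [/C2c_continuous[U1 _] /C2c_continuous[U2 _]] [/C2c_continuous[V1 _] /C2c_continuous[V2 _]].
by rewrite /symp -intgN; [apply: eq_intg => x; ring|cont].
Qed.

Lemma symp_quarter_turn N U : symp N U (quarter_turn U) = mass N U.
Proof. by apply: eq_intg => x; rewrite /= -[(- U.1) x]/(- U.1 x); ring. Qed.

Lemma mass_gt0 N U : 0 <= N -> C2c2 N U -> U != 0 -> 0 < mass N U.
Proof.
move=> N0 [U1 U2] Un0.
have [c1 _] := C2c_continuous U1; have [c2 _] := C2c_continuous U2.
have cm : continuous (fun x => U.1 x ^+ 2 + U.2 x ^+ 2) by cont.
have NN : - N <= N by rewrite ge0_cp.
have m0 x : 0 <= U.1 x ^+ 2 + U.2 x ^+ 2 by rewrite addr_ge0 ?sqr_ge0.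
rewrite lt_neqAle intg_ge0 // andbT; apply: contra Un0 => /eqP I0.
have E x : U.1 x ^+ 2 + U.2 x ^+ 2 = 0.
  have [xN|Nx] := leP N `|x|.
    have [_ _ _ /(_ _ xN)[-> _]] := U1; have [_ _ _ /(_ _ xN)[-> _]] := U2.
    by rewrite expr0n addr0.
  by apply: (intg_eq0 NN cm (fun y _ => m0 y) (esym I0)); rewrite -ltr_norml.
apply/eqP; rewrite [U]surjective_pairing; congr (_, _); apply/funext => x;
  have /eqP := E x; rewrite paddr_eq0 ?sqr_ge0 // !sqrf_eq0 => /andP[/eqP e1 /eqP e2] //.
Qed.

End TestFunctions.

(** * The quadratic form of the linearised operator *)

Section Forms.
Context {R : realType}.
Variables (a a1 p p1 w w1 q : R -> R) (kap A : R).
Hypotheses (aa : has_deriv a a1) (pp : has_deriv p p1) (ww : has_deriv w w1)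
  (a1c : continuous a1) (p1c : continuous p1) (w1c : continuous w1) (qc : continuous q)
  (kap0 : 0 < kap) (a_ge : forall x, kap <= a x) (a_le : forall x, a x <= A)
  (p_ge : forall x, kap <= p x) (p_le : forall x, p x <= A)
  (w_le : forall x, `|w x| <= A) (q_le : forall x, `|q x| <= A).
Implicit Types (f g : R -> R) (N c k : R) (U V : (R -> R) * (R -> R)).

(* The density of the bilinear form of [L(k)]; the equation [sigma U = J L(k) U] says that
   [energy N k U V + sigma * symp N U V = 0] for all [V]. *)
Definition energy_density k U V (x : R) : R :=
  a x * (der U.1 x * der V.1 x)
  + (k ^+ 2 * a x - (q x - w x ^+ 2 / p x)) * (U.1 x * V.1 x)
  + w x * (der U.2 x * V.1 x + U.1 x * der V.2 x)
  + p x * (der U.2 x * der V.2 x) + k ^+ 2 * p x * (U.2 x * V.2 x).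

Definition energy N k U V := intg (- N) N (energy_density k U V).

Let p0 x : p x != 0. Proof. exact: (weight_neq0 kap0 p_ge). Qed.

Lemma energy_density_continuous k N U V : C2c2 N U -> C2c2 N V ->
  continuous (energy_density k U V).
Proof.
move=> [/C2c_continuous[U1 dU1] /C2c_continuous[U2 dU2]]
  [/C2c_continuous[V1 dV1] /C2c_continuous[V2 dV2]].
have ac := has_deriv_continuous aa; have pc := has_deriv_continuous pp.
have wc := has_deriv_continuous ww.
by rewrite /energy_density; cont.
Qed.

Lemma energy_sym N k U V : energy N k U V = energy N k V U.
Proof. by apply: eq_intg => x; rewrite /energy_density; ring. Qed.

Lemma energy_bilinear N k : bilinear_on (C2c2 N) (energy N k).
Proof.
have left V : C2c2 N V -> linear_on (C2c2 N) ((energy N k)^~ V).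
  move=> DV c u v Du Dv; have [Du1 Du2] := Du; have [Dv1 Dv2] := Dv.
  have cu := @energy_density_continuous k _ _ _ Du DV.
  have cv := @energy_density_continuous k _ _ _ Dv DV.
  rewrite /energy -intgZ // -intgD //; last by cont.
  apply: eq_intg => x; rewrite /energy_density /=.
  rewrite (C2c_derive_lin c Du1 Dv1) (C2c_derive_lin c Du2 Dv2).
  rewrite -[(c *: u.2 + v.2) x]/(c * u.2 x + v.2 x) -[(c *: u.1 + v.1) x]/(c * u.1 x + v.1 x).
  ring.
split=> // V DV c u v Du Dv.
by rewrite !(energy_sym N k V); exact: left.
Qed.

(** Completing the square in [phi'] produces [w^2 eta^2 / p], which is exactly the difference
    between [q] and the potential of [L(k)]. *)
Lemma energy_densityE k U x : energy_density k U U x =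
  (a x * der U.1 x ^+ 2 - q x * U.1 x ^+ 2)
  + p x * (der U.2 x + w x * U.1 x / p x) ^+ 2
  + k ^+ 2 * (a x * U.1 x ^+ 2 + p x * U.2 x ^+ 2).
Proof. by rewrite /energy_density; field; exact: p0. Qed.

Definition h1_density U (x : R) : R :=
  U.1 x ^+ 2 + der U.1 x ^+ 2 + U.2 x ^+ 2 + der U.2 x ^+ 2.

Lemma h1_density_continuous N U : C2c2 N U -> continuous (h1_density U).
Proof.
move=> [/C2c_continuous[U1 dU1] /C2c_continuous[U2 dU2]].
by rewrite /h1_density; cont.
Qed.

(** Adding [max(0, q) eta^2] removes the only negative term. The [k ^+ 2] term then controls [eta]
    and [phi], and [phi'] is recovered from [phi' + w eta / p] at the price of a multiple of
    [eta^2]. *)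
Lemma energy_coercive k : 0 < k -> exists2 c, 0 < c &
  forall U x, c * h1_density U x <= energy_density k U U x + Num.max 0 (q x) * U.1 x ^+ 2.
Proof.
move=> k0; pose B := (A / kap) ^+ 2.
have B0 : 0 <= B by exact: sqr_ge0.
have kk : 0 < k ^+ 2 * kap by rewrite mulr_gt0 // exprn_gt0.
have B1 : 0 < 1 + 2 * B by rewrite ltr_pwDl // mulr_ge0.
(* From [g1^2 <= 2 (g1 + y)^2 + 2 y^2] and [y^2 <= B e^2]: the first entry pays for the factor 2,
   the second for [1 + 2 B] copies of [e^2]. *)
pose c := Num.min (kap / 2) (k ^+ 2 * kap / (1 + 2 * B)).
have c0 : 0 < c by rewrite lt_min !divr_gt0.
have ck : 2 * c <= kap.
  have : c <= kap / 2 by rewrite ge_min lexx.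
  by rewrite ler_pdivlMr // mulrC.
have cB : c * (1 + 2 * B) <= k ^+ 2 * kap.
  by rewrite -ler_pdivlMr // ge_min lexx orbT.
exists c => // U x; rewrite energy_densityE /h1_density.
set e := U.1 x; set e1 := der U.1 x; set g := U.2 x; set g1 := der U.2 x.
have qm : q x * e ^+ 2 <= Num.max 0 (q x) * e ^+ 2.
  by rewrite ler_wpM2r ?sqr_ge0 // le_max lexx orbT.
set y := w x * e / p x.
have yB : y ^+ 2 <= B * e ^+ 2.
  have -> : y ^+ 2 = (w x / p x) ^+ 2 * e ^+ 2 by rewrite /y; ring.
  rewrite ler_wpM2r ?sqr_ge0 // /B -[(w x / p x) ^+ 2]real_normK ?num_real //.
  have A0 : 0 <= A by apply: le_trans (w_le 0).
  rewrite lerXn2r ?nnegrE ?divr_ge0 // ?(ltW kap0) //.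
  have px := lt_le_trans kap0 (p_ge x).
  rewrite normrM normfV (gtr0_norm px).
  by apply: ler_pM => //; rewrite ?invr_ge0 ?(ltW px) // lef_pV2 ?posrE.
have g1B : g1 ^+ 2 <= 2 * (g1 + y) ^+ 2 + 2 * y ^+ 2.
  rewrite -subr_ge0 (_ : _ - _ = (g1 + 2 * y) ^+ 2); first exact: sqr_ge0.
  ring.
have ax : kap * e1 ^+ 2 <= a x * e1 ^+ 2 by rewrite ler_wpM2r ?sqr_ge0.
have px : kap * (g1 + y) ^+ 2 <= p x * (g1 + y) ^+ 2 by rewrite ler_wpM2r ?sqr_ge0.
have ax' : kap * e ^+ 2 <= a x * e ^+ 2 by rewrite ler_wpM2r ?sqr_ge0.
have px' : kap * g ^+ 2 <= p x * g ^+ 2 by rewrite ler_wpM2r ?sqr_ge0.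
have ap : k ^+ 2 * (kap * e ^+ 2 + kap * g ^+ 2) <= k ^+ 2 * (a x * e ^+ 2 + p x * g ^+ 2).
  by rewrite ler_wpM2l ?sqr_ge0 // lerD.
have ck' : c <= k ^+ 2 * kap.
  by apply: le_trans cB; rewrite ler_peMr ?(ltW c0) // lerDl mulr_ge0.
have h1 : c * e1 ^+ 2 <= kap * e1 ^+ 2 by rewrite ler_wpM2r ?sqr_ge0 //; lra.
have h2 : c * g ^+ 2 <= k ^+ 2 * kap * g ^+ 2 by rewrite ler_wpM2r ?sqr_ge0.
have h3 : c * (1 + 2 * B) * e ^+ 2 <= k ^+ 2 * kap * e ^+ 2 by rewrite ler_wpM2r ?sqr_ge0.
have h4 : 2 * c * (g1 + y) ^+ 2 <= kap * (g1 + y) ^+ 2 by rewrite ler_wpM2r ?sqr_ge0.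
have h5 : c * g1 ^+ 2 <= c * (2 * (g1 + y) ^+ 2 + 2 * (B * e ^+ 2)).
  by rewrite ler_wpM2l ?(ltW c0) // (le_trans g1B) // lerD2l ler_wpM2l.
lra.
Qed.

Lemma energy_support N M k U : 0 <= N -> N <= M -> C2c2 N U ->
  energy M k U U = energy N k U U.
Proof.
move=> N0 NM DU; have [[_ _ _ U1] [_ _ _ U2]] := DU.
have Z x : N <= `|x| -> energy_density k U U x = 0.
  move=> xN; have [u1 du1] := U1 x xN; have [u2 du2] := U2 x xN.
  by rewrite /energy_density u1 u2 du1 du2; ring.
apply: intg_support; rewrite ?lerN2 ?ge0_cp //.
- exact: (energy_density_continuous DU DU).
- by move=> x xN; apply: Z; rewrite ler_normr lerNr xN orbT.
- by move=> x xN; apply: Z; rewrite ler_normr xN.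
Qed.

Variables (r r1 r2 : R -> R) (x0 Nq : R).
Hypotheses (rr : has_deriv r r1) (rr1 : has_deriv r1 r2) (r2c : continuous r2)
  (ode : has_deriv (fun x => a x * r1 x) (fun x => - q x * r x))
  (rx0 : r x0 = 0) (r1x0 : 0 < r1 x0) (r_neq0 : forall x, x != x0 -> r x != 0)
  (r_lim : forall e, 0 < e -> exists M, forall x, M <= x -> `|r x| <= e)
  (q_out : forall x, Nq <= `|x| -> q x <= 0).

(** The Jacobi form is non-negative when [U.1] vanishes at [x0], the completed square always is, and
    the mass comes from the [k ^+ 2] term with [a] and [p] at least [kap]. *)
Lemma energy_hyperplane N k U : 0 <= N -> C2c2 N U -> U.1 x0 = 0 ->
  k ^+ 2 * kap * mass N U <= energy N k U U.
Proof.
move=> N0 DU Ux0; have [U1 U2] := DU; have [d1 d2 _ out] := U1.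
have [cU1 cdU1] := C2c_continuous U1; have [cU2 cdU2] := C2c_continuous U2.
have a0 x : 0 <= a x by apply: le_trans (a_ge x); exact: ltW.
have J := jacobi_form_ge0 aa a0 qc rr ode (has_deriv_continuous rr1) rx0
  (lt0r_neq0 r1x0) r_neq0 d1 cdU1 Ux0 N0 out.
have ac := has_deriv_continuous aa.
have cJ : continuous (fun x => a x * der U.1 x ^+ 2 - q x * U.1 x ^+ 2) by cont.
have cM : continuous (fun x => U.1 x ^+ 2 + U.2 x ^+ 2) by cont.
have NN : - N <= N by rewrite ge0_cp.
rewrite /mass -intgZ // -[X in X <= _]add0r; apply: le_trans (lerD J (lexx _)) _.
rewrite -intgD //; last by cont.
apply: le_intg => //; [by cont|exact: (energy_density_continuous DU DU)|move=> x _].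
rewrite energy_densityE -[leRHS]addrA lerD2l ler_wpDl //.
  by rewrite mulr_ge0 ?sqr_ge0 // (le_trans _ (p_ge x)) // ltW.
rewrite -mulrA ler_wpM2l ?sqr_ge0 // mulrDr lerD // ler_wpM2r ?sqr_ge0 //.
Qed.

(** Budget: the one-dimensional form contributes [E < 0], the compensated square at most [- E / 2],
    and [k] is taken so small that its term is at most [- E / 4]; the sum is at most [E / 4]. *)
Lemma negative_energy : exists k N U, [/\ 0 < k, 0 < N, C2c2 N U & energy N k U U < 0].
Proof.
have [f [f1 [f2 [N [N0 [ff ff1 f2c] fN E0]]]]] := jacobi_form_lt0 aa kap0 a_ge a_le qc
  rr rr1 r2c ode rx0 r1x0 r_lim.
set E := intg _ _ _ in E0.
have e0 : 0 < - E / 2 by rewrite divr_gt0 // oppr_gt0.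
have [g [g1 [g2 [M [NM [gg gg1 g2c] gM gE]]]]] :=
  compensating_potential pp ww p1c w1c kap0 p_ge p_le N0 ff ff1 f2c fN e0.
have M0 : 0 < M := lt_le_trans N0 NM.
have fM x : M <= `|x| -> f x = 0 /\ f1 x = 0 by move=> xM; apply: fN; apply: le_trans xM.
pose U : (R -> R) * (R -> R) := (f, g).
have DU : C2c2 M U by split; [exact: (C2cI ff ff1)|exact: (C2cI gg gg1)].
have ac := has_deriv_continuous aa; have pc := has_deriv_continuous pp.
have wc := has_deriv_continuous ww.
have fc := has_deriv_continuous ff; have gc := has_deriv_continuous gg.
have f1c := has_deriv_continuous ff1; have g1c := has_deriv_continuous gg1.
pose Z := intg (- M) M (fun x => a x * f x ^+ 2 + p x * g x ^+ 2).
have cZ : continuous (fun x => a x * f x ^+ 2 + p x * g x ^+ 2) by cont.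
have MM : - M <= M by rewrite ge0_cp // ltW.
have a0 x : 0 <= a x by apply: le_trans (a_ge x); exact: ltW.
have p_ge0 x : 0 <= p x by apply: le_trans (p_ge x); exact: ltW.
have Z0 : 0 <= Z.
  by apply: intg_ge0 => // x _; rewrite addr_ge0 // mulr_ge0 // sqr_ge0.
pose k := Num.min 1 (- E / 4 / (Z + 1)).
have Z1 : 0 < Z + 1 by rewrite ltr_pwDr.
have k0 : 0 < k by rewrite lt_min ltr01 !divr_gt0 // oppr_gt0.
have kZ : k ^+ 2 * Z <= - E / 4.
  have k1 : k <= 1 by rewrite ge_min lexx.
  have k2 : k * (Z + 1) <= - E / 4 by rewrite -ler_pdivlMr // ge_min lexx orbT.
  apply: le_trans k2; rewrite expr2; apply: ler_pM; rewrite ?mulr_ge0 ?(ltW k0) //.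
    by rewrite ler_piMr // ltW.
  by rewrite lerDl.
exists k, M, U; split=> //.
rewrite /energy.
have cJ : continuous (fun x => a x * f1 x ^+ 2 - q x * f x ^+ 2) by cont.
have cP : continuous (fun x => p x * (g1 x + w x * f x / p x) ^+ 2) by cont.
rewrite (eq_intg _ _ (g := fun x => (a x * f1 x ^+ 2 - q x * f x ^+ 2)
  + p x * (g1 x + w x * f x / p x) ^+ 2
  + k ^+ 2 * (a x * f x ^+ 2 + p x * g x ^+ 2))); last first.
  by move=> x; rewrite energy_densityE /= (has_deriv_der ff) (has_deriv_der gg).
rewrite [X in X < 0]intgD; [|by cont|by cont].
rewrite [X in X + _ < 0]intgD // [X in _ + X < 0]intgZ // -/Z.
have -> : intg (- M) M (fun x => a x * f1 x ^+ 2 - q x * f x ^+ 2) = E.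
  apply: intg_support => //; rewrite ?lerN2 ?ge0_cp ?(ltW N0) //.
    move=> x xN; have [] := fN x; first by rewrite ler_normr lerNr xN orbT.
    by move=> -> ->; rewrite expr0n !mulr0 subrr.
  move=> x xN; have [] := fN x; first by rewrite ler_normr xN.
  by move=> -> ->; rewrite expr0n !mulr0 subrr.
by lra.
Qed.

End Forms.

(* For the solitary wave [a = K(rhoc)], [p = rhoc], [w = uc - c], [q = m + w^2 / p] and
   [r] is [rhoc'] up to sign. *)
Record wave_coefficients {R : realType} (a a1 p p1 w w1 q r r1 r2 : R -> R)
    (kap A x0 Nq : R) : Prop := WaveCoefficients {
  _ : has_deriv a a1; _ : has_deriv p p1; _ : has_deriv w w1;
  _ : continuous a1; _ : continuous p1; _ : continuous w1; _ : continuous q;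
  _ : 0 < kap;
  _ : forall x, kap <= a x; _ : forall x, a x <= A;
  _ : forall x, kap <= p x; _ : forall x, p x <= A;
  _ : forall x, `|w x| <= A; _ : forall x, `|q x| <= A;
  _ : has_deriv r r1; _ : has_deriv r1 r2; _ : continuous r2;
  _ : has_deriv (fun x => a x * r1 x) (fun x => - q x * r x);
  _ : r x0 = 0; _ : 0 < r1 x0; _ : forall x, x != x0 -> r x != 0;
  _ : forall e, 0 < e -> exists M, forall x, M <= x -> `|r x| <= e;
  _ : forall x, Nq <= `|x| -> q x <= 0 }.

(** * Uniform bounds for the Galerkin solutions and their growth rates *)

Section GalerkinBounds.
Context {R : realType}.

Lemma linear_onZ (F : rcfType) (W : lmodType F) (D : set W) (l : W -> F) c u :
  linear_subspace D -> linear_on D l -> D u -> l (c *: u) = c * l u.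
Proof.
by move=> DD ll Du; rewrite -[c *: u]addr0 ll ?(linear_on0 DD ll) ?addr0 //; exact: DD.1.
Qed.

Lemma quarter_turn_linear (b : R) (v z : (R -> R) * (R -> R)) :
  quarter_turn (b *: v + z) = b *: quarter_turn v + quarter_turn z.
Proof.
rewrite /quarter_turn; congr (_, _).
by rewrite -[LHS]/(- (b *: v.1 + z.1)) -[RHS]/(b *: - v.1 + - z.1) opprD scalerN.
Qed.

Lemma quarter_turnK (v : (R -> R) * (R -> R)) : quarter_turn (quarter_turn v) = - v.
Proof. by []. Qed.

Lemma cross_le (c x y M : R) : `|c| <= M -> c * (x * y) <= M * ((x ^+ 2 + y ^+ 2) / 2).
Proof.
move=> cM; apply: le_trans (ler_norm _) _; rewrite normrM.
apply: ler_pM => //; rewrite normrM ler_pdivlMr //.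
rewrite -(real_normK (num_real x)) -(real_normK (num_real y)).
have := sqr_ge0 (`|x| - `|y|); rewrite -subr_ge0 => H.
rewrite -subr_ge0 (_ : _ - _ = (`|x| - `|y|) ^+ 2) ?sqr_ge0 //; ring.
Qed.

(* Testing with [quarter_turn U] turns [sg] times the mass into the energy. *)
Lemma growth_rate_le (a a1 p p1 w w1 q : R -> R) (kap A k : R) :
  has_deriv a a1 -> has_deriv p p1 -> has_deriv w w1 -> continuous q -> 0 < kap ->
  (forall x, kap <= a x) -> (forall x, a x <= A) ->
  (forall x, kap <= p x) -> (forall x, p x <= A) ->
  (forall x, `|w x| <= A) -> (forall x, `|q x| <= A) ->
  exists2 C, 0 < C & forall N U, 0 <= N -> C2c2 N U ->
    - energy a p w q N k U (quarter_turn U) <= C * intg (- N) N (h1_density U).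
Proof.
move=> aa pp ww qc kap0 a_ge a_le p_ge p_le w_le q_le.
have A0 : 0 < A by apply: lt_le_trans kap0 (le_trans (a_ge 0) (a_le 0)).
pose B := k ^+ 2 * A + (A + A ^+ 2 / kap).
have kA : 0 <= k ^+ 2 * A by apply: mulr_ge0; [exact: sqr_ge0|exact: ltW].
have AA : 0 <= A ^+ 2 / kap by apply: divr_ge0; [exact: sqr_ge0|exact: ltW].
have B0 : 0 <= B by rewrite /B; clear -kA AA A0; lra.
exists (A + B + A + A + k ^+ 2 * A); first by clear -kA B0 A0; lra.
move=> N U N0 DU; have DJ := C2c2_quarter_turn DU.
have NN : - N <= N by rewrite ge0_cp.
have ce := energy_density_continuous aa pp ww qc kap0 p_ge DU DJ (k := k).
have ch := h1_density_continuous DU.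
rewrite -intgN // -intgZ //; apply: le_intg => //; [by cont|by cont|move=> x _].
have [U1 _] := DU; have [dU1 _ _ _] := U1.
have dJ2 : der (- U.1) = (fun y => - der U.1 y).
  by apply: has_deriv_der; exact: has_derivN dU1.
rewrite /energy_density /h1_density /= dJ2.
have -> : (- U.1) x = - U.1 x by [].
set e := U.1 x; set e1 := der U.1 x; set g := U.2 x; set g1 := der U.2 x.
have px := lt_le_trans kap0 (p_ge x).
have na : `|a x| <= A by rewrite ger0_norm // (le_trans (ltW kap0)).
have np : `|p x| <= A by rewrite ger0_norm // ltW.
have nk2 : `|k ^+ 2| = k ^+ 2 by rewrite ger0_norm // sqr_ge0.
have nkp : `|k ^+ 2 * p x| <= k ^+ 2 * A by rewrite normrM nk2 ler_wpM2l ?sqr_ge0.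
have nm : `|k ^+ 2 * a x - (q x - w x ^+ 2 / p x)| <= B.
  apply: le_trans (ler_normB _ _) _; apply: lerD.
    by rewrite normrM nk2 ler_wpM2l ?sqr_ge0.
  apply: le_trans (ler_normB _ _) _; apply: lerD => //.
  rewrite normrM normrX normfV (gtr0_norm px); apply: ler_pM.
  - by rewrite exprn_ge0.
  - by rewrite invr_ge0 ltW.
  - by rewrite lerXn2r ?nnegrE // ltW.
  - by rewrite lef_pV2 ?posrE.
have h1 := @cross_le (- a x) e1 g1 A ltac:(by rewrite normrN).
have h2 := @cross_le (- (k ^+ 2 * a x - (q x - w x ^+ 2 / p x))) e g B ltac:(by rewrite normrN).
have h3 := @cross_le (- w x) g1 g A ltac:(by rewrite normrN).
have h4 := @cross_le (w x) e e1 A (w_le x).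
have h5 := @cross_le (p x) g1 e1 A np.
have h6 := @cross_le (k ^+ 2 * p x) g e (k ^+ 2 * A) nkp.
have s1 := sqr_ge0 e; have s2 := sqr_ge0 e1; have s3 := sqr_ge0 g; have s4 := sqr_ge0 g1.
have -> : - (a x * (e1 * g1) + (k ^+ 2 * a x - (q x - w x ^+ 2 / p x)) * (e * g)
   + w x * (g1 * g + e * - e1) + p x * (g1 * - e1) + k ^+ 2 * p x * (g * - e)) =
   - a x * (e1 * g1) + - (k ^+ 2 * a x - (q x - w x ^+ 2 / p x)) * (e * g)
   + - w x * (g1 * g) + w x * (e * e1) + p x * (g1 * e1) + k ^+ 2 * p x * (g * e) by ring.
have t c (y z : R) : 0 <= c -> y <= z -> c * y <= c * z by move=> c0 yz; rewrite ler_wpM2l.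
set H := e ^+ 2 + e1 ^+ 2 + g ^+ 2 + g1 ^+ 2.
have t1 := t A ((e1 ^+ 2 + g1 ^+ 2) / 2) H (ltW A0) ltac:(rewrite /H; clear -s1 s2 s3 s4; lra).
have t2 := t B ((e ^+ 2 + g ^+ 2) / 2) H B0 ltac:(rewrite /H; clear -s1 s2 s3 s4; lra).
have t3 := t A ((g1 ^+ 2 + g ^+ 2) / 2 + (e ^+ 2 + e1 ^+ 2) / 2) H (ltW A0)
  ltac:(rewrite /H; clear -s1 s2 s3 s4; lra).
have t5 := t A ((g1 ^+ 2 + e1 ^+ 2) / 2) H (ltW A0) ltac:(rewrite /H; clear -s1 s2 s3 s4; lra).
have t6 := t (k ^+ 2 * A) ((g ^+ 2 + e ^+ 2) / 2) H kA ltac:(rewrite /H; clear -s1 s2 s3 s4; lra).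
rewrite mulrDr in t3.
have -> : (A + B + A + A + k ^+ 2 * A) * H = A * H + B * H + A * H + A * H + k ^+ 2 * A * H.
  by ring.
by clearbody H B; clear -h1 h2 h3 h4 h5 h6 t1 t2 t3 t5 t6; lra.
Qed.

(* [U - t u] lies in the hyperplane for a suitable [t], where the energy controls the mass. *)
Lemma growth_rate_ge (N m I E sg : R) (en : (R -> R) * (R -> R) -> (R -> R) * (R -> R) -> R)
    (U u : (R -> R) * (R -> R)) (x0 : R) :
  0 <= N -> bilinear_on (C2c2 N) en -> (forall V W, en V W = en W V) ->
  (forall W, C2c2 N W -> W.1 x0 = 0 -> m * mass N W <= en W W) -> 0 < m ->
  C2c2 N u -> C2c2 N U -> U != 0 -> mass N u <= I -> en u u <= - E -> 0 < E -> 0 <= I -> 0 < sg ->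
  en U U = 0 -> en U u = - sg * symp N U u -> Num.min m (E / (I + 1)) <= sg.
Proof.
move=> N0 [enl enr] ens hyp m0 Du DU Un0 uI uE E0 I0 sg0 UU Uu.
have mU := mass_gt0 N0 DU Un0.
(* In the hyperplane the energy dominates a positive multiple of the mass, whereas the energy of [U]
   is 0. *)
have Ux0 : U.1 x0 != 0.
  apply/eqP => Ux0; have := hyp _ DU Ux0; rewrite UU.
  by rewrite pmulr_rle0 // leNgt mU.
have ux0 : u.1 x0 != 0.
  apply/eqP => ux0; have := hyp _ Du ux0 => H.
  have : 0 <= m * mass N u.
    rewrite mulr_ge0 ?(ltW m0) //; apply: intg_ge0; first by rewrite ge0_cp.
      have [/C2c_continuous[c1 _] /C2c_continuous[c2 _]] := Du; by cont.
    by move=> x _; rewrite addr_ge0 ?sqr_ge0.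
  by clear -H uE E0; lra.
rewrite leNgt; apply/negP; rewrite lt_min => /andP[sgm]; rewrite ltr_pdivlMr ?ltr_wpDl // => sgE.
pose t := U.1 x0 / u.1 x0.
have t0 : 0 < t ^+ 2 by rewrite lt_neqAle sqr_ge0 andbT eq_sym sqrf_eq0 mulf_neq0 ?invr_eq0.
pose W := (- t) *: u + U.
have SS := C2c2_linear_subspace N.
have DW : C2c2 N W by exact: SS.2.
have W0 : W.1 x0 = 0.
  by rewrite -[LHS]/(- t * u.1 x0 + U.1 x0) /t mulNr divfK // addNr.
(* The energy of [U] vanishes, and the cross term is rewritten by the equation for [U] tested
   against [u]. *)
have EW : en W W = t ^+ 2 * en u u + 2 * t * sg * symp N U u.
  rewrite {1}/W (enl _ DW) // (ens u) (ens U) /W (enl _ Du) // (enl _ DU) //.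
  by rewrite UU (ens u U) Uu; ring.
have [syl syr] := symp_bilinear N.
have syW : symp N W u = symp N U u.
  rewrite /W (syl _ Du) //; have := symp_antisym Du Du => H.
  have -> : symp N u u = 0 by clear -H; lra.
  by rewrite mulr0 add0r.
(* This gives [m * mass W <= - t^2 E + sg * (mass W + t^2 I)], which is impossible when [sg < m] and
   [sg * (I + 1) < E]. *)
have AM : 2 * t * symp N W u <= mass N W + t ^+ 2 * mass N u.
  have [/C2c_continuous[c1 _] /C2c_continuous[c2 _]] := Du.
  have [/C2c_continuous[d1 _] /C2c_continuous[d2 _]] := DW.
  rewrite /symp /mass -intgZ; last by cont.
  rewrite -intgZ; last by cont.
  rewrite -intgD; [|by cont|by cont].
  apply: le_intg; [by rewrite ge0_cp|by cont|by cont|move=> x _].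
  rewrite -subr_ge0 (_ : _ - _ = (W.1 x + t * u.2 x) ^+ 2 + (W.2 x - t * u.1 x) ^+ 2).
    by rewrite addr_ge0 ?sqr_ge0.
  ring.
have hW := hyp _ DW W0.
have mW : 0 <= mass N W.
  apply: intg_ge0; first by rewrite ge0_cp.
    have [/C2c_continuous[c1 _] /C2c_continuous[c2 _]] := DW; by cont.
  by move=> x _; rewrite addr_ge0 ?sqr_ge0.
rewrite EW -syW in hW.
have h1 : sg * (2 * t * symp N W u) <= sg * (mass N W + t ^+ 2 * mass N u).
  by rewrite ler_wpM2l // ltW.
have h2 : t ^+ 2 * en u u <= t ^+ 2 * - E by rewrite ler_wpM2l // ltW.
have h3 : sg * (t ^+ 2 * mass N u) <= sg * (t ^+ 2 * I).
  by rewrite ler_wpM2l ?(ltW sg0) // ler_wpM2l // ltW.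
have h4 : sg * mass N W <= m * mass N W by rewrite ler_wpM2r // ltW.
have h5 : t ^+ 2 * (sg * (I + 1)) < t ^+ 2 * E by rewrite ltr_pM2l.
have h6 : 0 < t ^+ 2 * sg by rewrite mulr_gt0.
by clear -hW h1 h2 h3 h4 h5 h6; lra.
Qed.

(** The numbers [k], [s0], [s1], [C] do not depend on [s], because the negative direction [u0] and
    the constants of the form are fixed before [s] is given; only the window [N] grows with [s]. *)
Lemma galerkin_solutions (a a1 p p1 w w1 q r r1 r2 : R -> R) (kap A x0 Nq : R) :
  wave_coefficients a a1 p p1 w w1 q r r1 r2 kap A x0 Nq ->
  exists k s0 s1 C, [/\ 0 < k, 0 < s0 & forall s : seq (R -> R), exists N sg U,
    [/\ [/\ 0 < N, C2c2 N U & s0 <= sg <= s1], intg (- N) N (h1_density U) <= C,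
        intg (- N) N (fun x => Num.max 0 (q x) * U.1 x ^+ 2) = 1 &
        forall ps, ps \in s -> (exists M, C2c M ps) -> [/\ C2c N ps,
          energy a p w q N k U (ps, 0) + sg * symp N U (ps, 0) = 0 &
          energy a p w q N k U (0, ps) + sg * symp N U (0, ps) = 0]]].
Proof.
case=> aa pp ww a1c p1c w1c qc kap0 a_ge a_le p_ge p_le w_le q_le rr rr1 r2c ode rx0 r1x0
  r_neq0 r_lim q_out.
have A0 : 0 < A by apply: lt_le_trans kap0 (le_trans (a_ge 0) (a_le 0)).
have [k [N0 [u0 [k0 N0_gt0 Du0 Eu0]]]] := negative_energy aa pp ww p1c w1c qc kap0 a_ge a_le
  p_ge p_le rr rr1 r2c ode rx0 r1x0 r_lim.
have [c c0 coer] := energy_coercive q kap0 a_ge p_ge w_le k0.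
have [C C0 upper] := growth_rate_le k aa pp ww qc kap0 a_ge a_le p_ge p_le w_le q_le.
pose m := k ^+ 2 * kap; have m0 : 0 < m by rewrite mulr_gt0 // exprn_gt0.
pose I := mass N0 u0; pose E := - energy a p w q N0 k u0 u0.
have E0 : 0 < E by rewrite oppr_gt0.
have mass_ge0 (N : R) U : 0 <= N -> C2c2 N U -> 0 <= mass N U.
  move=> NN DU; apply: intg_ge0; first by rewrite ge0_cp.
    have [/C2c_continuous[d1 _] /C2c_continuous[d2 _]] := DU; by cont.
  by move=> x _; rewrite addr_ge0 ?sqr_ge0.
have I0 : 0 <= I by apply: mass_ge0 => //; exact: ltW.
exists k, (Num.min m (E / (I + 1))), (C * A / c), c^-1; split=> //.
  by rewrite lt_min m0 divr_gt0 // ltr_wpDl.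
move=> s.
have [N [NN0 Ns]] : exists N, N0 <= N /\ forall ps, ps \in s -> (exists M, C2c M ps) -> C2c N ps.
  elim: s => [|f s [N [NN0 Ns]]]; first by exists N0.
  have [[M Mf]|nf] := pselect (exists M, C2c M f); last first.
    by exists N; split=> // ps; rewrite inE => /orP[/eqP -> //|]; exact: Ns.
  exists (Num.max N M); split; first by rewrite le_max NN0.
  move=> ps; rewrite inE => /orP[/eqP -> _|pss psM].
    by apply: C2cW Mf; rewrite le_max lexx orbT.
  by apply: C2cW (Ns _ pss psM); rewrite le_max lexx.
have N_gt0 : 0 < N := lt_le_trans N0_gt0 NN0; have N_ge0 := ltW N_gt0.
have NN : - N <= N by rewrite ge0_cp.
(* Members of [s] that are not admissible are discarded; each of the others is used in either
   component. *)
pose t := [seq ps <- s | `[< exists M, C2c M ps >]].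
pose t2 : seq ((R -> R) * (R -> R)) := [seq (ps, 0) | ps <- t] ++ [seq (0, ps) | ps <- t].
have SD := C2c2_linear_subspace N; have SC := C2c_linear_subspace N.
have tC ps : ps \in t -> C2c N ps.
  by rewrite mem_filter => /andP[/asboolP psM pss]; exact: Ns.
have t2D : {in t2, forall v, C2c2 N v}.
  move=> v; rewrite mem_cat => /orP[/mapP[ps /tC H ->]|/mapP[ps /tC H ->]].
    by split; [exact: H|exact: SC.1].
  by split; [exact: SC.1|exact: H].
have Du : C2c2 N u0 by have [H1 H2] := Du0; split; exact: C2cW NN0 _.
pose en := energy a p w q N k.
have enb : bilinear_on (C2c2 N) en by exact: (energy_bilinear aa pp ww qc kap0 p_ge).
have ens V W : en V W = en W V by exact: energy_sym.
have hyp U : C2c2 N U -> U.1 x0 = 0 -> m * mass N U <= en U U.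
  exact: (energy_hyperplane aa pp ww qc kap0 a_ge p_ge rr rr1 ode rx0 r1x0 r_neq0).
have Eu : en u0 u0 = - E.
  by rewrite /E opprK; exact: (energy_support aa pp ww qc kap0 p_ge _ (ltW N0_gt0)).
have Iu : mass N u0 = I.
  have [[/has_deriv_continuous c1 _ _ z1] [/has_deriv_continuous c2 _ _ z2]] := Du0.
  have Z x : N0 <= `|x| -> u0.1 x ^+ 2 + u0.2 x ^+ 2 = 0.
    by move=> xN; have [-> _] := z1 x xN; have [-> _] := z2 x xN; rewrite expr0n addr0.
  apply: intg_support; rewrite ?lerN2 ?ge0_cp ?(ltW N0_gt0) //; first by cont.
    by move=> x xN; apply: Z; rewrite ler_normr lerNr xN orbT.
  by move=> x xN; apply: Z; rewrite ler_normr xN.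
have jl := quarter_turn_linear; have jj := quarter_turnK.
have opos (v : (R -> R) * (R -> R)) : C2c2 N v -> v != 0 -> 0 < symp N v (quarter_turn v).
  by rewrite symp_quarter_turn; exact: mass_gt0.
have ll : linear_on (C2c2 N) (fun U : (R -> R) * (R -> R) => U.1 x0) by [].
have Eu0' : en u0 u0 < 0 by rewrite Eu oppr_lt0.
have hyp' v : C2c2 N v -> v.1 x0 = 0 -> v != 0 -> 0 < en v v.
  by move=> Dv v0 vn0; apply: lt_le_trans (hyp v Dv v0); rewrite mulr_gt0 // mass_gt0.
have sya : {in C2c2 N &, forall v z, symp N v z = - symp N z v}.
  by move=> v z /set_mem Dv /set_mem Dz; exact: symp_antisym.
have [S [sg [U [SS SD' [Su0 St2] Sj [sg0 SU Un0 weak]]]]] :=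
  galerkin_pencil SD enb (symp_bilinear N) (fun V W _ _ => ens V W) sya jl jj
   (@C2c2_quarter_turn _ N) opos ll Du Eu0' hyp' t2D.
have DU : C2c2 N U by exact: SD'.
(* The equation tested against [U] itself: the antisymmetric form drops out. *)
have UU : en U U = 0.
  have := weak U SU; have := symp_antisym DU DU => H.
  by have -> : symp N U U = 0; [clear -H; lra|rewrite mulr0 addr0].
have Uu : en U u0 = - sg * symp N U u0.
  by have H := weak u0 Su0; clear -H; lra.
have [[/has_deriv_continuous c1 d1 _ _] [/has_deriv_continuous c2 d2 _ _]] := DU.
have qpc : continuous (fun x => Num.max 0 (q x)) by cont.
have cq1 : continuous (fun x => Num.max 0 (q x) * U.1 x ^+ 2) by cont.
have ch := h1_density_continuous DU.
have ce := energy_density_continuous aa pp ww qc kap0 p_ge DU DU (k := k).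
set Z := intg (- N) N (fun x => Num.max 0 (q x) * U.1 x ^+ 2).
set H := intg (- N) N (h1_density U).
have cHZ : c * H <= Z.
  rewrite -[Z]add0r -{1}UU /H /Z /en /energy -intgZ // -intgD //.
  by apply: (le_intg NN); [by cont|by cont|move=> x _; exact: coer].
have mH : mass N U <= H.
  apply: (le_intg NN); [by cont|by []|move=> x _]; rewrite /h1_density.
  have := sqr_ge0 (der U.1 x); have := sqr_ge0 (der U.2 x); clear; lra.
have mU := mass_gt0 N_ge0 DU Un0.
have H0 : 0 < H := lt_le_trans mU mH.
have Z0 : 0 < Z by apply: lt_le_trans cHZ; rewrite mulr_gt0.
have ZA : Z <= A * mass N U.
  rewrite /mass -intgZ; last by cont.
  apply: (le_intg NN); [by []|by cont|move=> x _].
  apply: (@le_trans _ _ (A * U.1 x ^+ 2)).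
    by rewrite ler_wpM2r ?sqr_ge0 // ge_max (ltW A0) (le_trans (ler_norm _)).
  by rewrite ler_wpM2l ?(ltW A0) // lerDl sqr_ge0.
have sg_ge : Num.min m (E / (I + 1)) <= sg.
  by apply: (growth_rate_ge N_ge0 enb ens hyp m0 Du DU Un0 _ _ E0 I0 sg0 UU Uu);
    rewrite ?Iu ?Eu.
(* Tested against the quarter turn of [U]: [sg * mass <= C H <= C Z / c <= (C A / c) * mass], and
   the mass cancels. *)
have sg_le : sg <= C * A / c.
  have := weak _ (Sj _ SU); rewrite symp_quarter_turn => /eqP.
  rewrite addrC addr_eq0 => /eqP sgm.
  have h1 := upper N U N_ge0 DU; rewrite -/(en _ _) -/H -sgm in h1.
  rewrite -(ler_pM2r mU) -(ler_pM2r c0).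
  have -> : C * A / c * mass N U * c = C * (A * mass N U).
    by field; rewrite gt_eqF.
  have h2 : sg * mass N U * c <= C * H * c by rewrite ler_pM2r.
  apply: (le_trans h2); rewrite -mulrA ler_pM2l // mulrC.
  exact: le_trans cHZ ZA.
(* Scaling to [Z = 1] is possible because [c H <= Z] with [H > 0]; the same inequality makes [c^-1]
   a bound for the H^1 integral. *)
pose lam := (Num.sqrt Z)^-1.
have lamZ : lam ^+ 2 * Z = 1.
  by rewrite /lam exprVn sqr_sqrtr ?(ltW Z0) // mulVf // gt_eqF.
have DV := SD.2 lam _ _ DU SD.1; rewrite addr0 in DV.
have s1 : (lam *: U).1 = (fun x => lam * U.1 x) by apply/funext.
have s2 : (lam *: U).2 = (fun x => lam * U.2 x) by apply/funext.
have dV1 : der (lam *: U).1 = (fun x => lam * der U.1 x).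
  by rewrite s1; apply: has_deriv_der; have [[dU _ _ _] _] := DU; exact: (has_derivMl lam dU).
have dV2 : der (lam *: U).2 = (fun x => lam * der U.2 x).
  by rewrite s2; apply: has_deriv_der; have [_ [dU _ _ _]] := DU; exact: (has_derivMl lam dU).
exists N, sg, (lam *: U); split.
- by split=> //; rewrite sg_ge sg_le.
- rewrite (eq_intg _ _ (g := fun x => lam ^+ 2 * h1_density U x)); last first.
    by move=> x; rewrite /h1_density dV1 dV2 s1 s2; ring.
  rewrite intgZ // -/H -(ler_pM2l c0) divff ?gt_eqF // mulrCA -lamZ.
  by rewrite ler_wpM2l // sqr_ge0.
- rewrite (eq_intg _ _ (g := fun x => lam ^+ 2 * (Num.max 0 (q x) * U.1 x ^+ 2))).
    by rewrite intgZ.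
  by move=> x; rewrite s1; ring.
move=> ps pss psM.
have pst : ps \in t by rewrite mem_filter pss andbT; apply/asboolP.
have wk v : C2c2 N v -> S v -> en (lam *: U) v + sg * symp N (lam *: U) v = 0.
  move=> Dv Sv; rewrite (linear_onZ lam SD (enb.1 _ Dv) DU).
  rewrite (linear_onZ lam SD ((symp_bilinear N).1 _ Dv) DU).
  by rewrite mulrCA -mulrDr weak // mulr0.
split; first exact: tC.
  by apply: wk; [apply: t2D|apply: St2]; rewrite mem_cat (map_f (fun ps => (ps, 0)) pst).
by apply: wk; [apply: t2D|apply: St2]; rewrite mem_cat (map_f (fun ps => (0, ps)) pst) orbT.
Qed.

End GalerkinBounds.

(** * From weak to classical solutions *)

Section DuBoisReymond.
Context {R : realType}.
Variables (p p1 : R -> R).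
Hypotheses (pp : has_deriv p p1) (p1c : continuous p1) (p_gt0 : forall x, 0 < p x).

Let p0 x : p x != 0. Proof. by rewrite gt_eqF. Qed.

(* [f] is projected onto the solutions [al + be P] of [(p y')' = 0] for the weight
   [(N^2 - x^2)_+]: the remainder, times the weight, is [(p ps')'] for an admissible [ps]. *)
Lemma weak_constant_on (f : R -> R) N : continuous f -> 0 < N ->
  (forall ps ps1 ps2 : R -> R, has_deriv ps ps1 -> has_deriv ps1 ps2 -> continuous ps2 ->
    (forall x, N <= `|x| -> ps x = 0 /\ ps1 x = 0) ->
    intg (- N) N (fun x => f x * (p1 x * ps1 x + p x * ps2 x)) = 0) ->
  exists be, forall x, - N < x < N -> is_derive x (1 : R) f (be / p x).
Proof.
move=> fc N0 weak.
have pc := has_deriv_continuous pp.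
have NN : - N <= N by rewrite ge0_cp // ltW.
pose K x := Num.max 0 (N ^+ 2 - x ^+ 2).
have Kc : continuous K by rewrite /K; cont.
have K0 x : 0 <= K x by rewrite le_max lexx.
have Kpos x : - N < x < N -> 0 < K x.
  by move=> xN; rewrite lt_max; apply/orP; right; nra.
have Kout x : x <= - N \/ N <= x -> K x = 0.
  by move=> xN; rewrite /K max_l //; case: xN => xN; nra.
have N00 : - N < 0 < N by rewrite N0 oppr_lt0 N0.
have pVc : continuous (fun x => (p x)^-1) by cont.
have dP := primitiveP pVc; set P := primitive _ in dP.
have Pc := has_deriv_continuous dP.
pose m0 := intg (- N) N K.
have m0_gt0 : 0 < m0.
  rewrite lt_neqAle intg_ge0 // andbT; apply/eqP => /esym I0.
  by have := Kpos _ N00; rewrite (intg_eq0 NN Kc (fun x _ => K0 x) I0 N00) ltxx.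
pose m1 := intg (- N) N (fun x => K x * P x).
(* Subtracting the weighted mean makes [Q] orthogonal to constants for the weight [K], so the
   coefficients [al] and [be] of the projection decouple. *)
pose Q x := P x - m1 / m0.
have dQ : has_deriv Q (fun x => (p x)^-1) by rewrite /Q; deriv; ring.
have Qc := has_deriv_continuous dQ.
have KQ : intg (- N) N (fun x => K x * Q x) = 0.
  rewrite (eq_intg _ _ (g := fun x => K x * P x - m1 / m0 * K x)); last first.
    by move=> x; rewrite /Q; ring.
  rewrite intgB; [|by cont|by cont].
  by rewrite intgZ // -/m0 -/m1 divfK ?subrr // gt_eqF.
pose m2 := intg (- N) N (fun x => K x * Q x ^+ 2).
have m2_gt0 : 0 < m2.
  have KQ0 x : - N <= x <= N -> 0 <= K x * Q x ^+ 2 by rewrite mulr_ge0 ?sqr_ge0.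
  have KQc : continuous (fun x => K x * Q x ^+ 2) by cont.
  rewrite lt_neqAle intg_ge0 // andbT; apply/eqP => /esym I0.
  (* A vanishing weighted norm would force [Q = 0] on the window, although its derivative is
     [1 / p]. *)
  have Q0 x : - N < x < N -> Q x = 0.
    move=> xN; have /eqP := intg_eq0 NN KQc KQ0 I0 xN.
    by rewrite mulf_eq0 gt_eqF ?Kpos // sqrf_eq0 => /eqP.
  have dQ0 : is_derive 0 (1 : R) Q 0.
    apply: (@near_eq_is_derive _ _ _ (cst 0) Q) => //.
    have : \forall y \near (0 : R), y \in `]- N, N[ by apply: near_in_itvoo; rewrite in_itv.
    by apply: filterS => y; rewrite in_itv /= => /Q0 ->.
  have : (p 0)^-1 = 0.
    by rewrite -(@derive_val _ _ _ _ _ _ _ (dQ 0)) (@derive_val _ _ _ _ _ _ _ dQ0).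
  by move/eqP; rewrite invr_eq0 (negbTE (p0 0)).
pose al := intg (- N) N (fun x => K x * f x) / m0.
pose be := intg (- N) N (fun x => K x * f x * Q x) / m2.
pose F x := f x - al - be * Q x.
have Fc : continuous F by rewrite /F; cont.
pose G x := K x * F x.
have Gc : continuous G by rewrite /G; cont.
have Gout x : x <= - N \/ N <= x -> G x = 0 by move=> /Kout Kx; rewrite /G Kx mul0r.
have G0 : intg (- N) N G = 0.
  rewrite (eq_intg _ _ (g := fun x => K x * f x - al * K x - be * (K x * Q x))); last first.
    by move=> x; rewrite /G /F; ring.
  rewrite !intgB; [|by cont|by cont|by cont|by cont].
  rewrite !intgZ //; last by cont.
  by rewrite KQ -/m0 /al divfK ?gt_eqF // subrr mulr0 subr0.
have GQ0 : intg (- N) N (fun x => G x * Q x) = 0.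
  rewrite (eq_intg _ _ (g := fun x => K x * f x * Q x - al * (K x * Q x) - be * (K x * Q x ^+ 2))); last first.
    by move=> x; rewrite /G /F; ring.
  rewrite !intgB; [|by cont|by cont|by cont|by cont].
  rewrite !intgZ; [|by cont|by cont].
  by rewrite KQ -/m2 /be divfK ?gt_eqF // mulr0 subr0 subrr.
(* Orthogonality of [G] to constants makes [Ps] vanish beyond [N]; orthogonality to [Q] does the
   same for the second integral [ps], through integration by parts. *)
pose Ps x := intg (- N) x G.
have dPs : has_deriv Ps G.
  by apply: (has_deriv_eq (has_derivB (primitiveP Gc) (has_deriv_cst _))) => x; rewrite subr0.
have PsL x : x <= - N -> Ps x = 0.
  move=> xN; rewrite /Ps /intg (has_deriv_cst_on (primitiveP Gc) xN) ?subrr // => y /andP[_ yN].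
  by rewrite Gout //; left.
have PsR x : N <= x -> Ps x = 0.
  move=> Nx; rewrite -(has_deriv_cst_on dPs Nx) // => y /andP[Ny _].
  by rewrite Gout //; right.
have Psc := has_deriv_continuous dPs.
pose ps1 x := Ps x / p x.
have ps1c : continuous ps1 by rewrite /ps1; cont.
pose ps x := intg (- N) x ps1.
have dps : has_deriv ps ps1.
  by apply: (has_deriv_eq (has_derivB (primitiveP ps1c) (has_deriv_cst _))) => x; rewrite subr0.
pose ps2 x := G x / p x + Ps x * (- p1 x / p x ^+ 2).
have dps1 : has_deriv ps1 ps2 by exact: has_derivM dPs (has_derivV pp p0).
have ps2c : continuous ps2.
  by rewrite /ps2; cont => // x; rewrite sqrf_eq0.
have psN : ps N = 0.
  rewrite /ps (eq_intg _ _ (g := fun x => (p x)^-1 * Ps x)); last by move=> x; rewrite /ps1 mulrC.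
  rewrite (intg_byparts _ _ dQ dPs) // PsR // PsL // !mulr0 subrr sub0r.
  by rewrite (eq_intg _ _ (g := fun x => G x * Q x)) ?GQ0 ?oppr0 // => x; rewrite mulrC.
have psout x : N <= `|x| -> ps x = 0 /\ ps1 x = 0.
  rewrite ler_normr lerNr => /orP[Nx|xN]; rewrite /ps1.
    rewrite PsR // mul0r; split=> //; rewrite -(has_deriv_cst_on dps Nx) // => y /andP[Ny _].
    by rewrite /ps1 PsR // mul0r.
  rewrite PsL // mul0r; split=> //; rewrite (has_deriv_cst_on dps xN).
    by rewrite /ps /intg subrr.
  by move=> y /andP[_ yN]; rewrite /ps1 PsL // mul0r.
have := weak _ _ _ dps dps1 ps2c psout.
(* Here [(p ps')' = G = K F]. Since [f = F + al + be Q] and [G] is orthogonal to the last two,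
   testing [f] gives the integral of [K F^2]. *)
rewrite (eq_intg _ _ (g := fun x => K x * F x ^+ 2 + al * G x + be * (G x * Q x))); last first.
  by move=> x; rewrite /ps1 /ps2 /G /F; field.
rewrite !intgD; [|by cont|by cont|by cont|by cont].
rewrite !intgZ //; last by cont.
rewrite G0 GQ0 !mulr0 !addr0 => I0.
have KF0 x : - N <= x <= N -> 0 <= K x * F x ^+ 2 by rewrite mulr_ge0 ?sqr_ge0.
have KFc : continuous (fun x => K x * F x ^+ 2) by cont.
have F0 x : - N < x < N -> F x = 0.
  move=> xN; have /eqP := intg_eq0 NN KFc KF0 I0 xN.
  by rewrite mulf_eq0 gt_eqF ?Kpos // sqrf_eq0 => /eqP.
exists be => x xN.
apply: (@near_eq_is_derive _ _ _ (fun y => al + be * Q y) f).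
  have : \forall y \near x, y \in `]- N, N[ by apply: near_in_itvoo; rewrite in_itv.
  apply: filterS => y; rewrite in_itv /= => /F0; rewrite /F => E.
  by clear -E; lra.
have H : has_deriv (fun y => al + be * Q y) (fun y => be / p y) by deriv; ring.
exact: H.
Qed.

(** With [H] a primitive of [h] and [B] one of [(g - H) / p], two integrations by parts show that
    [f + B] satisfies the homogeneous weak equation, and the derivative of [B] is known. *)
Lemma weak_solution_regular (f g h : R -> R) :
  continuous f -> continuous g -> continuous h ->
  (forall N (ps ps1 ps2 : R -> R), 0 < N ->
    has_deriv ps ps1 -> has_deriv ps1 ps2 -> continuous ps2 ->
    (forall x, N <= `|x| -> ps x = 0 /\ ps1 x = 0) ->
    intg (- N) N (fun x => f x * (p1 x * ps1 x + p x * ps2 x))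
    = intg (- N) N (fun x => g x * ps1 x + h x * ps x)) ->
  exists f1, has_deriv f f1 /\ has_deriv (fun x => p x * f1 x + g x) h.
Proof.
move=> fc gc hc weak.
have pc := has_deriv_continuous pp.
have dH := primitiveP hc; set H := primitive h in dH.
have Hc := has_deriv_continuous dH.
pose b x := (g x - H x) / p x.
have bc : continuous b by rewrite /b; cont.
have dB := primitiveP bc; set B := primitive b in dB.
have Bc := has_deriv_continuous dB.
pose F x := f x + B x.
have Fc : continuous F by rewrite /F; cont.
have loc (N : R) : 0 < N -> exists be : R, forall x : R, - N < x < N -> is_derive x (1 : R) F (be / p x).
  move=> N0; apply: weak_constant_on => // ps ps1 ps2 d1 d2 ps2c psN.
  have ps1c := has_deriv_continuous d2; have psc := has_deriv_continuous d1.
  have [pN1 pN2] := psN N ltac:(by rewrite gtr0_norm).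
  have [pN3 pN4] := psN (- N) ltac:(by rewrite normrN gtr0_norm).
  have dq : has_deriv (fun x => p x * ps1 x) (fun x => p1 x * ps1 x + p x * ps2 x).
    exact: has_derivM.
  have cq : continuous (fun x => p1 x * ps1 x + p x * ps2 x) by cont.
  rewrite (eq_intg _ _ (g := fun x => f x * (p1 x * ps1 x + p x * ps2 x)
    + (p1 x * ps1 x + p x * ps2 x) * B x)); last by move=> x; rewrite /F; ring.
  rewrite intgD; [|by cont|by cont].
  rewrite (weak N ps ps1 ps2) //.
  rewrite (intg_byparts _ _ dq dB) // pN2 pN4 !mulr0 !mul0r subrr sub0r.
  rewrite intgD; [|by cont|by cont].
  have -> : intg (- N) N (fun x => h x * ps x) = - intg (- N) N (fun x => H x * ps1 x).
    by rewrite (intg_byparts _ _ dH d1) // pN1 pN3 !mulr0 subrr sub0r.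
  rewrite -!intgN; [|by cont|by cont].
  rewrite -!intgD; [|by cont|by cont|by cont|by cont].
  rewrite (eq_intg _ _ (g := fun=> 0)) ?intg0 // => x.
  by rewrite /b; field.
pose F1 := derive1 F.
have locx (x : R) : exists N, 0 < N /\ - N < x < N.
  exists (`|x| + 1); split; first by rewrite ltr_wpDl.
  by rewrite -ltr_norml ltrDl.
have dF : has_deriv F F1.
  move=> x; have [N [N0 xN]] := locx x; have [be /(_ x xN) d] := loc N N0.
  by rewrite /F1 derive1E (@derive_val _ _ _ _ _ _ _ d).
(* The constants obtained on different windows need not be compared: being locally constant already
   gives a zero derivative. *)
have dpF : has_deriv (fun x => p x * F1 x) (fun=> 0).
  move=> x; have [N [N0 xN]] := locx x; have [be d] := loc N N0.
  apply: (@near_eq_is_derive _ _ _ (cst be)).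
  have : \forall y \near x, y \in `]- N, N[ by apply: near_in_itvoo; rewrite in_itv.
  apply: filterS => y; rewrite in_itv /= => /d dy.
  by rewrite /F1 derive1E (@derive_val _ _ _ _ _ _ _ dy) mulrC divfK.
exists (fun x => F1 x - b x); split.
  by apply: (has_deriv_ext (has_derivB dF dB)) => // x; rewrite /F addrK.
apply: (has_deriv_ext (has_derivD dpF dH)) => x; last by rewrite add0r.
by rewrite /b; field.
Qed.

End DuBoisReymond.

(** * One-dimensional Sobolev bounds *)

Section IntegralBounds.
Context {R : realType}.
Implicit Types (f g h : R -> R).

Lemma intg_norm_le (x y e : R) f g : x <= y -> continuous f -> continuous g ->
  (forall z, x <= z <= y -> `|f z| <= e * g z) -> `|intg x y f| <= e * intg x y g.
Proof.
move=> xy fc gc fg.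
have ce : continuous (fun z => e * g z) by cont.
rewrite ler_norml -intgZ //; apply/andP; split; last first.
  by apply: le_intg => // z /fg; rewrite ler_norml => /andP[].
rewrite -intgN //; apply: le_intg => //; first by cont.
by move=> z /fg; rewrite ler_norml => /andP[].
Qed.

Lemma intg_window f (N M : R) : 0 <= N -> 0 <= M -> continuous f ->
  (forall x, N <= `|x| -> f x = 0) -> (forall x, M <= `|x| -> f x = 0) ->
  intg (- N) N f = intg (- M) M f.
Proof.
move=> N0 M0 fc fN fM.
suff H K L : 0 <= K -> K <= L -> (forall x, K <= `|x| -> f x = 0) ->
    intg (- L) L f = intg (- K) K f.
  have [NM|/ltW MN] := leP N M; first by rewrite (H N M).
  exact: H.
move=> K0 KL fK; apply: intg_support => //; rewrite ?lerN2 ?ge0_cp //.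
  by move=> x xK; apply: fK; rewrite ler_normr lerNr xK orbT.
by move=> x xK; apply: fK; rewrite ler_normr xK.
Qed.

Lemma intg_le_window f (N x y : R) : 0 <= N -> x <= y -> continuous f ->
  (forall z, 0 <= f z) -> (forall z, N <= `|z| -> f z = 0) ->
  intg x y f <= intg (- N) N f.
Proof.
move=> N0 xy fc f0 fN; pose M := Num.max N (Num.max `|x| `|y|).
have NM : N <= M by rewrite le_max lexx.
have M0 : 0 <= M by apply: le_trans NM.
have xM : `|x| <= M by rewrite !le_max lexx orbT.
have yM : `|y| <= M by rewrite !le_max lexx !orbT.
rewrite (@intg_window f N M) //; last by move=> z Mz; apply: fN; apply: le_trans Mz.
apply: intg_sub => //.
  by move: xM; rewrite ler_norml => /andP[].
by move: yM; rewrite ler_norml => /andP[].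
Qed.

(** [f(x)^2] is the integral of [2 f f'] from [- N], where [f] vanishes, and
    [2 f f' <= f^2 + f'^2]. *)
Lemma sobolev_sup f f1 (N C : R) : has_deriv f f1 -> continuous f1 -> 0 <= N ->
  (forall x, N <= `|x| -> f x = 0 /\ f1 x = 0) ->
  intg (- N) N (fun x => f x ^+ 2 + f1 x ^+ 2) <= C -> forall x, f x ^+ 2 <= C.
Proof.
move=> ff f1c N0 fN IC x.
have fc := has_deriv_continuous ff.
have cH : continuous (fun x => f x ^+ 2 + f1 x ^+ 2) by cont.
have H0 z : 0 <= f z ^+ 2 + f1 z ^+ 2 by rewrite addr_ge0 ?sqr_ge0.
have HN z : N <= `|z| -> f z ^+ 2 + f1 z ^+ 2 = 0.
  by move=> /fN[-> ->]; rewrite expr0n addr0.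
have [Nx|xN] := leP N `|x|.
  have [-> _] := fN x Nx; rewrite expr0n /=; apply: le_trans IC.
  by apply: intg_ge0 => //; rewrite ge0_cp.
have Nx : - N <= x by move: xN; rewrite ltr_norml => /andP[/ltW].
have [fN0 _] := fN (- N) ltac:(by rewrite normrN ger0_norm).
have -> : f x ^+ 2 = intg (- N) x (fun z => 2 * (f z * f1 z)).
  by rewrite (intgE _ _ (has_deriv_sqr ff)) fN0 expr0n subr0.
apply: le_trans IC; apply: (@le_trans _ _ (intg (- N) x (fun z => f z ^+ 2 + f1 z ^+ 2))).
  apply: le_intg => // [|z _]; first by cont.
  rewrite -subr_ge0 (_ : _ - _ = (f z - f1 z) ^+ 2) ?sqr_ge0 //; ring.
exact: intg_le_window.
Qed.

(** Cauchy-Schwarz in the form that the integral of [(f' - l)^2] is non-negative, with [l] the mean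
    slope. *)
Lemma holder_half f f1 (N C : R) : has_deriv f f1 -> continuous f1 -> 0 <= N ->
  (forall x, N <= `|x| -> f x = 0 /\ f1 x = 0) ->
  intg (- N) N (fun x => f x ^+ 2 + f1 x ^+ 2) <= C ->
  forall x y, (f y - f x) ^+ 2 <= C * `|y - x|.
Proof.
move=> ff f1c N0 fN IC.
have fc := has_deriv_continuous ff.
have cH : continuous (fun x => f x ^+ 2 + f1 x ^+ 2) by cont.
have H0 z : 0 <= f z ^+ 2 + f1 z ^+ 2 by rewrite addr_ge0 ?sqr_ge0.
have HN z : N <= `|z| -> f z ^+ 2 + f1 z ^+ 2 = 0.
  by move=> /fN[-> ->]; rewrite expr0n addr0.
suff H x y : x < y -> (f y - f x) ^+ 2 <= C * (y - x).
  move=> x y; have [xy|yx|->] := ltgtP x y.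
  - by rewrite gtr0_norm ?subr_gt0 //; exact: H.
  - by rewrite distrC gtr0_norm ?subr_gt0 // -sqrrN opprB; exact: H.
  - by rewrite !subrr normr0 mulr0 expr0n.
move=> xy; have yx : 0 < y - x by rewrite subr_gt0.
pose l := (f y - f x) / (y - x).
have I1 : intg x y (fun z => f1 z ^+ 2) <= C.
  apply: le_trans IC; apply: (@le_trans _ _ (intg x y (fun z => f z ^+ 2 + f1 z ^+ 2))).
    by apply: le_intg (ltW xy) _ _ _ => //; [cont|move=> z _; rewrite lerDr sqr_ge0].
  by apply: intg_le_window => //; exact: ltW.
have I2 : 0 <= intg x y (fun z => f1 z ^+ 2 + (- (2 * l) * f1 z + l ^+ 2)).
  apply: intg_ge0 (ltW xy) _ _ => [|z _]; first by cont.
  by rewrite (_ : _ + _ = (f1 z - l) ^+ 2) ?sqr_ge0 //; ring.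
move: I2; rewrite !intgD; [|by cont|by cont|by cont|by cont].
rewrite intgZ // (intgE _ _ ff) intg_cst => I2.
have E : l * (y - x) = f y - f x by rewrite /l divfK // gt_eqF.
have : (f y - f x) ^+ 2 <= intg x y (fun z => f1 z ^+ 2) * (y - x).
  have h1 : 0 <= (intg x y (fun z => f1 z ^+ 2) + (- (2 * l) * (f y - f x) + l ^+ 2 * (y - x))) * (y - x).
    by rewrite mulr_ge0 // ltW.
  have h2 : l ^+ 2 * (y - x) * (y - x) = (f y - f x) ^+ 2 by rewrite -E; ring.
  have h3 : l * (f y - f x) * (y - x) = (f y - f x) ^+ 2 by rewrite -E; ring.
  by clear -h1 h2 h3; lra.
by move=> /le_trans; apply; rewrite ler_pM2r.
Qed.

End IntegralBounds.

(** * Convergence along an ultrafilter *)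

Section UltraLimits.
Context {R : realType} {T : Type} {F : set_system T} {FU : UltraFilter F}.

(** An ultrafilter on a compact interval converges, so no subsequences have to be extracted and all
    limits exist along the same filter. *)
Lemma bounded_ultra_cvg (f : T -> R) (M : R) : (forall s, `|f s| <= M) ->
  exists l : R, f s @[s --> F] --> l.
Proof.
move=> fM.
have FF : ProperFilter F by exact: ultra_proper.
have H s : `[- M, M]%classic (f s) by rewrite /= in_itv /= -ler_norml.
have /(_ (f @ F) _) := @segment_compact R (- M) M.
case; first by apply: (@filterS _ F _ setT) => [s _|]; [exact: H|exact: filterT].
move=> l [_ cl]; exists l => B Bl.
have [//|FnB] := in_ultra_setVsetC (f @^-1` B) FU.
by have [z [nBz Bz]] := cl (~` B) B FnB Bl.
Qed.

Definition unif_cvg (N : R) (h : T -> R -> R) (f : R -> R) :=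
  forall e, 0 < e -> F [set s | forall x, `|x| <= N -> `|h s x - f x| <= e].

Lemma unif_cvg_intg (N : R) (h : T -> R -> R) (f g : R -> R) : 0 <= N ->
  (forall s, continuous (h s)) -> continuous f -> continuous g -> unif_cvg N h f ->
  intg (- N) N (fun x => g x * h s x) @[s --> F] --> intg (- N) N (fun x => g x * f x).
Proof.
move=> N0 hc fc gc uc.
have FF : ProperFilter F by exact: ultra_proper.
have NN : - N <= N by rewrite ge0_cp.
(* A continuous majorant of [|g|]. *)
pose G x := 1 + g x ^+ 2.
have cG : continuous G by rewrite /G; cont.
have G0 : 0 <= intg (- N) N G by apply: intg_ge0 => // x _; rewrite /G addr_ge0 ?sqr_ge0.
apply/cvgrPdist_le => e e0.
have d0 : 0 < e / (intg (- N) N G + 1) by rewrite divr_gt0 // ltr_wpDl.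
apply: filterS (uc _ d0) => s us.
have hs := hc s.
rewrite -intgB; [|by cont|by cont].
apply: (@le_trans _ _ (e / (intg (- N) N G + 1) * intg (- N) N G)).
  apply: intg_norm_le => //; first by cont.
  move=> x /andP[x1 x2]; rewrite -mulrBr normrM mulrC; apply: ler_pM => //.
    by rewrite distrC; apply: us; rewrite ler_norml x1.
  rewrite /G -(real_normK (num_real (g x))).
  have := sqr_ge0 (`|g x| - 1); rewrite sqrrB1 => h1.
  by have := normr_ge0 (g x); clear -h1; lra.
by rewrite mulrAC ler_pdivrMr ?ltr_wpDl // ler_pM2l // lerDl.
Qed.

Lemma unif_cvg_sqr (N C : R) (h : T -> R -> R) (f : R -> R) : 0 < C ->
  (forall s x, `|h s x| <= C) -> (forall x, `|f x| <= C) -> unif_cvg N h f ->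
  unif_cvg N (fun s x => h s x ^+ 2) (fun x => f x ^+ 2).
Proof.
move=> C0 hC fC uc e e0.
have FF : ProperFilter F by exact: ultra_proper.
have d0 : 0 < e / (C + C) by rewrite divr_gt0 // addr_gt0.
apply: filterS (uc _ d0) => s us x xN.
rewrite subr_sqr normrM.
apply: (@le_trans _ _ (e / (C + C) * (C + C))); last by rewrite divfK // gt_eqF // addr_gt0.
apply: ler_pM => //; first exact: us.
by apply: le_trans (ler_normD _ _) _; exact: lerD.
Qed.

(* Equicontinuity upgrades pointwise convergence, along a finite grid, to uniform
   convergence. *)
Lemma equicontinuous_unif_cvg (N C : R) (h : T -> R -> R) (f : R -> R) : 0 < C ->
  (forall s x y, (h s y - h s x) ^+ 2 <= C * `|y - x|) ->
  (forall x y, (f y - f x) ^+ 2 <= C * `|y - x|) ->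
  (forall x, h s x @[s --> F] --> f x) -> unif_cvg N h f.
Proof.
move=> C0 hC fC hf e e0.
have FF : ProperFilter F by exact: ultra_proper.
have [N0|N0] := ltP N 0.
  apply: filterS (@filterT _ F _) => s _ x xN.
  by have := le_lt_trans (normr_ge0 x) (le_lt_trans xN N0); rewrite ltxx.
(* Grid spacing at which the Hoelder bound limits every oscillation to [e / 3]. *)
pose d := (e / 3) ^+ 2 / C.
have e3 : 0 < e / 3 by rewrite divr_gt0.
have d0 : 0 < d by rewrite divr_gt0 // exprn_gt0.
pose grid (i : nat) := - N + i%:R * d.
have fin n : F [set s | forall i, (i < n)%N -> `|h s (grid i) - f (grid i)| <= e / 3].
  elim: n => [|n IH]; first by apply: filterS (@filterT _ F _).
  have H : F [set s | `|h s (grid n) - f (grid n)| <= e / 3].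
    have /cvgrPdist_le/(_ _ e3) := hf (grid n).
    by apply: filterS => s; rewrite distrC.
  apply: filterS (filterI IH H) => s [H1 H2] i; rewrite ltnS leq_eqVlt => /orP[/eqP -> //|].
  exact: H1.
have small (g : R -> R) x y : (forall x y, (g y - g x) ^+ 2 <= C * `|y - x|) ->
    `|y - x| <= d -> `|g y - g x| <= e / 3.
  move=> gC yx; rewrite -(@ler_pXn2r _ 2) ?nnegrE //; last exact: ltW.
  rewrite real_normK ?num_real //; apply: le_trans (gC x y) _.
  by rewrite -ler_pdivlMl // mulrC.
pose n := (Num.truncn ((N + N) / d)).+1.
apply: filterS (fin n) => s us x xN.
have [x1 x2] : - N <= x /\ x <= N by apply/andP; rewrite -ler_norml.
have xN0 : 0 <= (x + N) / d by rewrite divr_ge0 ?(ltW d0) // -lerBlDr sub0r.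
pose i := Num.truncn ((x + N) / d).
have /andP[i1 i2] := truncn_itv xN0; rewrite -/i in i1 i2.
have ilt : (i < n)%N.
  rewrite /n ltnS; apply: le_truncn.
  by rewrite ler_pM2r ?invr_gt0 // lerD2r.
have xi : `|x - grid i| <= d.
  rewrite ler_pdivlMr // in i1; rewrite ltr_pdivrMr // -natr1 mulrDl mul1r in i2.
  rewrite /grid ger0_norm; clear -i1 i2; lra.
have h1 := small (h s) _ _ (hC s) xi; have h2 := small f _ _ fC xi.
have h3 := us i ilt.
have -> : h s x - f x = (h s x - h s (grid i)) + (h s (grid i) - f (grid i)) - (f x - f (grid i)).
  by ring.
apply: le_trans (ler_normB _ _) _; have := ler_normD (h s x - h s (grid i)) (h s (grid i) - f (grid i)).
by clear -h1 h2 h3; lra.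
Qed.

End UltraLimits.

Section WeakLimit.
Context {R : realType} {T : Type} {F : set_system T} {FU : UltraFilter F}.

(** Lower semicontinuity in dual form: the hypothesis involves [f] undifferentiated and therefore
    survives passage to the limit; the choice [g = chi f'] with a cutoff [chi] returns the bound on
    [f']. *)
Lemma derivative_window_le (f f1 f2 : R -> R) (C : R) :
  has_deriv f f1 -> has_deriv f1 f2 -> continuous f2 ->
  (forall N (g g1 : R -> R), 0 < N -> has_deriv g g1 -> continuous g1 ->
     (forall x, N <= `|x| -> g x = 0 /\ g1 x = 0) ->
     - 2 * intg (- N) N (fun x => g1 x * f x) <= C + intg (- N) N (fun x => g x ^+ 2)) ->
  forall N, intg (- N) N (fun x => f1 x ^+ 2) <= C.
Proof.
move=> ff ff1 f2c test.
have fc := has_deriv_continuous ff; have f1c := has_deriv_continuous ff1.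
suff H N : 0 < N -> intg (- N) N (fun x => f1 x ^+ 2) <= C.
  move=> N; have [N0|N0] := ltP 0 N; first exact: H.
  have c2 : continuous (fun x => f1 x ^+ 2) by cont.
  (* For [N <= 0] the reversed orientation makes the integral non-positive, and [0 <= C] follows
     from the window of radius 1. *)
  have h1 := H 1 ltr01.
  have h2 : 0 <= intg (- 1) 1 (fun x => f1 x ^+ 2).
    by apply: intg_ge0; [rewrite ge0_cp|exact: c2|move=> x _; exact: sqr_ge0].
  have h3 : 0 <= intg N (- N) (fun x => f1 x ^+ 2).
    by apply: intg_ge0; [rewrite le0_cp|exact: c2|move=> x _; exact: sqr_ge0].
  have h4 := intg_chasles N (- N) N (fun x => f1 x ^+ 2).
  have h5 : intg N N (fun x => f1 x ^+ 2) = 0 by rewrite /intg subrr.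
  by clear -h1 h2 h3 h4 h5; lra.
move=> N0.
have [S [S1 [S2 [D [[SS SS1 S2c D0] S_0 S_1 S1D]]]]] := @smooth_step R.
have S01 x : 0 <= S x <= 1.
  have mono u v : u <= v -> S u <= S v.
    by move=> uv; apply: (has_deriv_ge SS uv) => y _; have /andP[] := S1D y.
  have [x0|/ltW x0] := leP x 0; first by have [-> _] := S_0 x x0; rewrite lexx ler01.
  have [x1|/ltW x1] := leP 1 x; first by have [-> _] := S_1 x x1; rewrite lexx ler01.
  have [<- _] := S_0 0 (lexx _); have [<- _] := S_1 1 (lexx _).
  by rewrite !mono.
pose M := N + 1.
have M0 : 0 < M by rewrite /M addr_gt0.
have MM : - M <= M by rewrite ge0_cp // ltW.
have dl : has_deriv (fun x => M - x) (fun=> -1) by deriv; ring.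
have dr : has_deriv (fun x => M + x) (fun=> 1) by deriv; ring.
pose chi x := S (M - x) * S (M + x).
pose chi1 x := S1 (M - x) * -1 * S (M + x) + S (M - x) * (S1 (M + x) * 1).
have dchi : has_deriv chi chi1.
  exact: has_derivM (has_deriv_comp SS dl) (has_deriv_comp SS dr).
have cl := has_deriv_continuous (has_deriv_comp SS1 dl).
have cr := has_deriv_continuous (has_deriv_comp SS1 dr).
have cl0 := has_deriv_continuous (has_deriv_comp SS dl).
have cr0 := has_deriv_continuous (has_deriv_comp SS dr).
have chi1c : continuous chi1 by rewrite /chi1; cont.
have chic := has_deriv_continuous dchi.
have chi01 x : 0 <= chi x <= 1.
  have /andP[a1 a2] := S01 (M - x); have /andP[b1 b2] := S01 (M + x).
  by rewrite /chi mulr_ge0 //= mulr_ile1.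
have chi0 x : M <= `|x| -> chi x = 0 /\ chi1 x = 0.
  rewrite ler_normr /chi /chi1 => /orP[Mx|Mx].
    by have [-> ->] := S_0 (M - x) ltac:(by rewrite subr_le0); rewrite !mul0r addr0.
  have [-> ->] := S_0 (M + x) ltac:(by clear -Mx; lra).
  by rewrite !mul0r !mulr0 addr0.
have chi_1 x : - N <= x <= N -> chi x = 1.
  move=> /andP[x1 x2]; rewrite /chi.
  have [-> _] := S_1 (M - x) ltac:(rewrite /M; clear -x2; lra).
  by have [-> _] := S_1 (M + x) ltac:(rewrite /M; clear -x1; lra); rewrite mulr1.
pose g x := chi x * f1 x; pose g1 x := chi1 x * f1 x + chi x * f2 x.
have dg : has_deriv g g1 by exact: has_derivM.
have g1c : continuous g1 by rewrite /g1; cont.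
have g0 x : M <= `|x| -> g x = 0 /\ g1 x = 0.
  by move=> /chi0[e1 e2]; rewrite /g /g1 e1 e2 !mul0r addr0.
have := test M g g1 M0 dg g1c g0.
rewrite (intg_byparts _ _ dg ff) //.
have [gM _] := g0 M ltac:(by rewrite gtr0_norm).
have [gM' _] := g0 (- M) ltac:(by rewrite normrN gtr0_norm).
rewrite gM gM' !mul0r subrr sub0r mulrNN => H.
pose J := intg (- M) M (fun x => chi x * f1 x ^+ 2).
have cJ : continuous (fun x => chi x * f1 x ^+ 2) by cont.
have E1 : intg (- M) M (fun x => g x * f1 x) = J.
  by apply: eq_intg => x; rewrite /g; ring.
have E2 : intg (- M) M (fun x => g x ^+ 2) <= J.
  have cg := has_deriv_continuous dg.
  apply: (le_intg MM); [by cont|by []|move=> x _].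
  rewrite /g exprMn ler_wpM2r ?sqr_ge0 //; have /andP[c0 c1] := chi01 x.
  by rewrite expr2 ler_piMr.
have E3 : intg (- N) N (fun x => f1 x ^+ 2) <= J.
  have NN : - N <= N by rewrite ge0_cp // ltW.
  apply: (@le_trans _ _ (intg (- N) N (fun x => chi x * f1 x ^+ 2))).
    by apply: (le_intg NN); [by cont|by []|move=> x xN; rewrite chi_1 // mul1r].
  apply: intg_sub => //; [by rewrite lerN2 lerDl|by rewrite lerDl|move=> x].
  by rewrite mulr_ge0 ?sqr_ge0 //; have /andP[] := chi01 x.
by rewrite E1 in H; clear -H E2 E3; lra.
Qed.

(** The derivatives [h1 s] are not shown to converge. Only integrals of [h s] against continuous
    functions pass to the limit, so the bound on the derivative of [f] is stated for the case that
    [f] is known to be C^2. *)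
Lemma H1_limit (Nw : T -> R) (h h1 : T -> R -> R) (C : R) :
  (forall s, [/\ 0 < Nw s, has_deriv (h s) (h1 s), continuous (h1 s),
     forall x, Nw s <= `|x| -> h s x = 0 /\ h1 s x = 0 &
     intg (- Nw s) (Nw s) (fun x => h s x ^+ 2 + h1 s x ^+ 2) <= C]) ->
  exists f : R -> R, [/\ continuous f,
    forall N (g : R -> R), 0 <= N -> continuous g ->
      intg (- N) N (fun x => g x * h s x) @[s --> F] --> intg (- N) N (fun x => g x * f x),
    forall N (g : R -> R), 0 <= N -> continuous g ->
      intg (- N) N (fun x => g x * h s x ^+ 2) @[s --> F]
        --> intg (- N) N (fun x => g x * f x ^+ 2),
    forall N, 0 <= N -> intg (- N) N (fun x => f x ^+ 2) <= C &
    forall f1 f2 : R -> R, has_deriv f f1 -> has_deriv f1 f2 -> continuous f2 ->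
      forall N, intg (- N) N (fun x => f1 x ^+ 2) <= C].
Proof.
move=> data.
have FF : ProperFilter F by exact: ultra_proper.
(* At least 1 and at least [C], so that [f^2 <= C] yields [|f| <= M]; it also serves as the Hoelder
   constant. *)
pose M := `|C| + 1.
have M0 : 0 < M by rewrite ltr_wpDl.
have M1 : 1 <= M by rewrite lerDr.
have CM : C <= M by apply: le_trans (ler_norm C) _; rewrite lerDl.
have sup s x : `|h s x| <= M.
  have [N0 dh ch out IC] := data s.
  have H := sobolev_sup dh ch (ltW N0) out IC x.
  rewrite -(@ler_pXn2r _ 2) ?nnegrE ?(ltW M0) // real_normK ?num_real //.
  apply: (le_trans H); apply: (le_trans CM).
  by rewrite expr2 ler_peMr ?(ltW M0).
have hold s x y : (h s y - h s x) ^+ 2 <= M * `|y - x|.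
  have [N0 dh ch out IC] := data s.
  apply: le_trans (holder_half dh ch (ltW N0) out IC x y) _.
  by rewrite ler_wpM2r.
have [f fP] := choice (fun x => bounded_ultra_cvg (fun s => sup s x)).
have supf x : `|f x| <= M.
  have H : `|h s x| @[s --> F] --> `|f x| by apply: cvg_norm; exact: fP.
  apply: (cvgr_to_le H).
  by apply: (@filterS _ F _ setT) => [s _|]; [exact: sup|exact: filterT].
have holdf x y : (f y - f x) ^+ 2 <= M * `|y - x|.
  have H : (h s y - h s x) ^+ 2 @[s --> F] --> (f y - f x) ^+ 2.
    by rewrite expr2; under eq_fun do rewrite expr2; apply: cvgM; apply: cvgB; exact: fP.
  apply: (cvgr_to_le H).
  by apply: (@filterS _ F _ setT) => [s _|]; [exact: hold|exact: filterT].
have fc : continuous f.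
  move=> x; apply/cvgrPdist_le => e e0; near=> y.
  have yx : `|y - x| <= e ^+ 2 / M.
    rewrite distrC; near: y; apply: cvgr_dist_le; last by rewrite divr_gt0 // exprn_gt0.
    exact: cvg_id.
  rewrite distrC -(@ler_pXn2r _ 2) ?nnegrE //; last exact: ltW.
  rewrite real_normK ?num_real //; apply: (le_trans (holdf x y)).
  by rewrite -ler_pdivlMl // mulrC.
have hc s : continuous (h s) by have [_ dh _ _ _] := data s; exact: has_deriv_continuous dh.
have uc N : unif_cvg (F := F) N h f.
  exact: equicontinuous_unif_cvg M0 hold holdf fP.
have uc2 N : unif_cvg (F := F) N (fun s x => h s x ^+ 2) (fun x => f x ^+ 2).
  exact: unif_cvg_sqr M0 sup supf (uc N).
have f2c : continuous (fun x => f x ^+ 2) by cont.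
have h2c s : continuous (fun x => h s x ^+ 2) by have := hc s => hsc; cont.
have dens s : [/\ 0 <= Nw s, continuous (fun x => h s x ^+ 2 + h1 s x ^+ 2),
    forall x, 0 <= h s x ^+ 2 + h1 s x ^+ 2 &
    forall x, Nw s <= `|x| -> h s x ^+ 2 + h1 s x ^+ 2 = 0].
  have [N0 dh ch out _] := data s; have hsc := hc s; split; [exact: ltW|by cont| |].
    by move=> x; rewrite addr_ge0 ?sqr_ge0.
  by move=> x /out[-> ->]; rewrite expr0n addr0.
exists f; split=> //.
- by move=> N g N0 gc; exact: unif_cvg_intg.
- by move=> N g N0 gc; exact: (unif_cvg_intg N0 h2c).
- move=> N N0; have NN : - N <= N by rewrite ge0_cp.
  have E (k : R -> R) : intg (- N) N (fun x => 1 * k x) = intg (- N) N k.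
    by apply: eq_intg => x; rewrite mul1r.
  have H := @unif_cvg_intg _ _ _ FU _ _ _ _ N0 h2c f2c (@continuous_const R 1) (uc2 N).
  rewrite (E (fun x => f x ^+ 2)) in H; apply: (cvgr_to_le H).
  apply: (@filterS _ F _ setT) => [s _|]; last exact: filterT.
  rewrite (E (fun x => h s x ^+ 2)).
  have [N0' c1 p1 z1] := dens s; have [_ _ ch _ IC] := data s; have hsc := hc s.
  apply: le_trans IC; apply: le_trans (intg_le_window N0' NN c1 p1 z1).
  by apply: (le_intg NN); [by cont|by []|move=> x _; rewrite lerDl sqr_ge0].
- move=> f1 f2 ff ff1 f2c'; apply: (derivative_window_le ff ff1 f2c').
  move=> N g g1 N0 gg g1c g0.
  have NN : - N <= N by rewrite ge0_cp // ltW.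
  have gc := has_deriv_continuous gg.
  have H := @unif_cvg_intg _ _ _ FU _ _ _ _ (ltW N0) hc fc g1c (uc N).
  have H2 : - 2 * intg (- N) N (fun x => g1 x * h s x) @[s --> F]
      --> - 2 * intg (- N) N (fun x => g1 x * f x).
    by apply: cvgM => //; exact: cvg_cst.
  apply: (cvgr_to_le H2).
  apply: (@filterS _ F _ setT) => [s _|]; last exact: filterT.
  have [N0' c1 p1 z1] := dens s; have [_ dh ch _ IC] := data s; have hsc := hc s.
  rewrite (intg_byparts _ _ gg dh) //.
  have [gN _] := g0 N ltac:(by rewrite gtr0_norm).
  have [gN' _] := g0 (- N) ltac:(by rewrite normrN gtr0_norm).
  rewrite gN gN' !mul0r subrr sub0r mulrNN -intgZ; last by cont.
  apply: (@le_trans _ _ (intg (- N) N (fun x => (h s x ^+ 2 + h1 s x ^+ 2) + g x ^+ 2))).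
    apply: (le_intg NN); [by cont|by cont|move=> x _].
    have h2 := sqr_ge0 (h s x); rewrite -subr_ge0.
    rewrite (_ : _ - _ = h s x ^+ 2 + (h1 s x - g x) ^+ 2); last by ring.
    by rewrite addr_ge0 // sqr_ge0.
  rewrite intgD //; last by cont.
  by rewrite lerD2r; apply: le_trans IC; exact: intg_le_window.
Unshelve. all: by end_near. Qed.

End WeakLimit.

(** * Passage to the limit in the Galerkin equations *)

Section Eigenmode.
Context {R : realType}.

(** Finite sets ordered by inclusion: every single test function eventually belongs to the Galerkin
    space, without choosing a countable dense family. *)
Lemma ultrafilter_of_finite_sets (I : eqType) : exists F : set_system (seq I),
  UltraFilter F /\ forall i, F [set s : seq I | i \in s].
Proof.
pose B := filter_from setT (fun s : seq I => [set s' : seq I | {subset s <= s'}]).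
have BF : ProperFilter B.
  apply: filter_from_proper; last by move=> s _; exists s.
  apply: filter_from_filter; first by exists [::].
  move=> s t _ _; exists (s ++ t) => // u su; split=> x xs; apply: su;
    by rewrite mem_cat xs ?orbT.
have [F [FU BF']] := ultraFilterLemma BF.
exists F; split=> // i; apply: BF'; exists [:: i] => // s; apply.
exact: mem_head.
Qed.

Lemma der0 : der (0 : R -> R) = (fun=> 0).
Proof. by apply: has_deriv_der; exact: has_deriv_cst. Qed.

(** All derivatives are moved from [U] to [ps], because only [U] itself converges, and the window
    [M] of the Galerkin solution is shrunk to that of [ps], which stays fixed in the limit. *)
Lemma weak_identity_density (a a1 p p1 w w1 q : R -> R) (k sg N M : R) (U : (R -> R) * (R -> R))
    (ps ps1 ps2 : R -> R) :
  has_deriv a a1 -> has_deriv w w1 -> continuous a1 -> continuous w1 -> continuous q ->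
  has_deriv p p1 -> continuous p1 -> (forall x, p x != 0) -> 0 < N -> 0 < M -> C2c2 M U ->
  C2c M ps -> has_deriv ps ps1 -> has_deriv ps1 ps2 -> continuous ps2 ->
  (forall x, N <= `|x| -> ps x = 0 /\ ps1 x = 0) ->
  energy a p w q M k U (ps, 0) + sg * symp M U (ps, 0) = 0 ->
  energy a p w q M k U (0, ps) + sg * symp M U (0, ps) = 0 ->
  - intg (- N) N (fun x => (a1 x * ps1 x + a x * ps2 x) * U.1 x)
  + intg (- N) N (fun x => (k ^+ 2 * a x - (q x - w x ^+ 2 / p x)) * ps x * U.1 x)
  - intg (- N) N (fun x => (w1 x * ps x + w x * ps1 x) * U.2 x)
  + sg * intg (- N) N (fun x => ps x * U.2 x) = 0 /\
  - intg (- N) N (fun x => (p1 x * ps1 x + p x * ps2 x) * U.2 x)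
  + intg (- N) N (fun x => w x * ps1 x * U.1 x)
  + intg (- N) N (fun x => k ^+ 2 * p x * ps x * U.2 x)
  - sg * intg (- N) N (fun x => ps x * U.1 x) = 0.
Proof.
move=> aa ww a1c w1c qc pp p1c p0 N0 M0 DU CM ps_ ps_1 ps2c out En1 En2.
have ac := has_deriv_continuous aa; have wc := has_deriv_continuous ww.
have pc := has_deriv_continuous pp; have psc := has_deriv_continuous ps_.
have ps1c := has_deriv_continuous ps_1.
have [U1 U2] := DU; have [du1 ddu1 _ _] := U1; have [du2 ddu2 _ _] := U2.
have [u1c du1c] := C2c_continuous U1; have [u2c du2c] := C2c_continuous U2.
have outM x : M <= `|x| -> ps x = 0 /\ ps1 x = 0.
  by have [_ _ _ H] := CM; move=> /H; rewrite (has_deriv_der ps_).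
have [psN ps1N] := out N ltac:(by rewrite gtr0_norm).
have [psN' ps1N'] := out (- N) ltac:(by rewrite normrN gtr0_norm).
have byp (f f1 g g1 : R -> R) : has_deriv f f1 -> has_deriv g g1 -> continuous f1 -> continuous g1 ->
    g N = 0 -> g (- N) = 0 ->
    intg (- N) N (fun x => f1 x * g x) = - intg (- N) N (fun x => g1 x * f x).
  move=> ff gg f1c g1c gN gN'.
  rewrite (intg_byparts _ _ ff gg) // gN gN' !mulr0 subrr sub0r; congr (- _).
  by apply: eq_intg => x; rewrite mulrC.
have daps : has_deriv (fun x => a x * ps1 x) (fun x => a1 x * ps1 x + a x * ps2 x).
  exact: has_derivM.
have dwps : has_deriv (fun x => w x * ps x) (fun x => w1 x * ps x + w x * ps1 x).
  exact: has_derivM.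
have dpps : has_deriv (fun x => p x * ps1 x) (fun x => p1 x * ps1 x + p x * ps2 x).
  exact: has_derivM.
have c1 : continuous (fun x => a1 x * ps1 x + a x * ps2 x) by cont.
have c2 : continuous (fun x => w1 x * ps x + w x * ps1 x) by cont.
have c3 : continuous (fun x => p1 x * ps1 x + p x * ps2 x) by cont.
have b1 := byp _ _ _ _ du1 daps du1c c1 ltac:(by rewrite /= ps1N mulr0) ltac:(by rewrite /= ps1N' mulr0).
have b2 := byp _ _ _ _ du2 dwps du2c c2 ltac:(by rewrite /= psN mulr0) ltac:(by rewrite /= psN' mulr0).
have b3 := byp _ _ _ _ du2 dpps du2c c3 ltac:(by rewrite /= ps1N mulr0) ltac:(by rewrite /= ps1N' mulr0).
have win (f : R -> R) : continuous f -> (forall x, ps x = 0 -> ps1 x = 0 -> f x = 0) ->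
    intg (- M) M f = intg (- N) N f.
  move=> fc f0; apply: intg_window; rewrite ?(ltW N0) ?(ltW M0) // => x.
    by move=> /outM[e1 e2]; exact: f0.
  by move=> /out[e1 e2]; exact: f0.
have z : continuous (0 : R -> R) by exact: continuous_const.
have z0 x : (0 : R -> R) x = 0 by [].
have cd : continuous (energy_density a p w q k U (ps, 0)).
  by rewrite /energy_density /= der0 (has_deriv_der ps_); cont.
have cd' : continuous (energy_density a p w q k U (0, ps)).
  by rewrite /energy_density /= der0 (has_deriv_der ps_); cont.
have cs : continuous (fun x => U.2 x * (ps, 0 : R -> R).1 x - U.1 x * (ps, 0 : R -> R).2 x).
  by rewrite /=; cont.
have cs' : continuous (fun x => U.2 x * (0 : R -> R, ps).1 x - U.1 x * (0 : R -> R, ps).2 x).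
  by rewrite /=; cont.
split.
  have E : intg (- M) M (fun x => der U.1 x * (a x * ps1 x)
      + (k ^+ 2 * a x - (q x - w x ^+ 2 / p x)) * ps x * U.1 x
      + der U.2 x * (w x * ps x) + sg * (ps x * U.2 x)) = 0.
    rewrite -[RHS]En1 /energy /symp -intgZ // -intgD //; last by cont.
    apply: eq_intg => x; rewrite /energy_density /= der0 (has_deriv_der ps_) z0.
    by field; exact: p0.
  rewrite win in E; first last.
  - by move=> x e1 e2; rewrite e1 e2; ring.
  - by cont.
  move: E; rewrite !intgD; [|by cont|by cont|by cont|by cont|by cont|by cont].
  rewrite b1 b2 intgZ; last by cont.
  by [].
have E : intg (- M) M (fun x => der U.2 x * (p x * ps1 x) + w x * ps1 x * U.1 x
      + k ^+ 2 * p x * ps x * U.2 x - sg * (ps x * U.1 x)) = 0.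
  rewrite -[RHS]En2 /energy /symp -intgZ // -intgD //; last by cont.
  apply: eq_intg => x; rewrite /energy_density /= der0 (has_deriv_der ps_) z0.
  by field; exact: p0.
rewrite win in E; first last.
- by move=> x e1 e2; rewrite e1 e2; ring.
- by cont.
move: E; rewrite intgB; [|by cont|by cont].
rewrite !intgD; [|by cont|by cont|by cont|by cont].
by rewrite b3 intgZ //; cont.
Qed.

Lemma classical_eigenmode (a a1 p p1 w w1 q r r1 r2 : R -> R) (kap A x0 Nq : R) :
  wave_coefficients a a1 p p1 w w1 q r r1 r2 kap A x0 Nq ->
  exists k sg C (e e1 g g1 : R -> R), [/\ 0 < k /\ 0 < sg,
    [/\ has_deriv e e1, has_deriv g g1,
        has_deriv (fun x => a x * e1 x) (fun x =>
          (k ^+ 2 * a x - (q x - w x ^+ 2 / p x)) * e x + w x * g1 x + sg * g x) &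
        has_deriv (fun x => p x * g1 x + w x * e x) (fun x => k ^+ 2 * p x * g x - sg * e x)],
    exists x, e x != 0 &
    forall N, 0 <= N -> [/\ intg (- N) N (fun x => e x ^+ 2) <= C,
      intg (- N) N (fun x => e1 x ^+ 2) <= C, intg (- N) N (fun x => g x ^+ 2) <= C &
      intg (- N) N (fun x => g1 x ^+ 2) <= C]].
Proof.
move=> wc; have [k [s0 [s1 [C [k0 s0_gt0 sol]]]]] := galerkin_solutions wc.
case: wc => aa pp ww a1c p1c w1c qc kap0 a_ge a_le p_ge p_le w_le q_le rr rr1 r2c ode rx0 r1x0
  r_neq0 r_lim q_out.
have a_gt0 x : 0 < a x := lt_le_trans kap0 (a_ge x).
have p_gt0 x : 0 < p x := lt_le_trans kap0 (p_ge x).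
have p0 x : p x != 0 by rewrite gt_eqF.
have a0 x : a x != 0 by rewrite gt_eqF.
have ac := has_deriv_continuous aa; have wc := has_deriv_continuous ww.
have pc := has_deriv_continuous pp.
have {sol} /choice[Nw /choice[sgw /choice[Uw sol]]] := sol.
have [F [FU Fin]] := ultrafilter_of_finite_sets (R -> R).
have FF : ProperFilter F by exact: ultra_proper.
have ev (P : seq (R -> R) -> Prop) : (forall s, P s) -> F [set s | P s].
  by move=> Ps; apply: (@filterS _ F _ setT) => [s _|]; [exact: Ps|exact: filterT].
have sg_le s : `|sgw s| <= `|s1|.
  have [[_ _ /andP[h1 h2]] _ _ _] := sol s.
  by rewrite ger0_norm ?(le_trans (ltW s0_gt0)) // (le_trans h2) // ler_norm.
have [sg sgP] := bounded_ultra_cvg (F := F) sg_le.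
have sg0 : 0 < sg.
  apply: lt_le_trans s0_gt0 _; apply: (cvgr_to_ge sgP); apply: ev => s.
  by have [[_ _ /andP[]]] := sol s.
have data1 s : [/\ 0 < Nw s, has_deriv (Uw s).1 (der (Uw s).1), continuous (der (Uw s).1),
     forall x, Nw s <= `|x| -> (Uw s).1 x = 0 /\ der (Uw s).1 x = 0 &
     intg (- Nw s) (Nw s) (fun x => (Uw s).1 x ^+ 2 + der (Uw s).1 x ^+ 2) <= C].
  have [[N0 DU _] IC _ _] := sol s; have [U1 U2] := DU.
  have [u1 du1] := C2c_continuous U1; have [u2 du2] := C2c_continuous U2.
  have [h1 h2 h3 h4] := U1; split; [exact: N0|exact: h1|exact: du1|exact: h4|apply: le_trans IC].
  have NN : - Nw s <= Nw s by rewrite ge0_cp // ltW.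
  apply: (le_intg NN); [by cont|exact: (h1_density_continuous DU)|move=> x _].
  rewrite /h1_density -addrA lerDl addr_ge0 ?sqr_ge0 //.
have data2 s : [/\ 0 < Nw s, has_deriv (Uw s).2 (der (Uw s).2), continuous (der (Uw s).2),
     forall x, Nw s <= `|x| -> (Uw s).2 x = 0 /\ der (Uw s).2 x = 0 &
     intg (- Nw s) (Nw s) (fun x => (Uw s).2 x ^+ 2 + der (Uw s).2 x ^+ 2) <= C].
  have [[N0 DU _] IC _ _] := sol s; have [U1 U2] := DU.
  have [u1 du1] := C2c_continuous U1; have [u2 du2] := C2c_continuous U2.
  have [h1 h2 h3 h4] := U2; split; [exact: N0|exact: h1|exact: du2|exact: h4|apply: le_trans IC].
  have NN : - Nw s <= Nw s by rewrite ge0_cp // ltW.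
  apply: (le_intg NN); [by cont|exact: (h1_density_continuous DU)|move=> x _].
  rewrite /h1_density -addrA lerDr addr_ge0 ?sqr_ge0 //.
have [e [ec elim elim2 eL2 eH1]] := @H1_limit _ _ F FU _ _ _ _ data1.
have [g [gc glim glim2 gL2 gH1]] := @H1_limit _ _ F FU _ _ _ _ data2.
pose m x := k ^+ 2 * a x - (q x - w x ^+ 2 / p x).
have mc : continuous m by rewrite /m; cont.
have ids N (ps ps1 ps2 : R -> R) : 0 < N -> has_deriv ps ps1 -> has_deriv ps1 ps2 ->
    continuous ps2 -> (forall x, N <= `|x| -> ps x = 0 /\ ps1 x = 0) ->
  - intg (- N) N (fun x => (a1 x * ps1 x + a x * ps2 x) * e x)
  + intg (- N) N (fun x => m x * ps x * e x)
  - intg (- N) N (fun x => (w1 x * ps x + w x * ps1 x) * g x)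
  + sg * intg (- N) N (fun x => ps x * g x) = 0 /\
  - intg (- N) N (fun x => (p1 x * ps1 x + p x * ps2 x) * g x)
  + intg (- N) N (fun x => w x * ps1 x * e x)
  + intg (- N) N (fun x => k ^+ 2 * p x * ps x * g x)
  - sg * intg (- N) N (fun x => ps x * e x) = 0.
  move=> N0 d1 d2 ps2c out; have N0' := ltW N0.
  have psc := has_deriv_continuous d1; have ps1c := has_deriv_continuous d2.
  have uniq (f : seq (R -> R) -> R) (l : R) : f s @[s --> F] --> l ->
      F [set s | f s = 0] -> l = 0.
    move=> fl F0; apply: (@cvg_unique _ _ (f @ F)) => //.
    apply: (@cvg_trans _ ((fun=> 0) @ F)); last exact: cvg_cst.
    by apply: near_eq_cvg; apply: filterS F0 => s /= ->.
  have weak : F [set s | forall M, M = Nw s ->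
      energy a p w q M k (Uw s) (ps, 0) + sgw s * symp M (Uw s) (ps, 0) = 0 /\
      energy a p w q M k (Uw s) (0, ps) + sgw s * symp M (Uw s) (0, ps) = 0 /\ C2c M ps].
    apply: filterS (Fin ps) => s /= pss M ->.
    have [_ _ _ /(_ ps pss)[]] := sol s; last by [].
    by exists N; exact: (C2cI d1 d2).
  split.
    apply: (uniq (fun s => - intg (- N) N (fun x => (a1 x * ps1 x + a x * ps2 x) * (Uw s).1 x)
      + intg (- N) N (fun x => m x * ps x * (Uw s).1 x)
      - intg (- N) N (fun x => (w1 x * ps x + w x * ps1 x) * (Uw s).2 x)
      + sgw s * intg (- N) N (fun x => ps x * (Uw s).2 x))).
      apply: cvgD; last by apply: cvgM => //; apply: glim.
      apply: cvgB; last by apply: glim => //; cont.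
      by apply: cvgD; [apply: cvgN|]; apply: elim => //; cont.
    apply: filterS weak => s /= /(_ _ erefl)[w_1 [w_2 C2]].
    have [[M0 DU _] _ _ _] := sol s.
    by have [] := weak_identity_density aa ww a1c w1c qc pp p1c p0 N0 M0 DU C2 d1 d2 ps2c out w_1 w_2.
  apply: (uniq (fun s => - intg (- N) N (fun x => (p1 x * ps1 x + p x * ps2 x) * (Uw s).2 x)
      + intg (- N) N (fun x => w x * ps1 x * (Uw s).1 x)
      + intg (- N) N (fun x => k ^+ 2 * p x * ps x * (Uw s).2 x)
      - sgw s * intg (- N) N (fun x => ps x * (Uw s).1 x))).
    apply: cvgB; last by apply: cvgM => //; apply: elim.
    apply: cvgD; last by apply: glim => //; cont.
    apply: cvgD; first by apply: cvgN; apply: glim => //; cont.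
    by apply: elim => //; cont.
  apply: filterS weak => s /= /(_ _ erefl)[w_1 [w_2 C2]].
  have [[M0 DU _] _ _ _] := sol s.
  by have [] := weak_identity_density aa ww a1c w1c qc pp p1c p0 N0 M0 DU C2 d1 d2 ps2c out w_1 w_2.
have [g1 [gg ggp]] : exists g1, has_deriv g g1 /\
    has_deriv (fun x => p x * g1 x + w x * e x) (fun x => k ^+ 2 * p x * g x - sg * e x).
  apply: (weak_solution_regular pp p1c p_gt0 gc); [by cont|by cont|].
  move=> N ps ps1 ps2 N0 d1 d2 ps2c out.
  have psc := has_deriv_continuous d1; have ps1c := has_deriv_continuous d2.
  have [_ I] := ids N ps ps1 ps2 N0 d1 d2 ps2c out.
  rewrite (eq_intg _ _ (g := fun x => (p1 x * ps1 x + p x * ps2 x) * g x)); last first.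
    by move=> x; rewrite mulrC.
  rewrite [RHS](eq_intg _ _ (g := fun x => w x * ps1 x * e x + k ^+ 2 * p x * ps x * g x
     - sg * (ps x * e x))); last by move=> x; ring.
  rewrite intgB; [|by cont|by cont].
  rewrite intgD; [|by cont|by cont].
  rewrite intgZ; last by cont.
  by clear -I; lra.
have g1c : continuous g1.
  have H := has_deriv_continuous ggp.
  have -> : g1 = (fun x => (p x * g1 x + w x * e x - w x * e x) / p x).
    by apply/funext => x; rewrite addrK mulrC mulKf.
  set y := (fun x => p x * g1 x + w x * e x) in H *.
  have -> : (fun x => (p x * g1 x + w x * e x - w x * e x) / p x)
     = (fun x => (y x - w x * e x) / p x) by [].
  by cont.
(* The flux is [a e' - w g], with [g] undifferentiated; the derivative of [w g], available now that
   [g] is known to be C^1, is added back afterwards. *)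
have [e1 [ee eea]] : exists e1, has_deriv e e1 /\
    has_deriv (fun x => a x * e1 x + - (w x * g x)) (fun x => m x * e x - w1 x * g x + sg * g x).
  apply: (weak_solution_regular aa a1c a_gt0 ec); [by cont|by cont|].
  move=> N ps ps1 ps2 N0 d1 d2 ps2c out.
  have psc := has_deriv_continuous d1; have ps1c := has_deriv_continuous d2.
  have [I _] := ids N ps ps1 ps2 N0 d1 d2 ps2c out.
  rewrite (eq_intg _ _ (g := fun x => (a1 x * ps1 x + a x * ps2 x) * e x)); last first.
    by move=> x; rewrite mulrC.
  rewrite [RHS](eq_intg _ _ (g := fun x => m x * ps x * e x
     - (w1 x * ps x + w x * ps1 x) * g x + sg * (ps x * g x))); last by move=> x; ring.
  rewrite intgD; [|by cont|by cont].
  rewrite intgB; [|by cont|by cont].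
  rewrite intgZ; last by cont.
  by clear -I; lra.
have dae : has_deriv (fun x => a x * e1 x) (fun x => m x * e x + w x * g1 x + sg * g x).
  apply: (has_deriv_ext (has_derivD eea (has_derivM ww gg))) => x; first by rewrite subrK.
  ring.
have de1 := has_deriv_quotient aa a0 dae; set e2 := (X in has_deriv e1 X) in de1.
have e1c := has_deriv_continuous de1.
have e2c : continuous e2 by rewrite /e2; cont.
have dpg : has_deriv (fun x => p x * g1 x) (fun x => k ^+ 2 * p x * g x - sg * e x - (w1 x * e x + w x * e1 x)).
  by apply: (has_deriv_ext (has_derivB ggp (has_derivM ww ee))) => // x; rewrite addrK.
have dg1 := has_deriv_quotient pp p0 dpg; set g2 := (X in has_deriv g1 X) in dg1.
have g2c : continuous g2 by rewrite /g2; cont.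
exists k, sg, C, e, e1, g, g1; split=> //; last first.
  by move=> N N0; split; [exact: eL2|exact: eH1 ee de1 e2c N|exact: gL2|exact: gH1 gg dg1 g2c N].
(* If [e] vanished identically, the normalised integrals, which equal 1 on the fixed window outside
   which [max(0, q)] is 0, would converge to 0. *)
apply: contrapT => e0.
have e00 x : e x = 0.
  by apply/eqP; apply: contraT => ex; exfalso; apply: e0; exists x.
pose M := Num.max Nq 0.
have M0 : 0 <= M by rewrite le_max lexx orbT.
have qM x : M <= `|x| -> Num.max 0 (q x) = 0.
  by move=> Mx; rewrite max_l // q_out // (le_trans _ Mx) // le_max lexx.
have qpc : continuous (fun x => Num.max 0 (q x)) by cont.
have L := elim2 M (fun x => Num.max 0 (q x)) M0 qpc.
have : intg (- M) M (fun x => Num.max 0 (q x) * e x ^+ 2) = 1.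
  apply: (@cvg_unique _ _ ((fun s => intg (- M) M (fun x => Num.max 0 (q x) * (Uw s).1 x ^+ 2)) @ F)) => //.
  apply: (@cvg_trans _ ((fun=> 1) @ F)); last exact: cvg_cst.
  apply: near_eq_cvg; apply: ev => s /=.
  have [[N0 [U1 _] _] _ I1 _] := sol s; have [u1 _] := C2c_continuous U1.
  rewrite -I1; apply: intg_window => //; first exact: ltW.
  - by cont.
  - by move=> x xN; have [_ _ _ /(_ x xN)[-> _]] := U1; rewrite expr0n mulr0.
  - by move=> x /qM ->; rewrite mul0r.
rewrite (eq_intg _ _ (g := fun=> 0)) ?intg0; last by move=> x; rewrite e00 expr0n mulr0.
by move/eqP; rewrite eq_sym oner_eq0.
Qed.

End Eigenmode.

(** * Translation to Lebesgue integrals, weak derivatives and L^2 *)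

Section LebesgueLink.
Context {R : realType}.
Notation mu := (@lebesgue_measure R).
Implicit Types (f g : R -> R).

Lemma integral_intg f (x y : R) : x < y -> continuous f ->
  (\int[mu]_(z in `[x, y]) (f z)%:E = (intg x y f)%:E)%E.
Proof.
move=> xy fc; have pf := primitiveP fc.
have Fc := has_deriv_continuous pf.
rewrite (@continuous_FTC2 _ f (primitive f)) //.
- exact: continuous_subspaceT.
- split=> [z _||]; first exact: (@ex_derive _ _ _ _ _ _ _ (pf z)).
  + by apply: cvg_at_right_filter; exact: Fc.
  + by apply: cvg_at_left_filter; exact: Fc.
- by move=> z _; rewrite (has_derivE pf).
Qed.

Lemma integral_le_of_windows f C : continuous f -> (forall x, 0 <= f x) ->
  (forall N, 0 <= N -> intg (- N) N f <= C) -> (\int[mu]_x (f x)%:E <= C%:E)%E.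
Proof.
move=> fc f0 fC.
pose W (n : nat) : set R := `[- n.+1%:R, n.+1%:R]%classic.
have WT : \bigcup_n W n = setT.
  rewrite -subTset => x _; exists (Num.truncn `|x|) => //=.
  rewrite /W /= in_itv /= -ler_norml ltW //.
  by have /andP[] := truncn_itv (normr_ge0 x).
rewrite -WT; have H : (\int[mu]_(x in W n) (f x)%:E @[n --> \oo] --> \int[mu]_(x in \bigcup_n W n) (f x)%:E)%E.
  apply: ge0_nondecreasing_set_cvg_integral.
  - move=> m n mn; apply/subsetPset => x; rewrite /W /= !in_itv /= -!ler_norml => /le_trans; apply.
    by rewrite ler_nat ltnS.
  - by move=> n; exact: measurable_itv.
  - move=> n; apply/measurable_EFinP; apply: measurable_funTS.
    exact: continuous_measurable_fun.
  - by move=> n x _; rewrite lee_fin.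
rewrite -(cvg_lim _ H) //; apply: lime_le; first by apply/cvg_ex; eexists; exact: H.
apply: nearW => n; rewrite integral_intg // ?lee_fin; first exact: fC.
by have n0 : 0 < n.+1%:R :> R; rewrite ?ltr0n //; lra.
Qed.

Lemma continuous_Lfun2 f C : continuous f ->
  (forall N, 0 <= N -> intg (- N) N (fun x => f x ^+ 2) <= C) -> f \in Lfun mu 2%:E.
Proof.
move=> fc fC; rewrite inE; apply/andP; split; rewrite inE /=.
  exact: continuous_measurable_fun.
rewrite /finite_norm unlock; apply: poweR_lty.
have f2c : continuous (fun x => f x ^+ 2) by cont.
apply: (@le_lt_trans _ _ (\int[mu]_x (f x ^+ 2)%:E)%E).
  rewrite le_eqVlt; apply/orP; left; apply/eqP; apply: eq_integral => x _.
  by rewrite /= powR_mulrn // real_normK // num_real.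
by apply: (le_lt_trans (integral_le_of_windows f2c (fun x => sqr_ge0 (f x)) fC)); rewrite ltry.
Qed.

Lemma continuous_locally_integrable f : continuous f -> locally_integrable setT f.
Proof.
move=> fc; split; [exact: continuous_measurable_fun|exact: openT|move=> K _ Kc].
have /integrableP[_] := continuous_compact_integrable Kc (continuous_subspaceT fc).
by [].
Qed.

Lemma Rintegral_window f (N : R) : 0 < N -> continuous f ->
  (forall x, N <= `|x| -> f x = 0) -> (\int[mu]_(x in setT) f x)%R = intg (- N) N f.
Proof.
move=> N0 fc f0.
transitivity (\int[mu]_(x in `[- N, N]) f x)%R.
  rewrite [RHS]Rintegral_mkcond; congr Rintegral; apply/funext => x.
  rewrite patchE; case: ifPn => // xN; apply: f0; rewrite leNgt; apply/negP => xN'.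
  move/negP: xN; apply; rewrite inE /= in_itv /= -ler_norml; exact: ltW.
by rewrite /Rintegral integral_intg //; lra.
Qed.

Lemma has_deriv_weak_derivR f f1 : has_deriv f f1 -> continuous f1 -> weak_derivR f f1.
Proof.
move=> ff f1c; have fc := has_deriv_continuous ff.
split; [exact: continuous_locally_integrable|exact: continuous_locally_integrable|].
move=> phi [phis phic].
have dphi : has_deriv phi (derive1 phi).
  by apply: derivable_has_deriv => x; exact: (phis 0%N x I).
have dphi1 : has_deriv (derive1 phi) (derive1 (derive1 phi)).
  by apply: derivable_has_deriv => x; exact: (phis 1%N x I).
set ph1 := derive1 phi in dphi dphi1 *.
have ph1c := has_deriv_continuous dphi1; have phc := has_deriv_continuous dphi.
have [N N0 phN] : exists2 N, 0 < N & forall x, N <= `|x| -> phi x = 0.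
  have [M [_ HM]] := compact_bounded phic.
  exists (`|M| + 1 + 1); first by rewrite addr_gt0 // ltr_wpDl.
  move=> x Nx; apply/eqP; apply: contraT => px.
  have xc : closure [set y | phi y != 0] x by apply: subset_closure.
  have M1 : M < `|M| + 1 by have := ler_norm M; lra.
  by have := HM _ M1 x xc => /= /(le_trans Nx); lra.
(* At [|x| = N] the zero of [phi] says nothing about one side; the larger radius [N + 1] puts [x]
   inside the open set where [phi] vanishes. *)
have ph1N x : N + 1 <= `|x| -> ph1 x = 0.
  move=> Nx; have dx : is_derive x (1 : R) phi 0.
    apply: (@near_eq_is_derive _ _ _ (cst 0) phi) => //.
    have : open [set y : R | N < `|y|].
      apply: (@open_comp _ _ (fun y : R => `|y|) [set z | N < z]).
        by move=> y _; apply: norm_continuous.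
      exact: open_gt.
    move=> o; have : nbhs x [set y : R | N < `|y|].
      by apply: open_nbhs_nbhs; split=> //=; apply: lt_le_trans Nx; rewrite ltrDl.
    by apply: filterS => y /= /ltW/phN ->.
  by rewrite -(@derive_val _ _ _ _ _ _ _ (dphi x)) (@derive_val _ _ _ _ _ _ _ dx).
have N10 : 0 < N + 1 by rewrite addr_gt0.
have phN1 x : N + 1 <= `|x| -> phi x = 0 by move=> H; apply: phN; apply: le_trans H; rewrite lerDl.
rewrite (Rintegral_window N10); [|by cont|by move=> x /ph1N ->; rewrite mulr0].
rewrite (Rintegral_window N10); [|by cont|by move=> x /phN1 ->; rewrite mulr0].
rewrite (intg_byparts _ _ ff dphi) // !phN1 ?normrN ?gtr0_norm // !mulr0 subrr sub0r opprK.
by [].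
Qed.

Lemma has_deriv_weak_deriv f f1 : has_deriv f f1 -> continuous f1 ->
  weak_deriv (fun x => (f x)%:C) (fun x => (f1 x)%:C).
Proof.
move=> ff f1c; split; apply: has_deriv_weak_derivR => //=.
  exact: has_deriv_cst.
exact: continuous_const.
Qed.

Lemma continuous_in_L2 f C : continuous f ->
  (forall N, 0 <= N -> intg (- N) N (fun x => f x ^+ 2) <= C) -> in_L2 (fun x => (f x)%:C).
Proof.
move=> fc fC; split => /=; first exact: continuous_Lfun2 fC.
apply: (@continuous_Lfun2 _ 0); first exact: continuous_const.
by move=> N _; rewrite (eq_intg _ _ (g := fun=> 0)) ?intg0 // => x; rewrite expr0n.
Qed.

(** A nonzero value persists on an interval, which has positive measure. *)
Lemma continuous_not_ae0 f (x : R) : continuous f -> f x != 0 ->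
  ~ (\forall y \ae mu, (f y)%:C = 0 :> R[i]).
Proof.
move=> fc fx [B [mB B0 subB]].
have e0 : 0 < `|f x| / 2 by rewrite divr_gt0 // normr_gt0.
have [d d0 H] := continuous_epsilon_delta x fc e0.
have dB : `[x - d, x + d]%classic `<=` B.
  move=> y; rewrite /= in_itv /= => /andP[y1 y2]; apply: subB => /= -[fy].
  have := H y; rewrite fy sub0r normrN => /(_ _).
  have yx : `|y - x| <= d by rewrite ler_norml; apply/andP; split; lra.
  by move=> /(_ yx); have := normr_gt0 (f x); rewrite fx; lra.
have : (mu (`[(x - d)%R, (x + d)%R]%classic) <= mu B)%E.
  by apply: le_measure => //; rewrite inE //; exact: measurable_itv.
rewrite B0 lebesgue_measure_itv /= lte_fin ifT; last by lra.
by rewrite -EFinD lee_fin; lra.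
Qed.

End LebesgueLink.

Section ComplexForm.
Context {R : realType}.

Lemma eigenmode_solution (K g0 rhoc uc a1 p1 u1 e e1 e2 g g1 g2 : R -> R) (c k sg C : R) :
  0 < k -> 0 < sg ->
  has_deriv (fun x => K (rhoc x)) a1 -> has_deriv rhoc p1 -> has_deriv uc u1 ->
  continuous p1 -> continuous u1 ->
  has_deriv e e1 -> has_deriv g g1 -> has_deriv e1 e2 -> has_deriv g1 g2 ->
  continuous e2 -> continuous g2 -> continuous (potential_m K g0 rhoc) ->
  has_deriv (fun x => K (rhoc x) * e1 x) (fun x =>
    (k ^+ 2 * K (rhoc x) - potential_m K g0 rhoc x) * e x + (uc x - c) * g1 x + sg * g x) ->
  has_deriv (fun x => rhoc x * g1 x + (uc x - c) * e x)
    (fun x => k ^+ 2 * rhoc x * g x - sg * e x) ->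
  (exists x, e x != 0) ->
  (forall N, 0 <= N -> [/\ intg (- N) N (fun x => e x ^+ 2) <= C,
      intg (- N) N (fun x => e1 x ^+ 2) <= C, intg (- N) N (fun x => g x ^+ 2) <= C &
      intg (- N) N (fun x => g1 x ^+ 2) <= C]) ->
  (forall N, 0 <= N -> intg (- N) N (fun x => e2 x ^+ 2) <= C /\
      intg (- N) N (fun x => g2 x ^+ 2) <= C) ->
  exists (sigma k : R) (U LU : (R -> R[i]) * (R -> R[i])),
    [/\ 0 < sigma /\ k != 0,
        in_H2 U.1 /\ in_H2 U.2,
        ~ (\forall x \ae lebesgue_measure, U.1 x = 0 /\ U.2 x = 0),
        linL K g0 c rhoc uc k U LU &
        \forall x \ae lebesgue_measure,
          sigma%:C * U.1 x = (opJ LU).1 x /\ sigma%:C * U.2 x = (opJ LU).2 x].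
Proof.
move=> k0 sg0 da dp du p1c u1c de dg de1 dg1 e2c g2c mc eq1 eq2 [x0 ex0] L2 L2'.
have ec := has_deriv_continuous de; have gc := has_deriv_continuous dg.
have e1c := has_deriv_continuous de1; have g1c := has_deriv_continuous dg1.
have ac := has_deriv_continuous da; have pc := has_deriv_continuous dp.
have uc_c := has_deriv_continuous du.
have He : in_H2 (fun x => (e x)%:C).
  split; first by apply: (@continuous_in_L2 _ _ C ec) => N N0; have [] := L2 N N0.
  exists (fun x => (e1 x)%:C), (fun x => (e2 x)%:C); split.
  - exact: has_deriv_weak_deriv.
  - by apply: (@continuous_in_L2 _ _ C e1c) => N N0; have [] := L2 N N0.
  - exact: has_deriv_weak_deriv.
  - by apply: (@continuous_in_L2 _ _ C e2c) => N N0; have [] := L2' N N0.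
have Hg : in_H2 (fun x => (g x)%:C).
  split; first by apply: (@continuous_in_L2 _ _ C gc) => N N0; have [] := L2 N N0.
  exists (fun x => (g1 x)%:C), (fun x => (g2 x)%:C); split.
  - exact: has_deriv_weak_deriv.
  - by apply: (@continuous_in_L2 _ _ C g1c) => N N0; have [] := L2 N N0.
  - exact: has_deriv_weak_deriv.
  - by apply: (@continuous_in_L2 _ _ C g2c) => N N0; have [] := L2' N N0.
(* The image is [- sg J U], so applying [J] gives back [sg U]. *)
exists sg, k, (fun x => (e x)%:C, fun x => (g x)%:C),
  (fun x => (- (sg * g x))%:C, fun x => (sg * e x)%:C); split=> //=.
- by split=> //; rewrite gt_eqF.
- move=> H; apply: (continuous_not_ae0 ec ex0).
  case: H => B [mB B0 subB]; exists B; split=> // y /= ey; apply: subB => /= -[eq0 _].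
  exact: ey.
- split=> //=.
  exists (fun x => (e1 x)%:C), (fun x => (g1 x)%:C),
    (fun x => ((k ^+ 2 * K (rhoc x) - potential_m K g0 rhoc x) * e x
       + (uc x - c) * g1 x + sg * g x)%:C),
    (fun x => (u1 x * e x + uc x * e1 x)%:C),
    (fun x => (k ^+ 2 * rhoc x * g x - sg * e x - (u1 x * e x + (uc x - c) * e1 x))%:C).
  have prod (f h : R -> R) : (fun x => (f x)%:C * (h x)%:C) = (fun x => (f x * h x)%:C).
    by apply/funext => x; rewrite -rmorphM.
  rewrite !prod; split.
  + by split; exact: has_deriv_weak_deriv.
  + by apply: has_deriv_weak_deriv => //; cont.
  + by apply: has_deriv_weak_deriv; [exact: has_derivM|cont].
  + apply: has_deriv_weak_deriv; last by cont.
    have dw : has_deriv (fun x => (uc x - c) * e x) (fun x => u1 x * e x + (uc x - c) * e1 x).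
      by deriv; ring.
    by apply: (has_deriv_ext (has_derivB eq2 dw)) => // x; rewrite addrK.
  + apply: aeW => x; split; apply/eqP; rewrite eq_complex /=; apply/andP; split;
      apply/eqP; ring.
- by apply: aeW => x; split; apply/eqP; rewrite eq_complex /=; apply/andP; split;
    apply/eqP; ring.
Qed.

End ComplexForm.

(** * Limits at both ends of the line *)

Section Infinity.
Context {R : realType}.
Implicit Types (f g : R -> R).

(** The profile has the same limit at both ends, so one filter treats them together. *)
Definition infty_nbhs : set_system R := [set A | pinfty_nbhs R A /\ ninfty_nbhs R A].

Global Instance infty_nbhs_filter : ProperFilter infty_nbhs.
Proof.
apply: Build_ProperFilter_ex => [A [/filter_ex //]|].
split; first by split; exact: filterT.
- by move=> A B [A1 A2] [B1 B2]; split; exact: filterI.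
- by move=> A B AB [A1 A2]; split; [exact: filterS A1|exact: filterS A2].
Qed.

Lemma infty_nbhsP (A : set R) : infty_nbhs A -> exists2 N, 0 < N & forall x, N <= `|x| -> A x.
Proof.
move=> [[M [_ HM]] [M' [_ HM']]]; exists (`|M| + `|M'| + 1); first by rewrite ltr_wpDl ?addr_ge0.
move=> x; have := ler_norm M; have := ler_norm (- M'); rewrite normrN.
have := normr_ge0 M; have := normr_ge0 M'; have [x0|x0] := ger0P x => *.
  by apply: HM; lra.
by apply: HM'; lra.
Qed.

Lemma cvg_infty (f : R -> R) (l : R) : f x @[x --> +oo] --> l -> f x @[x --> -oo] --> l ->
  f x @[x --> infty_nbhs] --> l.
Proof. by move=> fp fm A Al; split; [exact: fp|exact: fm]. Qed.

Lemma cvg_infty_le (f : R -> R) (l e : R) : f x @[x --> infty_nbhs] --> l -> 0 < e ->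
  exists2 N, 0 < N & forall x, N <= `|x| -> `|f x - l| <= e.
Proof.
move=> fl e0; move/cvgrPdist_le: fl => /(_ e e0)/infty_nbhsP[N N0 H].
by exists N => // x /H; rewrite distrC.
Qed.

Lemma cvg_infty_bounded (f : R -> R) (l : R) : continuous f -> f x @[x --> infty_nbhs] --> l ->
  exists2 B, 0 < B & forall x, `|f x| <= B.
Proof.
move=> fc fl; have [N N0 H] := cvg_infty_le fl ltr01.
have NN : - N <= N by lra.
have fcN : {within `[- N, N], continuous (fun x => `|f x|)}.
  by apply: continuous_subspaceT => x; apply: cvg_norm; exact: fc.
have [z _ zmax] := EVT_max NN fcN.
exists (`|f z| + `|l| + 1); first by rewrite ltr_wpDl ?addr_ge0.
move=> x; have fz0 := normr_ge0 (f z); have l0 := normr_ge0 l.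
have [xN|/ltW Nx] := leP `|x| N.
  by have := zmax x; rewrite in_itv /= -ler_norml => /(_ xN); lra.
by have := H x Nx; have := ler_normD (f x - l) l; rewrite subrK; lra.
Qed.

(** On unit intervals far out the mean value theorem gives points where [f1] is small. The square is
    used because the energy integral of the profile yields a limit for [r^2] before one for [r]. *)
Lemma cvg_infty_derivative (f f1 : R -> R) (l L : R) : has_deriv f f1 -> f x @[x --> infty_nbhs] --> l ->
  (fun x => f1 x ^+ 2) x @[x --> infty_nbhs] --> L -> L = 0.
Proof.
move=> ff fl f1L; apply/eqP; rewrite -normr_le0; apply/ler_addgt0Pr => e e0.
rewrite add0r; pose d := Num.min (e / 8) 1.
have d0 : 0 < d by rewrite /d lt_min ltr01 andbT divr_gt0.
have [de d1] : d <= e / 8 /\ d <= 1 by rewrite /d !ge_min !lexx orbT.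
have [N N0 HN] := cvg_infty_le fl d0.
have [M M0 HM] := cvg_infty_le f1L d0.
pose a := N + M.
have aa : a <= a + 1 by lra.
have [x] := MVT_segment aa (fun x _ => ff x) (has_deriv_cfixed ff (a := a) (b := a + 1)).
rewrite in_itv /= => /andP[ax xa].
have x0 : 0 < x by rewrite /a in ax; lra.
have -> : f1 x * (a + 1 - a) = f1 x by ring.
have a0 : 0 < a by rewrite /a; lra.
move=> E; have := HM x; rewrite (gtr0_norm x0) => /(_ ltac:(rewrite /a in ax; lra)) H.
have := HN a; rewrite (gtr0_norm a0) => /(_ ltac:(rewrite /a; lra)) Ha.
have := HN (a + 1); rewrite (gtr0_norm (addr_gt0 a0 ltr01)) => /(_ ltac:(rewrite /a; lra)) Ha1.
have f1x : `|f1 x| <= 2 * d.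
  rewrite -E; have -> : f (a + 1) - f a = (f (a + 1) - l) - (f a - l) by ring.
  by apply: (le_trans (ler_normB _ _)); lra.
have f1x2 : f1 x ^+ 2 <= 4 * d.
  rewrite -real_normK ?num_real //; apply: (@le_trans _ _ ((2 * d) ^+ 2)).
    by rewrite ler_sqr ?nnegrE // mulr_ge0 // ltW.
  clear -d0 d1; nra.
have := ler_normB (f1 x ^+ 2) (f1 x ^+ 2 - L).
rewrite subKr (ger0_norm (sqr_ge0 _)) => H'.
clear -H' H f1x2 de d0; lra.
Qed.

End Infinity.

Section UniqueZero.
Context {R : realType}.
Implicit Types (f v : R -> R).

Lemma neg_right v v1 z : has_deriv v v1 -> v z <= 0 -> (v z = 0 -> v1 z < 0) ->
  exists2 h, 0 < h & forall x, z < x < z + h -> v x < 0.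
Proof.
move=> dv; rewrite le_eqVlt => /orP[/eqP vz /(_ vz) v1z|vz _].
  have [s [sE sc sz]] := has_deriv_slope dv vz.
  have : \forall x \near z, s x < 0.
    by have := cvgr_lt (s z) sc; apply; rewrite sz.
  move=> /nbhs_ballP[h /= h0 H]; exists h => // x /andP[zx xh].
  rewrite sE pmulr_llt0 ?subr_gt0 //; apply: H.
  by rewrite /ball /= ltr0_norm; lra.
have vc := @has_deriv_continuous _ _ _ dv z.
have : \forall x \near z, v x < 0 by have := cvgr_lt (v z) vc; apply.
move=> /nbhs_ballP[h /= h0 H]; exists h => // x /andP[zx xh]; apply: H.
by rewrite /ball /= ltr0_norm; lra.
Qed.

Lemma pos_left v v1 z : has_deriv v v1 -> 0 <= v z -> (v z = 0 -> v1 z < 0) ->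
  exists2 h, 0 < h & forall x, z - h < x < z -> 0 < v x.
Proof.
move=> dv vz v1z.
have dw : has_deriv (fun x => - v (- x)) (fun x => v1 (- x)).
  have := has_derivN (has_deriv_comp dv (has_derivN (@has_deriv_id R))).
  by move=> H; apply: (has_deriv_eq H) => x /=; ring.
have [||h h0 H] := neg_right (z := - z) dw.
- by rewrite opprK; lra.
- by rewrite opprK => vz0; apply: v1z; lra.
exists h => // x xh; have := H (- x); rewrite opprK => /(_ ltac:(lra)); lra.
Qed.

(* Between two zeros a primitive of [v] would have a minimum, where [v'] cannot be negative. *)
Lemma unique_zero (V v v1 : R -> R) y1 y2 : has_deriv V v -> has_deriv v v1 ->
  (forall x, v x = 0 -> v1 x < 0) -> v y1 = 0 -> v y2 = 0 -> y1 = y2.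
Proof.
move=> dV dv v0.
wlog y12 : y1 y2 / y1 < y2.
  move=> H v1' v2'; have [/H->//|/H->//|//] := ltgtP y1 y2.
move=> vy1 vy2; exfalso.
have [z zI zmin] := EVT_min (ltW y12) (has_deriv_cfixed dV (a := y1) (b := y2)).
move: zI; rewrite in_itv /= => /andP[y1z zy2].
(* At the minimum [z] of [V], either there is room to the right and [v z <= 0], and [V] decreases
   further, or there is room to the left and [0 <= v z], and [V] was smaller before. *)
have [/andP[zlt vz]|] := boolP ((z < y2) && (v z <= 0)).
  have [h h0 H] := neg_right dv vz (@v0 z).
  pose b := Num.min (z + h / 2) y2.
  have zb : z < b by rewrite /b lt_min zlt andbT; lra.
  have [bh by2] : b <= z + h / 2 /\ b <= y2 by rewrite /b !ge_min !lexx orbT.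
  have [x] := MVT zb (fun x _ => dV x) (has_deriv_cfixed dV (a := z) (b := b)).
  rewrite in_itv /= => /andP[zx xb] E.
  have vx : v x < 0 by apply: H; lra.
  have := zmin b; rewrite in_itv /= => /(_ ltac:(lra)).
  by have : v x * (b - z) < 0; [rewrite nmulr_rlt0 // subr_gt0|lra].
move=> zc.
have [y1lt vz] : y1 < z /\ 0 <= v z.
  move: zc; rewrite negb_and -leNgt -ltNge => /orP[y2z|vz].
    have -> : z = y2 by lra.
    by rewrite vy2.
  split; last exact: ltW.
  by rewrite lt_neqAle y1z andbT; apply: contraTneq vz => <-; rewrite vy1 ltxx.
have [h h0 H] := pos_left dv vz (@v0 z).
pose b := Num.max (z - h / 2) y1.
have zb : b < z by rewrite /b gt_max y1lt andbT; lra.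
have [bh by2] : z - h / 2 <= b /\ y1 <= b by rewrite /b !le_max !lexx orbT.
have [x] := MVT zb (fun x _ => dV x) (has_deriv_cfixed dV (a := b) (b := z)).
rewrite in_itv /= => /andP[zx xb] E.
have vx : 0 < v x by apply: H; lra.
have := zmin b; rewrite in_itv /= => /(_ ltac:(lra)).
by have : 0 < v x * (z - b); [rewrite mulr_gt0 // subr_gt0|lra].
Qed.

End UniqueZero.

Section LinearODE.
Context {R : realType}.

(** [E] times [exp(- L x)] is nonincreasing and [E] times [exp(L x)] is nondecreasing; the former is
    used to the right of [y], the latter to the left. *)
Lemma gronwall_zero (E E1 : R -> R) (L y : R) : has_deriv E E1 -> (forall x, 0 <= E x) ->
  (forall x, `|E1 x| <= L * E x) -> E y = 0 -> forall x, E x = 0.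
Proof.
move=> dE E0 EL Ey.
have dexp (s : R) : has_deriv (fun x => expR (s * x)) (fun x => s * expR (s * x)).
  have H : has_deriv (@expR R) expR by move=> x; exact: is_derive_expR.
  by apply: (has_deriv_eq (has_deriv_comp H (has_derivMl s (@has_deriv_id R)))) => x; ring.
have dG s : has_deriv (fun x => E x * expR (s * x)) (fun x => (E1 x + s * E x) * expR (s * x)).
  by apply: (has_deriv_eq (has_derivM dE (dexp s))) => x; ring.
have bnd x : - (L * E x) <= E1 x <= L * E x by rewrite -ler_norml.
move=> x; apply/eqP; rewrite eq_le E0 andbT.
have [yx|/ltW xy] := leP y x.
  have H z : y <= z <= x -> 0 <= - ((E1 z + - L * E z) * expR (- L * z)).
    by move=> _; rewrite oppr_ge0 pmulr_lle0 ?expR_gt0 //; have /andP[_] := bnd z; lra.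
  have := has_deriv_ge (has_derivN (dG (- L))) yx H.
  by rewrite Ey mul0r oppr0 oppr_ge0 pmulr_lle0 // expR_gt0.
have H z : x <= z <= y -> 0 <= (E1 z + L * E z) * expR (L * z).
  by move=> _; rewrite mulr_ge0 ?expR_ge0 //; have /andP[] := bnd z; lra.
by have := has_deriv_ge (dG L) xy H; rewrite Ey mul0r pmulr_lle0 // expR_gt0.
Qed.

(** Gronwall for [r^2 + z^2] with [z = a r'], whose derivative is [2 r z (1 / a - q)]. *)
Lemma second_order_zero (a q r r1 : R -> R) (kap A y : R) : 0 < kap -> (forall x, kap <= a x) ->
  (forall x, `|q x| <= A) -> has_deriv r r1 -> has_deriv (fun x => a x * r1 x) (fun x => - q x * r x) ->
  r y = 0 -> r1 y = 0 -> forall x, r x = 0.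
Proof.
move=> kap0 ak qA rr ode ry r1y x.
have a0 z : 0 < a z := lt_le_trans kap0 (ak z).
pose z x := a x * r1 x.
have dz : has_deriv z (fun x => - q x * r x) by exact: ode.
have dE : has_deriv (fun x => r x ^+ 2 + z x ^+ 2) (fun x => 2 * (r x * r1 x) + 2 * (z x * (- q x * r x))).
  exact: has_derivD (has_deriv_sqr rr) (has_deriv_sqr dz).
suff : r x ^+ 2 + z x ^+ 2 = 0.
  move=> /eqP; rewrite paddr_eq0 ?sqr_ge0 // => /andP[].
  by rewrite sqrf_eq0 => /eqP.
apply: (@gronwall_zero _ _ (kap^-1 + A) y dE) => [t|t|].
- by rewrite addr_ge0 ?sqr_ge0.
- have -> : 2 * (r t * r1 t) + 2 * (z t * (- q t * r t)) = (2 * (r t * z t)) * ((a t)^-1 - q t).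
    by rewrite /z; field; rewrite gt_eqF.
  rewrite normrM mulrC; apply: ler_pM => //.
    apply: (le_trans (ler_normB _ _)); apply: lerD; last exact: qA.
    by rewrite gtr0_norm ?invr_gt0 // lef_pV2 ?posrE.
  rewrite ler_norml; apply/andP; split.
    by have := sqr_ge0 (r t + z t); lra.
  by have := sqr_ge0 (r t - z t); lra.
- by rewrite /z ry r1y mulr0 expr0n addr0.
Qed.

End LinearODE.

(** * The profile as a homoclinic orbit *)

Section Homoclinic.
Context {R : realType}.

Lemma continuous_neq0_sign (d : R -> R) : continuous d -> (forall x, d x != 0) ->
  (forall x, 0 < d x) \/ (forall x, d x < 0).
Proof.
move=> dc d0.
have ivt x y : 0 < d x -> d y < 0 -> False.
  move=> dx dy; pose a := Num.min x y; pose b := Num.max x y.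
  have ab : a <= b by rewrite /a /b le_max !ge_min lexx.
  have dab : {within `[a, b], continuous d} by exact: continuous_subspaceT.
  have [|z _ /eqP] := IVT ab dab (v := 0); last by apply/negP.
  rewrite /a /b ge_min le_max; case: (leP x y) => _;
    by rewrite (ltW dx) (ltW dy) ?orbT.
have cases x : d x < 0 \/ 0 < d x by apply/orP; rewrite -neq_lt.
have [n0|p0] := cases 0; [right|left] => x; have [n|p] := cases x => //; exfalso.
  exact: (ivt x 0).
exact: (ivt 0 x).
Qed.

(* At a critical point of [d] that is not a strict maximum the potential [Phi] would be
   negative just below a value of [d]; but [d] takes all the values in between and
   [Phi (d x) = kr v^2 / 2 >= 0]. *)
Lemma bump_unique_extremum (d v v1 kr Phi phi : R -> R) :
  has_deriv d v -> has_deriv v v1 -> has_deriv Phi phi -> (forall x, 0 < d x) ->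
  d x @[x --> infty_nbhs] --> (0 : R) -> (forall x, 0 < kr x) ->
  (forall x, 2^-1 * kr x * v x ^+ 2 = Phi (d x)) ->
  (forall x, v x = 0 -> v1 x != 0) -> (forall x, v x = 0 -> kr x * v1 x = phi (d x)) ->
  exists x0, [/\ v x0 = 0, v1 x0 < 0 & forall x, x != x0 -> v x != 0].
Proof.
move=> dd dv dPhi d0 dlim kr0 en v1n0 v1E.
have dc := has_deriv_continuous dd; have vc := has_deriv_continuous dv.
have Phi0 x : 0 <= Phi (d x) by rewrite -en mulr_ge0 ?sqr_ge0 // mulr_ge0 // ?invr_ge0 // ltW.
have far e : 0 < e -> exists2 N, 0 < N & forall x, N <= `|x| -> d x <= e.
  move=> e0; have [N N0 H] := cvg_infty_le dlim e0; exists N => // x /H.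
  by rewrite subr0; apply: le_trans; exact: ler_norm.
have neg y : v y = 0 -> v1 y < 0.
  move=> vy; rewrite ltNge le_eqVlt eq_sym (negbTE (v1n0 y vy)) /=; apply/negP => v1y.
  have phiy : 0 < phi (d y) by rewrite -v1E // mulr_gt0.
  have Phiy : Phi (d y) = 0 by rewrite -en vy expr0n mulr0.
  have [||h h0 H] := pos_left (z := d y) (has_derivN dPhi).
  - by rewrite Phiy oppr0.
  - by rewrite oppr_lt0.
  pose t := Num.max (d y - h / 2) (d y / 2).
  have dy := d0 y.
  have ty : t < d y by rewrite /t gt_max; apply/andP; split; lra.
  have [th t2] : d y - h / 2 <= t /\ d y / 2 <= t by rewrite /t !le_max !lexx orbT.
  clearbody t; have t0 : 0 < t by lra.
  have [N N0 HN] := far t t0.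
  pose b := N + `|y|.
  have yb : y <= b by rewrite /b; have := ler_norm y; lra.
  have bN : N <= `|b| by rewrite /b; have := normr_ge0 y; have := ler_norm (N + `|y|); lra.
  have dtc : {within `[y, b], continuous d} by exact: continuous_subspaceT.
  have [|z _ dz] := IVT yb dtc (v := t).
    by rewrite ge_min le_max (HN b bN) (ltW ty) orbT.
  have := H t; rewrite -dz => /(_ ltac:(rewrite dz; lra)).
  by have := Phi0 z; lra.
(* Existence of a critical point: [d] is lower at [N] and [- N] than at 0, so its derivative changes
   sign. *)
have [N N0 HN] := far (d 0 / 2) ltac:(by have := d0 0; lra).
have d00 := d0 0.
have [dN dmN] : d N < d 0 /\ d (- N) < d 0.
  by have := HN N; have := HN (- N); rewrite normrN gtr0_norm // => /(_ (lexx N)) ? /(_ (lexx N)) ?; split; lra.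
have mN0 : - N < 0 by lra.
have [x1] := MVT mN0 (fun x _ => dd x) (has_deriv_cfixed dd (a := - N) (b := 0)).
rewrite in_itv /= => /andP[x11 x12] E1.
have [x2] := MVT N0 (fun x _ => dd x) (has_deriv_cfixed dd (a := 0) (b := N)).
rewrite in_itv /= => /andP[x21 x22] E2.
have vx1 : 0 <= v x1.
  by rewrite leNgt; apply/negP => vx; have : v x1 * (0 - - N) < 0; [rewrite nmulr_rlt0|]; lra.
have vx2 : v x2 <= 0.
  by rewrite leNgt; apply/negP => vx; have : 0 < v x2 * (N - 0); [rewrite mulr_gt0|]; lra.
have x12' : x1 <= x2 by lra.
have vtc : {within `[x1, x2], continuous v} by exact: continuous_subspaceT.
have [|x0 _ vx0] := IVT x12' vtc (v := 0).
  by rewrite ge_min le_max vx1 vx2 orbT.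
exists x0; split=> //; first exact: neg.
move=> x; apply: contra_neq => vx.
exact: (unique_zero dd dv neg).
Qed.

(** [rho] never takes the value [rhoinf]: the energy identity would make [r] vanish there, and then
    [f rhoinf = 0] would make [r1] vanish too. So the wave is one of elevation or of depression; [s]
    records which. *)
Lemma homoclinic_unique_extremum (rho r r1 kr F f : R -> R) (rhoinf : R) :
  has_deriv rho r -> has_deriv r r1 -> has_deriv F f -> F rhoinf = 0 -> f rhoinf = 0 ->
  rho x @[x --> infty_nbhs] --> rhoinf -> (forall x, 0 < kr x) ->
  (forall x, 2^-1 * kr x * r x ^+ 2 = F (rho x)) ->
  (forall x, r x = 0 -> r1 x != 0) -> (forall x, r x = 0 -> kr x * r1 x = f (rho x)) ->
  exists s x0, [/\ s ^+ 2 = 1, r x0 = 0, 0 < s * r1 x0 & forall x, x != x0 -> r x != 0].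
Proof.
move=> dr dr1 dF F0 f0 lim kr0 en r1n0 r1E.
have rho_neq x : rho x - rhoinf != 0.
  rewrite subr_eq0; apply/eqP => rx.
  have rx0 : r x = 0.
    have /eqP := en x; rewrite rx F0 mulf_eq0 sqrf_eq0 => /orP[|/eqP//].
    by rewrite mulf_eq0 invr_eq0 pnatr_eq0 /= gt_eqF.
  have /eqP := r1E x rx0; rewrite rx f0 mulf_eq0 (gt_eqF (kr0 x)) /=.
  by apply/negP; exact: r1n0.
have dd : has_deriv (fun x => rho x - rhoinf) r.
  by apply: (has_deriv_eq (has_derivB dr (has_deriv_cst rhoinf))) => x; rewrite subr0.
have dlim : rho x - rhoinf @[x --> infty_nbhs] --> (0 : R).
  by rewrite -(subrr rhoinf); apply: cvgB => //; exact: cvg_cst.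
have [pos|neg] := continuous_neq0_sign (has_deriv_continuous dd) rho_neq.
  have dPhi : has_deriv (fun t => F (t + rhoinf)) (fun t => f (t + rhoinf)).
    apply: (has_deriv_eq (has_deriv_comp dF (has_derivD (@has_deriv_id R) (has_deriv_cst rhoinf)))).
    by move=> x /=; rewrite addr0 mulr1.
  have [|x|x0 [rx0 r1x0 ne]] := bump_unique_extremum dd dr1 dPhi pos dlim kr0 _ r1n0.
  - by move=> x; rewrite subrK.
  - by rewrite subrK; exact: r1E.
  - by exists (-1), x0; split=> //; [rewrite sqrrN expr1n|lra].
have dPhi : has_deriv (fun t => F (rhoinf - t)) (fun t => - f (rhoinf - t)).
  apply: (has_deriv_eq (has_deriv_comp dF (has_derivB (has_deriv_cst rhoinf) (@has_deriv_id R)))).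
  by move=> x /=; ring.
have dlim' : - (rho x - rhoinf) @[x --> infty_nbhs] --> (0 : R).
  by rewrite -[X in _ --> X]oppr0; exact: cvgN.
have E x : rhoinf - - (rho x - rhoinf) = rho x by ring.
have [| | | |x0 [rx0 r1x0 ne]] := bump_unique_extremum (has_derivN dd) (has_derivN dr1) dPhi _ dlim' kr0.
- by move=> x; rewrite oppr_gt0.
- by move=> x; rewrite E sqrrN.
- by move=> x /eqP; rewrite !oppr_eq0 => /eqP; exact: r1n0.
- by move=> x /eqP; rewrite oppr_eq0 => /eqP rx; rewrite E mulrN r1E.
- exists 1, x0; split; [by rewrite expr1n|by rewrite -[r _]opprK rx0 oppr0|by lra|].
  by move=> x /ne; rewrite oppr_eq0.
Qed.

End Homoclinic.

Section FirstIntegrals.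
Context {R : realType}.

Lemma has_deriv0_constant (f f1 : R -> R) : has_deriv f f1 -> (forall x, f1 x = 0) ->
  forall x y, f x = f y.
Proof.
move=> ff f10 x y; have [xy|/ltW yx] := leP x y.
  by apply: (has_deriv_cst_on ff xy) => z _.
by apply/esym/(has_deriv_cst_on ff yx) => z _.
Qed.

Lemma has_deriv_uniq (f f1 f2 : R -> R) : has_deriv f f1 -> has_deriv f f2 -> f1 =1 f2.
Proof. by move=> /has_derivE <- /has_derivE <-. Qed.

(** On a travelling wave [d/dt = - c d/dx], so the mass and momentum equations become exact
    derivatives in [x]: conservation of flux and Bernoulli's law. Evaluation at [t = 0], [y = 0] is
    enough. *)
Lemma travelling_wave_integrals (K g0 : R -> R) (c : R) (rho u r r1 r2 u1 : R -> R) :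
  smooth_on [set r : R | 0 < r] K -> smooth_on [set r : R | 0 < r] g0 ->
  has_deriv rho r -> has_deriv r r1 -> has_deriv r1 r2 -> has_deriv u u1 ->
  (forall x, 0 < rho x) ->
  euler_korteweg K g0 (fun t x y : R => rho (x - c * t))
        (fun t x y : R => u (x - c * t)) (fun t x y : R => 0) ->
  (forall x y, rho x * (u x - c) = rho y * (u y - c)) /\
  (forall x y (G := fun x => 2^-1 * (u x - c) ^+ 2 + g0 (rho x)
     - (K (rho x) * r1 x + 2^-1 * derive1 K (rho x) * r x ^+ 2)), G x = G y).
Proof.
move=> Ks gs dr dr1 dr2 du rho0 ek.
have shift (f f1 : R -> R) x : has_deriv f f1 -> derive1 (fun t => f (x - c * t)) 0 = - c * f1 x.
  move=> df; have := has_deriv_comp df (has_derivB (has_deriv_cst x) (has_derivMl c (@has_deriv_id R))).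
  by move=> /has_derivE -> /=; rewrite mulr0 subr0; ring.
have st (f : R -> R) : (fun x => f (x - c * 0)) = f by apply/funext => x; rewrite mulr0 subr0.
have dru := has_derivM dr du.
have dK := has_deriv_comp_derivable (fun x => Ks 0%N _ (rho0 x)) dr.
have dK1 := has_deriv_comp_derivable (fun x => Ks 1%N _ (rho0 x)) dr.
have dg := has_deriv_comp_derivable (fun x => gs 0%N _ (rho0 x)) dr.
split.
  apply: (@has_deriv0_constant _ (fun x => r x * (u x - c) + rho x * (u1 x - 0))).
    exact: has_derivM dr (has_derivB du (has_deriv_cst c)).
  move=> x; have [H _ _] := ek 0 x 0; move: H; rewrite /partial_t /partial_x /partial_y.
  rewrite (shift _ _ _ dr) (st (fun z => rho z * u z)) (has_derivE dru) derive1_cst.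
  move=> H; rewrite -[RHS]H; ring.
set S := fun x => K (rho x) * r1 x + 2^-1 * derive1 K (rho x) * r x ^+ 2.
have capE : (fun x => capillarity K (fun t x y : R => rho (x - c * t)) 0 x 0) = S.
  apply/funext => x; rewrite /capillarity /laplacian /sqr_norm_grad /partial_x /partial_y.
  rewrite (st rho) (has_derivE dr).
  rewrite (has_derivE dr1) /S !derive1_cst.
  by rewrite mulr0 subr0; ring.
have dS := has_derivD (has_derivM dK dr2)
  (has_derivM (has_derivMl 2^-1 dK1) (has_deriv_sqr dr1)).
have dG := has_derivB (has_derivD (has_derivMl 2^-1 (has_deriv_sqr (has_derivB du (has_deriv_cst c)))) dg) dS.
move=> x y; apply: (has_deriv0_constant dG) => {x y} x /=.
have [_ H _] := ek 0 x 0; move: H.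
rewrite [in RHS]/partial_x capE (has_derivE dS).
rewrite /partial_t /partial_x /partial_y /comp_density (shift _ _ _ du) (st u).
rewrite (has_derivE du) (st (fun z => g0 (rho z))) (has_derivE dg) derive1_cst.
by rewrite mulr0 subr0 => H; rewrite -[X in _ - X]H; field.
Qed.

End FirstIntegrals.

(** * Coefficients of the linearisation about the solitary wave *)

Section Profile.
Context {R : realType}.

(** The inverse of [f] is continuous with a finite limit, hence bounded. *)
Lemma cvg_infty_gt0_lower (f : R -> R) (l : R) : continuous f -> (forall x, 0 < f x) -> 0 < l ->
  f x @[x --> infty_nbhs] --> l -> exists2 d, 0 < d & forall x, d <= f x.
Proof.
move=> fc f0 l0 fl; have fn x : f x != 0 by rewrite gt_eqF.
have fVl : (f x)^-1 @[x --> infty_nbhs] --> l^-1 by apply: cvgV => //; rewrite gt_eqF.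
have [B B0 HB] := cvg_infty_bounded (continuous_inv fc fn) fVl.
exists B^-1; first by rewrite invr_gt0.
move=> x; rewrite -[f x]invrK lef_pV2 ?posrE ?invr_gt0 //.
exact: le_trans (ler_norm _) (HB x).
Qed.

Lemma cvg_infty_comp (f g : R -> R) (l : R) : derivable f l 1 -> g x @[x --> infty_nbhs] --> l ->
  f (g x) @[x --> infty_nbhs] --> f l.
Proof.
move=> df gl; apply: continuous_cvg => //.
by apply: differentiable_continuous; apply/derivable1_diffP.
Qed.

Lemma cvg_infty_sqr0 (f : R -> R) : (fun x => f x ^+ 2) x @[x --> infty_nbhs] --> (0 : R) ->
  f x @[x --> infty_nbhs] --> (0 : R).
Proof.
move=> f2; apply/cvgrPdist_le => e e0.
have e2 : 0 < e ^+ 2 by rewrite exprn_gt0.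
have /cvgrPdist_le/(_ _ e2) := f2; apply: filterS => x; rewrite !sub0r !normrN => H.
rewrite -(@ler_pXn2r _ 2) ?nnegrE ?(ltW e0) //; apply: le_trans H.
by rewrite real_normK ?num_real // ler_norm.
Qed.

Lemma solitary_wave_coefficients (K g0 : R -> R) (c : R) (rho u : R -> R) (rhoinf uinf : R)
    (w := fun x => u x - c) (q := fun x => potential_m K g0 rho x + w x ^+ 2 / rho x)
    (a1 := fun x => derive1 K (rho x) * derive1 rho x) :
  smooth_on [set r : R | 0 < r] K -> (forall r : R, 0 < r -> 0 < K r) ->
  smooth_on [set r : R | 0 < r] g0 ->
  smooth_on setT rho -> (forall x, 0 < rho x) -> smooth_on setT u ->
  (~ exists p : R * R, forall x : R, (rho x, u x) = p) ->
  euler_korteweg K g0 (fun t x y : R => rho (x - c * t))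
        (fun t x y : R => u (x - c * t)) (fun t x y : R => 0) ->
  0 < rhoinf -> rho x @[x --> infty_nbhs] --> rhoinf -> u x @[x --> infty_nbhs] --> uinf ->
  (uinf - c) ^+ 2 < rhoinf * derive1 g0 rhoinf ->
  exists r r1 r2 kap A x0 Nq,
    [/\ wave_coefficients (fun x => K (rho x)) a1 rho (derive1 rho) w (derive1 u) q
          r r1 r2 kap A x0 Nq,
        forall x, `|a1 x| <= A, forall x, `|derive1 rho x| <= A &
        forall x, `|derive1 u x| <= A].
Proof.
move=> Ks K0 gs rhos rho0 us nonc ek rhoinf0 rhol ul subs.
set r := derive1 rho; pose r1 := derive1 r; pose r2 := derive1 r1; set u1 := derive1 u.
have dr : has_deriv rho r by apply: derivable_has_deriv => x; exact: (rhos 0%N x I).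
have dr1 : has_deriv r r1 by apply: derivable_has_deriv => x; exact: (rhos 1%N x I).
have dr2 : has_deriv r1 r2 by apply: derivable_has_deriv => x; exact: (rhos 2%N x I).
have dr3 : has_deriv r2 (derive1 r2) by apply: derivable_has_deriv => x; exact: (rhos 3%N x I).
have du : has_deriv u u1 by apply: derivable_has_deriv => x; exact: (us 0%N x I).
have du1 : has_deriv u1 (derive1 u1) by apply: derivable_has_deriv => x; exact: (us 1%N x I).
have rn x : rho x != 0 by rewrite gt_eqF.
have dw : has_deriv w u1 by apply: (has_deriv_eq (has_derivB du (has_deriv_cst c))) => x; rewrite subr0.
have dK : has_deriv (fun x => K (rho x)) a1 := has_deriv_comp_derivable (fun x => Ks 0%N _ (rho0 x)) dr.
have dK1 := has_deriv_comp_derivable (fun x => Ks 1%N _ (rho0 x)) dr; rewrite /= in dK1.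
have dK2 := has_deriv_comp_derivable (fun x => Ks 2%N _ (rho0 x)) dr; rewrite /= in dK2.
have dg := has_deriv_comp_derivable (fun x => gs 0%N _ (rho0 x)) dr; rewrite /= in dg.
have dg1 := has_deriv_comp_derivable (fun x => gs 1%N _ (rho0 x)) dr; rewrite /= in dg1.
have [mass_cst bern_cst] := travelling_wave_integrals Ks gs dr dr1 dr2 du rho0 ek.
pose j := rho 0 * w 0.
pose C0 := 2^-1 * (u 0 - c) ^+ 2 + g0 (rho 0) - (K (rho 0) * r1 0 + 2^-1 * derive1 K (rho 0) * r 0 ^+ 2).
have wE x : w x = j / rho x.
  by rewrite /j -(mass_cst x 0) -/(w x); field; exact: rn.
have bern x : K (rho x) * r1 x + 2^-1 * derive1 K (rho x) * r x ^+ 2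
    = 2^-1 * w x ^+ 2 + g0 (rho x) - C0.
  by rewrite /C0 (bern_cst 0 x) /w; ring.
have rhoc := has_deriv_continuous dr; have Kc := has_deriv_continuous dK.
have wcn := has_deriv_continuous dw; have rc := has_deriv_continuous dr1.
have r1c := has_deriv_continuous dr2; have r2c := has_deriv_continuous dr3.
have K1c := has_deriv_continuous dK1; have K2c := has_deriv_continuous dK2.
have gc := has_deriv_continuous dg; have g1c := has_deriv_continuous dg1.
have u1c := has_deriv_continuous du1.
have mE x : potential_m K g0 rho x = derive1 K (rho x) * r1 x
  + 2^-1 * derive1 (derive1 K) (rho x) * r x ^+ 2 - derive1 g0 (rho x) by [].
have a1c : continuous a1 by rewrite /a1 -/r; cont.
have qc : continuous q.
  have -> : q = (fun x => derive1 K (rho x) * r1 x + 2^-1 * derive1 (derive1 K) (rho x) * r x ^+ 2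
      - derive1 g0 (rho x) + w x ^+ 2 / rho x) by apply/funext.
  by cont.
have u1E x : u1 x = - (r x * w x) / rho x.
  have w1E : r x * w x + rho x * u1 x = 0.
    have dj := has_derivM dr dw.
    have j0 : has_deriv (fun x => rho x * w x) (fun=> 0).
      apply: (has_deriv_ext (has_deriv_cst j)) => // z.
      by rewrite wE; field; exact: rn.
    exact: (has_deriv_uniq dj j0).
  by apply: (mulfI (rn x)); rewrite mulrCA divff // mulr1; lra.
(* Bernoulli's law differentiated, with [u'] eliminated by the constant flux; this is where
   [w^2 / rho] joins the potential in [q]. *)
have ode : has_deriv (fun x => K (rho x) * r1 x) (fun x => - q x * r x).
  have H := has_derivB (has_derivB (has_derivD (has_derivMl 2^-1 (has_deriv_sqr dw)) dg) (has_deriv_cst C0))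
    (has_derivM (has_derivMl 2^-1 dK1) (has_deriv_sqr dr1)).
  have E x : (2^-1 * w x ^+ 2 + g0 (rho x) - C0) - 2^-1 * derive1 K (rho x) * r x ^+ 2 = K (rho x) * r1 x.
    by rewrite -bern addrK.
  apply: (has_deriv_ext H E) => x.
  rewrite u1E /q mE; field; exact: rn.
have pos_der (f : R -> R) n : smooth_on [set r : R | 0 < r] f ->
    (derive1n n f) (rho x) @[x --> infty_nbhs] --> (derive1n n f) rhoinf.
  by move=> fs; apply: cvg_infty_comp => //; exact: fs.
have Kl := pos_der K 0%N Ks; have K1l := pos_der K 1%N Ks; have K2l := pos_der K 2%N Ks.
have gl := pos_der g0 0%N gs; have g1l := pos_der g0 1%N gs; rewrite /= in Kl K1l K2l gl g1l.
have wl : w x @[x --> infty_nbhs] --> uinf - c by apply: cvgB => //; exact: cvg_cst.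
have Kinf0 : 0 < K rhoinf by exact: K0.
have [dlt dlt0 rho_ge] := cvg_infty_gt0_lower rhoc rho0 rhoinf0 rhol.
have [kK kK0 K_ge] := cvg_infty_gt0_lower Kc (fun x => K0 _ (rho0 x)) Kinf0 Kl.
(* Bernoulli's law as a function of the density alone. Replacing [s] by the maximum with [dlt] makes
   it continuous on the whole line without changing it on the profile, where [rho] is at least
   [dlt]. *)
pose f s := 2^-1 * (j / Num.max s dlt) ^+ 2 + g0 (Num.max s dlt) - C0.
have max0 s : 0 < Num.max s dlt by rewrite lt_max dlt0 orbT.
have fE x : f (rho x) = K (rho x) * r1 x + 2^-1 * derive1 K (rho x) * r x ^+ 2.
  by rewrite /f max_l // bern wE.
have maxc : continuous (fun s : R => Num.max s dlt) by cont.
have gmc : continuous (fun s : R => g0 (Num.max s dlt)).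
  move=> s; apply: (@continuous_comp _ _ _ (fun s : R => Num.max s dlt) g0); first exact: maxc.
  apply: differentiable_continuous; apply/derivable1_diffP.
  exact: (gs 0%N _ (max0 s)).
have fc : continuous f.
  by rewrite /f; cont => s; rewrite gt_eqF.
pose F s := primitive f s - primitive f rhoinf.
have dF : has_deriv F f.
  by apply: (has_deriv_eq (has_derivB (primitiveP fc) (has_deriv_cst _))) => s; rewrite subr0.
have Finf : F rhoinf = 0 by rewrite /F subrr.
(* Multiplying Bernoulli's law by [r] gives an exact derivative: the second first integral. *)
have [E0 energyE] : exists E0, forall x, 2^-1 * K (rho x) * r x ^+ 2 = F (rho x) + E0.
  have dE := has_derivB (has_derivM (has_derivMl 2^-1 dK) (has_deriv_sqr dr1)) (has_deriv_comp dF dr).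
  exists (2^-1 * K (rho 0) * r 0 ^+ 2 - F (rho 0)) => x.
  rewrite -(has_deriv0_constant dE _ x 0); first by ring.
  by move=> z; rewrite fE /a1 -/r; field.
have dFinf : derivable F rhoinf 1 := @ex_derive _ _ _ _ _ _ _ (dF rhoinf).
have Frl := cvg_infty_comp dFinf rhol; rewrite Finf in Frl.
have r2E x : r x ^+ 2 = 2 * (F (rho x) + E0) / K (rho x).
  by rewrite -energyE; field; rewrite gt_eqF ?K0.
have r2l : (fun x => r x ^+ 2) x @[x --> infty_nbhs] --> 2 * (0 + E0) / K rhoinf.
  under eq_fun do rewrite r2E.
  apply: cvgM; last by apply: cvgV => //; rewrite gt_eqF.
  by apply: cvgM; [exact: cvg_cst|apply: cvgD => //; exact: cvg_cst].
(* [r^2] has a limit by the energy integral, so the limit is 0 and so is [E0]. Then [r1] has a limit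
   by Bernoulli's law, again 0, whence [f rhoinf = 0]. *)
have r2inf := cvg_infty_derivative dr rhol r2l.
have E00 : E0 = 0.
  apply: (mulfI (_ : 2 / K rhoinf != 0)); first by rewrite gt_eqF // divr_gt0.
  by rewrite mulr0 -r2inf add0r; ring.
rewrite r2inf in r2l; have rl := cvg_infty_sqr0 r2l.
have r1E x : r1 x = (f (rho x) - 2^-1 * derive1 K (rho x) * r x ^+ 2) / K (rho x).
  by rewrite fE; field; rewrite gt_eqF ?K0.
have r1l : r1 x @[x --> infty_nbhs] --> (f rhoinf - 2^-1 * derive1 K rhoinf * 0) / K rhoinf.
  under eq_fun do rewrite r1E.
  apply: cvgM; last by apply: cvgV => //; rewrite gt_eqF.
  apply: cvgB; first by apply: continuous_cvg; [exact: fc|exact: rhol].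
  apply: cvgM; last exact: r2l.
  by apply: cvgM; [exact: cvg_cst|exact: K1l].
have r1inf : (f rhoinf - 2^-1 * derive1 K rhoinf * 0) / K rhoinf = 0.
  have r12l : (fun x => r1 x ^+ 2) x @[x --> infty_nbhs] -->
      ((f rhoinf - 2^-1 * derive1 K rhoinf * 0) / K rhoinf) ^+ 2.
    by under eq_fun do rewrite expr2; rewrite expr2; exact: cvgM.
  by have /eqP := cvg_infty_derivative dr1 rl r12l; rewrite sqrf_eq0 => /eqP.
have finf : f rhoinf = 0.
  move/eqP: r1inf; rewrite mulr0 subr0 mulf_eq0 invr_eq0 (gt_eqF Kinf0) orbF.
  by move=> /eqP.
rewrite r1inf in r1l.
have ql : q x @[x --> infty_nbhs] -->
    (derive1 K rhoinf * 0 + 2^-1 * derive1 (derive1 K) rhoinf * 0 - derive1 g0 rhoinf) + (uinf - c) * (uinf - c) / rhoinf.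
  rewrite /q; under eq_fun do rewrite mE expr2.
  apply: cvgD; last first.
    by apply: cvgM; [exact: cvgM|apply: cvgV => //; rewrite gt_eqF].
  apply: cvgB; last exact: g1l.
  apply: cvgD; first exact: (cvgM K1l r1l).
  apply: cvgM; last exact: r2l.
  by apply: cvgM; [exact: cvg_cst|exact: K2l].
set qinf := (X in _ --> X) in ql.
have qinf0 : qinf < 0.
  have -> : qinf = ((uinf - c) ^+ 2 - rhoinf * derive1 g0 rhoinf) / rhoinf.
    by rewrite /qinf; field; rewrite gt_eqF.
  by rewrite pmulr_llt0 ?invr_gt0 // subr_lt0.
(* A deviation of at most [- qinf] from the negative limit [qinf] keeps [q] non-positive. *)
have [Nq Nq0 HNq] := cvg_infty_le ql (e := - qinf) ltac:(by rewrite oppr_gt0).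
have a1l : a1 x @[x --> infty_nbhs] --> derive1 K rhoinf * 0 by exact: (cvgM K1l rl).
have u1l : u1 x @[x --> infty_nbhs] --> - (0 * (uinf - c)) / rhoinf.
  under eq_fun do rewrite u1E.
  by apply: cvgM; [apply: cvgN; exact: cvgM|apply: cvgV => //; rewrite gt_eqF].
have [B1 B10 HB1] := cvg_infty_bounded Kc Kl.
have [B2 B20 HB2] := cvg_infty_bounded rhoc rhol.
have [B3 B30 HB3] := cvg_infty_bounded wcn wl.
have [B4 B40 HB4] := cvg_infty_bounded qc ql.
have [B5 B50 HB5] := cvg_infty_bounded a1c a1l.
have [B6 B60 HB6] := cvg_infty_bounded rc rl.
have [B7 B70 HB7] := cvg_infty_bounded u1c u1l.
pose A := B1 + B2 + B3 + B4 + B5 + B6 + B7.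
(* By uniqueness for the linear equation a double zero would make [r] vanish identically; [rho]
   would be constant, and [u] with it through the flux. *)
have r1n0 x : r x = 0 -> r1 x != 0.
  move=> rx; apply/eqP => r1x; apply: nonc.
  have r00 := second_order_zero kK0 K_ge HB4 dr1 ode rx r1x.
  exists (rho 0, u 0) => z.
  have rz : rho z = rho 0 by apply: (has_deriv0_constant dr).
  by congr pair => //; have := wE z; have := wE 0; rewrite rz => <-; exact: addIr.
have [s [x0 [s2 rx0 r1x0 rne]]] : exists s x0,
    [/\ s ^+ 2 = 1, r x0 = 0, 0 < s * r1 x0 & forall x, x != x0 -> r x != 0].
  apply: (homoclinic_unique_extremum dr dr1 dF Finf finf rhol (fun x => K0 _ (rho0 x))) => //.
    by move=> x; rewrite energyE E00 addr0.
  by move=> x rx; rewrite fE rx expr0n mulr0 addr0.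
have s0 : s != 0 by apply: contra_eq_neq s2 => ->; rewrite expr0n /= eq_sym oner_eq0.
exists (fun x => s * r x), (fun x => s * r1 x), (fun x => s * r2 x), (Num.min kK dlt), A, x0, Nq.
have [BA1 BA2 BA3 BA4] : [/\ B1 <= A, B2 <= A, B3 <= A & B4 <= A].
  by move: B10 B20 B30 B40 B50 B60 B70; rewrite /A; clear; split; lra.
have [BA5 BA6 BA7] : [/\ B5 <= A, B6 <= A & B7 <= A].
  by move: B10 B20 B30 B40 B50 B60 B70; rewrite /A; clear; split; lra.
have dode : has_deriv (fun x => K (rho x) * (s * r1 x)) (fun x => - q x * (s * r x)).
  by apply: (has_deriv_ext (has_derivMl s ode)) => x; rewrite mulrCA.
split; [|by move=> x; exact: le_trans (HB5 x) BA5|by move=> x; exact: le_trans (HB6 x) BA6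
  |by move=> x; exact: le_trans (HB7 x) BA7].
apply: WaveCoefficients.
- exact: dK.
- exact: dr.
- exact: dw.
- exact: a1c.
- exact: rc.
- exact: u1c.
- exact: qc.
- by rewrite lt_min kK0.
- by move=> x; rewrite ge_min K_ge.
- by move=> x; exact: le_trans (le_trans (ler_norm _) (HB1 x)) BA1.
- by move=> x; rewrite ge_min rho_ge orbT.
- by move=> x; exact: le_trans (le_trans (ler_norm _) (HB2 x)) BA2.
- by move=> x; exact: le_trans (HB3 x) BA3.
- by move=> x; exact: le_trans (HB4 x) BA4.
- exact: (has_derivMl s dr1).
- exact: (has_derivMl s dr2).
- by cont.
- exact: dode.
- by rewrite rx0 mulr0.
- exact: r1x0.
- by move=> x /rne; apply: contraNneq => /eqP; rewrite mulf_eq0 (negbTE s0).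
- move=> e e0; have [N N0 HN] := cvg_infty_le rl e0; exists N => x Nx.
  have sn : `|s| = 1 by apply/eqP; rewrite -sqrp_eq1 // real_normK ?num_real // s2.
  rewrite normrM sn mul1r -[r x]subr0; apply: HN; exact: le_trans Nx (ler_norm x).
- by move=> x /HNq; rewrite ler_norml => /andP[_]; rewrite lerBlDr addNr.
Qed.

End Profile.

(** * Square integrability of second derivatives *)

Section SecondDerivatives.
Context {R : realType}.

(** One factor 4 comes from the square of a sum of four terms, the other from adding their four
    integrals. *)
Lemma intg_sqr_lincomb (c1 c2 c3 c4 f1 f2 f3 f4 h : R -> R) (M C N : R) : 0 <= N -> 0 <= M ->
  continuous h -> continuous f1 -> continuous f2 -> continuous f3 -> continuous f4 ->
  (forall x, h x = c1 x * f1 x + c2 x * f2 x + c3 x * f3 x + c4 x * f4 x) ->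
  (forall x, [/\ `|c1 x| <= M, `|c2 x| <= M, `|c3 x| <= M & `|c4 x| <= M]) ->
  [/\ intg (- N) N (fun x => f1 x ^+ 2) <= C, intg (- N) N (fun x => f2 x ^+ 2) <= C,
      intg (- N) N (fun x => f3 x ^+ 2) <= C & intg (- N) N (fun x => f4 x ^+ 2) <= C] ->
  intg (- N) N (fun x => h x ^+ 2) <= 16 * M ^+ 2 * C.
Proof.
move=> N0 M0 hc f1c f2c f3c f4c hE cM [I1 I2 I3 I4].
have NN : - N <= N by lra.
have sq c f : `|c| <= M -> (c * f) ^+ 2 <= M ^+ 2 * f ^+ 2.
  move=> cM'; rewrite exprMn ler_wpM2r ?sqr_ge0 // -real_normK ?num_real //.
  by rewrite ler_sqr ?nnegrE.
have four (u v z t : R) : (u + v + z + t) ^+ 2 <= 4 * (u ^+ 2 + v ^+ 2 + z ^+ 2 + t ^+ 2).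
  rewrite -subr_ge0 (_ : _ - _ = (u - v) ^+ 2 + (u - z) ^+ 2 + (u - t) ^+ 2 + (v - z) ^+ 2
    + (v - t) ^+ 2 + (z - t) ^+ 2); last by ring.
  by rewrite !addr_ge0 ?sqr_ge0.
pose S x := 4 * M ^+ 2 * (f1 x ^+ 2 + f2 x ^+ 2 + f3 x ^+ 2 + f4 x ^+ 2).
have hS : intg (- N) N (fun x => h x ^+ 2) <= intg (- N) N S.
  apply: le_intg => //; [by cont|by rewrite /S; cont|move=> x _].
  rewrite hE; apply: (le_trans (four _ _ _ _)); rewrite /S.
  have [H1 H2 H3 H4] := cM x.
  move: (sq _ (f1 x) H1) (sq _ (f2 x) H2) (sq _ (f3 x) H3) (sq _ (f4 x) H4).
  by clear; lra.
apply: (le_trans hS); rewrite /S intgZ; last by cont.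
rewrite !intgD; try by cont.
have M2 : 0 <= 4 * M ^+ 2 by rewrite mulr_ge0 ?sqr_ge0.
have -> : 16 * M ^+ 2 * C = 4 * M ^+ 2 * (4 * C) by ring.
by apply: ler_wpM2l => //; lra.
Qed.

Lemma norm_div_le (x y B kap : R) : 0 < kap -> kap <= y -> `|x| <= B -> `|x / y| <= B / kap.
Proof.
move=> k0 ky xB; have y0 : 0 < y := lt_le_trans k0 ky.
rewrite normrM normfV (gtr0_norm y0); apply: ler_pM => //.
  by rewrite invr_ge0 ltW.
by rewrite lef_pV2 ?posrE.
Qed.

(** The equations, solved for [e2] and [g2], express them by [e], [e1], [g], [g1] with bounded
    coefficients, since [a] and [p] stay above [kap]. *)
Lemma eigenmode_second_derivatives (a a1 p p1 w w1 q e e1 g g1 : R -> R) (kap A k sg C : R) :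
  0 < kap -> 0 < sg -> has_deriv a a1 -> has_deriv p p1 -> has_deriv w w1 ->
  continuous a1 -> continuous p1 -> continuous w1 -> continuous q ->
  (forall x, [/\ kap <= a x, a x <= A, kap <= p x & p x <= A]) ->
  (forall x, [/\ `|w x| <= A, `|q x| <= A, `|a1 x| <= A, `|p1 x| <= A & `|w1 x| <= A]) ->
  has_deriv e e1 -> has_deriv g g1 ->
  has_deriv (fun x => a x * e1 x) (fun x =>
    (k ^+ 2 * a x - (q x - w x ^+ 2 / p x)) * e x + w x * g1 x + sg * g x) ->
  has_deriv (fun x => p x * g1 x + w x * e x) (fun x => k ^+ 2 * p x * g x - sg * e x) ->
  (forall N, 0 <= N -> [/\ intg (- N) N (fun x => e x ^+ 2) <= C,
      intg (- N) N (fun x => e1 x ^+ 2) <= C, intg (- N) N (fun x => g x ^+ 2) <= C &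
      intg (- N) N (fun x => g1 x ^+ 2) <= C]) ->
  exists e2 g2 C2, [/\ has_deriv e1 e2 /\ has_deriv g1 g2, continuous e2 /\ continuous g2 &
    forall N, 0 <= N -> intg (- N) N (fun x => e2 x ^+ 2) <= C2 /\
      intg (- N) N (fun x => g2 x ^+ 2) <= C2].
Proof.
move=> kap0 sg0 aa pp ww a1c p1c w1c qc ap wq ee gg eq1 eq2 L2.
have a_ge x : kap <= a x by have [] := ap x.
have p_ge x : kap <= p x by have [] := ap x.
have a0 x : a x != 0 by rewrite gt_eqF // (lt_le_trans kap0 (a_ge x)).
have p0 x : p x != 0 by rewrite gt_eqF // (lt_le_trans kap0 (p_ge x)).
have A0 : 0 <= A by have [H _ _ _ _] := wq 0; exact: le_trans (normr_ge0 _) H.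
have de1 := has_deriv_quotient aa a0 eq1.
have eq3 : has_deriv (fun x => p x * g1 x)
    (fun x => k ^+ 2 * p x * g x - sg * e x - (w1 x * e x + w x * e1 x)).
  by apply: (has_deriv_ext (has_derivB eq2 (has_derivM ww ee))) => // x; rewrite addrK.
have dg1 := has_deriv_quotient pp p0 eq3.
set e2 := (X in has_deriv e1 X) in de1; set g2 := (X in has_deriv g1 X) in dg1.
have ec := has_deriv_continuous ee; have gc := has_deriv_continuous gg.
have e1c := has_deriv_continuous de1; have g1c := has_deriv_continuous dg1.
have ac := has_deriv_continuous aa; have pc := has_deriv_continuous pp.
have wc := has_deriv_continuous ww.
have e2c : continuous e2 by rewrite /e2; cont.
have g2c : continuous g2 by rewrite /g2; cont.
(* [B] dominates the numerator of every coefficient, and division by [a] or [p] costs at most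
   [kap^-1]. *)
pose B := k ^+ 2 * A + 2 * A + A ^+ 2 / kap + sg; pose M := B / kap.
have t1 : 0 <= k ^+ 2 * A by rewrite mulr_ge0 ?sqr_ge0.
have t2 : 0 <= A ^+ 2 / kap by rewrite divr_ge0 ?sqr_ge0 // ltW.
have M0 : 0 <= M by rewrite divr_ge0 ?(ltW kap0) // /B; lra.
have ka x : `|k ^+ 2 * a x| <= k ^+ 2 * A.
  have [H1 H2 _ _] := ap x; rewrite ger0_norm ?ler_wpM2l ?sqr_ge0 //.
  by rewrite mulr_ge0 ?sqr_ge0 //; lra.
have kp x : `|k ^+ 2 * p x| <= k ^+ 2 * A.
  have [_ _ H1 H2] := ap x; rewrite ger0_norm ?ler_wpM2l ?sqr_ge0 //.
  by rewrite mulr_ge0 ?sqr_ge0 //; lra.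
have w2p x : `|w x ^+ 2 / p x| <= A ^+ 2 / kap.
  apply: norm_div_le => //; rewrite normrX ler_sqr ?nnegrE //.
  by have [] := wq x.
exists e2, g2, (16 * M ^+ 2 * C); split=> // N N0.
have [L1 L2' L3 L4] := L2 N N0; split.
- apply: (@intg_sqr_lincomb (fun x => (k ^+ 2 * a x - (q x - w x ^+ 2 / p x)) / a x)
    (fun x => - a1 x / a x) (fun x => sg / a x) (fun x => w x / a x) e e1 g g1 e2 M C N) => //.
    by move=> x; rewrite /e2; field; rewrite a0 p0.
  move=> x; have [H1 H2 H3 H4 H5] := wq x.
  split; apply: norm_div_le; rewrite ?normrN ?(gtr0_norm sg0) // /B; try lra.
  apply: (le_trans (ler_normB _ _)).
  have := ler_normB (q x) (w x ^+ 2 / p x); have := ka x; have := w2p x.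
  by move: H2 t1 t2 A0 sg0; clear; lra.
- apply: (@intg_sqr_lincomb (fun x => (- (sg + w1 x)) / p x)
    (fun x => - w x / p x) (fun x => k ^+ 2 * p x / p x) (fun x => - p1 x / p x)
    e e1 g g1 g2 M C N) => //.
    by move=> x; rewrite /g2; field; rewrite p0.
  move=> x; have [H1 H2 H3 H4 H5] := wq x.
  split; apply: norm_div_le; rewrite ?normrN // /B.
  + by apply: (le_trans (ler_normD _ _)); rewrite (gtr0_norm sg0); lra.
  + lra.
  + by have := kp x; lra.
  + lra.
Qed.

End SecondDerivatives.

Theorem theorem3p2 (R : realType) (K g0 : R -> R)
    (K_smooth : smooth_on [set r : R | 0 < r] K)
    (K_pos : forall r : R, 0 < r -> 0 < K r)
    (g0_smooth : smooth_on [set r : R | 0 < r] g0)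
    (c : R) (rhoc uc : R -> R)
    (rhoc_smooth : smooth_on setT rhoc)
    (rhoc_pos : forall x : R, 0 < rhoc x)
    (uc_smooth : smooth_on setT uc)
    (nonconstant :
      ~ exists q : R * R, forall x : R, (rhoc x, uc x) = q)
    (travelling_wave :
      euler_korteweg K g0 (fun t x y : R => rhoc (x - c * t))
        (fun t x y : R => uc (x - c * t)) (fun t x y : R => 0))
    (rhoinf uinf : R) (rhoinf_pos : 0 < rhoinf)
    (rhoc_pinfty : rhoc x @[x --> +oo] --> rhoinf)
    (rhoc_ninfty : rhoc x @[x --> -oo] --> rhoinf)
    (uc_pinfty : uc x @[x --> +oo] --> uinf)
    (uc_ninfty : uc x @[x --> -oo] --> uinf)
    (subsonic : (uinf - c) ^+ 2 < rhoinf * derive1 g0 rhoinf) :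
  exists (sigma k : R) (U LU : (R -> R[i]) * (R -> R[i])),
    [/\ 0 < sigma /\ k != 0,
        in_H2 U.1 /\ in_H2 U.2,
        ~ (\forall x \ae lebesgue_measure, U.1 x = 0 /\ U.2 x = 0),
        linL K g0 c rhoc uc k U LU &
        \forall x \ae lebesgue_measure,
          sigma%:C * U.1 x = (opJ LU).1 x /\ sigma%:C * U.2 x = (opJ LU).2 x].
Proof.
have [r [r1 [r2 [kap [A [x0 [Nq [wc a1A p1A u1A]]]]]]]] :=
  solitary_wave_coefficients K_smooth K_pos g0_smooth rhoc_smooth rhoc_pos uc_smooth
    nonconstant travelling_wave rhoinf_pos (cvg_infty rhoc_pinfty rhoc_ninfty)
    (cvg_infty uc_pinfty uc_ninfty) subsonic.
have [k [sg [C [e [e1 [g [g1 [[k0 sg0] [de dg eq1 eq2] ne0 L2]]]]]]]] := classical_eigenmode wc.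
case: wc => aa pp ww a1c p1c w1c qc kap0 a_ge a_le p_ge p_le w_le q_le _ _ _ _ _ _ _ _ _.
have [e2 [g2 [C2 [[de1 dg1] [e2c g2c] L2']]]] := eigenmode_second_derivatives kap0 sg0 aa pp ww a1c
  p1c w1c qc (fun x => And4 (a_ge x) (a_le x) (p_ge x) (p_le x))
  (fun x => And5 (w_le x) (q_le x) (a1A x) (p1A x) (u1A x)) de dg eq1 eq2 L2.
have du : has_deriv uc (derive1 uc).
  by apply: derivable_has_deriv => x; exact: (uc_smooth 0%N x I).
pose w x := uc x - c.
have mE x : potential_m K g0 rhoc x = potential_m K g0 rhoc x + w x ^+ 2 / rhoc x - w x ^+ 2 / rhoc x.
  by rewrite addrK.
have rc0 x : rhoc x != 0 by rewrite gt_eqF.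
have pc := has_deriv_continuous pp; have wc := has_deriv_continuous ww.
apply: (@eigenmode_solution _ K g0 rhoc uc _ _ _ e e1 e2 g g1 g2 c k sg (Num.max C C2)
  k0 sg0 aa pp du p1c w1c de dg de1 dg1 e2c g2c _ _ eq2 ne0).
- have -> : potential_m K g0 rhoc = (fun x => (potential_m K g0 rhoc x + w x ^+ 2 / rhoc x) - w x ^+ 2 / rhoc x).
    by apply/funext => x.
  by apply: continuous_add; [exact: qc|cont].
- by apply: (has_deriv_eq eq1) => x; rewrite addrK.
- by move=> N /L2[*]; split; rewrite le_max; apply/orP; left.
- by move=> N /L2'[*]; split; rewrite le_max; apply/orP; right.
Qed.
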